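(* Let $\nu\neq 0$ be a symmetric Lévy measure on $\mathbb{R}$ with Lévy exponent $\psi(\theta)=\int_{\mathbb{R}}(1-\cos(\theta y))\,\nu(dy)$, let $\Lambda$ be the homogeneous Lévy basis on $\mathbb{R}^2$ corresponding to $\nu$, and let $g:[0,\infty)\to[0,\infty)$ be a trawl function satisfying Assumption (G) with parameter $\gamma\in(0,1)$. Assume that at least one of the following holds: (i) there exist $\kappa,\alpha$ with $2\ge\kappa>1+\gamma$, $0\le\alpha<1+\gamma$, and a finite constant $C>0$ such that $$\psi(u)\le C\,\big(|u|^\kappa\wedge|u|^\alpha\big),\qquad u\in\mathbb{R};$$ (ii) $\psi$ is nondecreasing on $[0,\infty)$, $$\int_{\mathbb{R}}\psi(u)|u|^{-2-\gamma}\,du<\infty,$$ and $\sup_{u>0}u^{2+\gamma}|g'(u)|\le C$ for some finite constant $C>0$. Let $$Y_T(t)=\frac{1}{F_T}\int_0^{Tt}X_s\,ds,\quad t\ge0,\qquad F_T=T^{\frac{1}{1+\gamma}},$$ where $X_s=\Lambda(A_s)$ is the trawl process determined by $\Lambda$ and $g$. Then, as $T\to\infty$, the processes $Y_T$ converge in the sense of finite-dimensional distributions to $K\xi^{(1+\gamma)}$, where $\xi^{(1+\gamma)}$ is a symmetric $(1+\gamma)$-stable Lévy process and $K$ is a positive constant.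
   Context: A symmetric Lévy measure on $\mathbb{R}$ is a symmetric Borel measure $\nu$ with $\nu(\{0\})=0$ and $\int_{\mathbb{R}}(1\wedge|y|^2)\,\nu(dy)<\infty$. The homogeneous Lévy basis $\Lambda$ on $\mathbb{R}^2$ corresponding to $\nu$ is a family $(\Lambda(B))_{B\in\mathcal{E}}$ of real random variables, where $\mathcal{E}$ is the class of Borel subsets of $\mathbb{R}^2$ with finite Lebesgue measure, such that: (1) $\Lambda$ is independently scattered, i.e. for pairwise disjoint $B_1,B_2,\ldots\in\mathcal{E}$ the variables $\Lambda(B_1),\Lambda(B_2),\ldots$ are independent, and if moreover $\bigcup_j B_j\in\mathcal{E}$ then $\Lambda(\bigcup_j B_j)=\sum_j\Lambda(B_j)$; (2) $\mathbb{E}\exp(i\theta\Lambda(B))=\exp(-|B|\psi(\theta))$ for all $B\in\mathcal{E}$, $\theta\in\mathbb{R}$, where $|B|$ is the Lebesgue measure of $B$ and $\psi(\theta)=\int_{\mathbb{R}}(1-\cos(\theta y))\,\nu(dy)$. Assumption (G): the trawl function $g:[0,\infty)\to[0,\infty)$ is continuous, integrable, strictly decreasing, continuously differentiable on $(0,\infty)$, and $\lim_{x\to\infty}x^{2+\gamma}|g'(x)|=C_g$ for some $\gamma\in(0,1)$ and $C_g>0$. Trawl sets and trawl process: $A_t=\{(x,y):x\le t,\ 0\le y\le g(t-x)\}$ and $X_t=\Lambda(A_t)$, $t\ge 0$. A symmetric $\beta$-stable Lévy process is a Lévy process $\xi^{(\beta)}$ with $\mathbb{E}\exp(i\theta\xi^{(\beta)}_t)=\exp(-t|\theta|^\beta)$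 (the normalization being immaterial because of the constant $K$). $a\wedge b=\min(a,b)$. *)

(* Defs.v *)
From HB Require Import structures.
From mathcomp Require Export all_boot all_order all_algebra.
From mathcomp Require Export finmap.
From mathcomp.real_closed Require Export complex.
From mathcomp Require Export all_classical all_reals all_analysis.
Export Order.TTheory GRing.Theory Num.Theory.
Export numFieldNormedType.Exports.

Set Implicit Arguments.
Unset Strict Implicit.
Unset Printing Implicit Defensive.

Local Open Scope classical_set_scope.
Local Open Scope ring_scope.

Definition mutually_independent (R : realType) (d : measure_display)
    (Omega : measurableType d) (P : probability Omega R)
    (I : choiceType) (X : I -> Omega -> R) : Prop :=
  forall (J : {fset I}) (B : I -> set R),
    (forall i, measurable (B i)) ->
    P (\bigcap_(i in [set` J]) (X i @^-1` B i)) =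
    (\prod_(i <- J) P (X i @^-1` B i))%E.

Definition same_law (R : realType) (d : measure_display)
    (Omega : measurableType d) (P : probability Omega R)
    (X Y : Omega -> R) : Prop :=
  forall B : set R, measurable B -> P (X @^-1` B) = P (Y @^-1` B).

(** [E exp(i theta X)], through the expectations of its real and imaginary
    parts. *)
Definition char_fun (R : realType) (d : measure_display)
    (Omega : measurableType d) (P : probability Omega R)
    (X : Omega -> R) (theta : R) : R[i] :=
  Complex (fine ('E_P[fun w => cos (theta * X w)])%E)
          (fine ('E_P[fun w => sin (theta * X w)])%E).

Record symmetric_levy_measure (R : realType)
    (nu : {measure set R -> \bar R}) : Prop := {
  levy_symmetric : forall B : set R, measurable B -> nu (-%R @^-1` B) = nu B ;
  levy_no_atom0 : nu [set 0] = 0%E ;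
  levy_integral : (\int[nu]_y (Num.min 1 (`|y| ^+ 2))%:E < +oo)%E }.

Definition levy_exponent (R : realType) (nu : {measure set R -> \bar R})
    (theta : R) : R :=
  \int[nu]_y (1 - cos (theta * y)).

Definition area (R : realType) : set (R * R) -> \bar R :=
  (@lebesgue_measure R \x @lebesgue_measure R)%E.

Definition finite_area (R : realType) (B : set (R * R)) : Prop :=
  measurable B /\ (area B < +oo)%E.

(** [Lambda] is indexed by all subsets of the plane, but only its values on
    [finite_area] sets are constrained.  Equalities of random variables are
    almost sure ones, so the series in [basis_additive] converges a.s. *)
Record homogeneous_levy_basis (R : realType) (d : measure_display)
    (Omega : measurableType d) (P : probability Omega R)
    (nu : {measure set R -> \bar R})
    (Lambda : set (R * R) -> {RV P >-> R}) : Prop := {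
  basis_independent : forall B : nat -> set (R * R),
    (forall j, finite_area (B j)) -> trivIset setT B ->
    mutually_independent P (fun j => Lambda (B j) : Omega -> R) ;
  basis_additive : forall B : nat -> set (R * R),
    (forall j, finite_area (B j)) -> trivIset setT B ->
    finite_area (\bigcup_j B j) ->
    {ae P, forall w,
      (\sum_(0 <= j < n) Lambda (B j) w) @[n --> \oo]
        --> Lambda (\bigcup_j B j) w} ;
  basis_char_fun : forall (B : set (R * R)) (theta : R), finite_area B ->
    char_fun P (Lambda B) theta =
    (expR (- (fine (area B) * levy_exponent nu theta)))%:C%C }.

(** The values of [g] on the negative half-line are irrelevant. *)
Record trawl_function (R : realType) (gamma : R) (g : R -> R) : Prop := {
  trawl_ge0 : forall x : R, 0 <= x -> 0 <= g x ;
  trawl_continuous : {within `[0, +oo[, continuous g} ;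
  trawl_integrable :
    (@lebesgue_measure R).-integrable `[0, +oo[ (EFin \o g) ;
  trawl_decreasing : forall x y : R, 0 <= x -> x < y -> g y < g x ;
  trawl_derivable : forall x : R, 0 < x -> derivable g x 1 ;
  trawl_derive_continuous : forall x : R, 0 < x ->
    {for x, continuous (derive1 g)} ;
  trawl_derive_tail : exists2 Cg : R, 0 < Cg &
    (x `^ (2 + gamma) * `|derive1 g x|) @[x --> +oo] --> Cg }.

Definition trawl_set (R : realType) (g : R -> R) (t : R) : set (R * R) :=
  [set p | p.1 <= t /\ 0 <= p.2 <= g (t - p.1)].

(** [Lambda (trawl_set g t)] is determined, for each [t], up to a null set
    only.  The time integral of its paths is that of a jointly measurable
    version. *)
Record trawl_process (R : realType) (d : measure_display)
    (Omega : measurableType d) (P : probability Omega R)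
    (Lambda : set (R * R) -> {RV P >-> R}) (g : R -> R)
    (X : R -> Omega -> R) : Prop := {
  trawl_process_measurable :
    measurable_fun ([set s : R | 0 <= s] `*` [set: Omega])
      (fun p : R * Omega => X p.1 p.2) ;
  trawl_process_version : forall t : R, 0 <= t ->
    {ae P, forall w, X t w = Lambda (trawl_set g t) w} }.

Definition normalized_integral (R : realType) (d : measure_display)
    (Omega : measurableType d) (gamma : R) (X : R -> Omega -> R)
    (T t : R) (w : Omega) : R :=
  (T `^ (1 / (1 + gamma)))^-1 *
  \int[@lebesgue_measure R]_(s in `[0, T * t]) X s w.

Record levy_process (R : realType) (d : measure_display)
    (Omega : measurableType d) (P : probability Omega R)
    (xi : R -> {RV P >-> R}) : Prop := {
  levy_start : {ae P, forall w, xi 0 w = 0} ;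
  levy_independent_increments : forall t : nat -> R,
    0 <= t 0 -> (forall i, t i <= t i.+1) ->
    mutually_independent P (fun (i : nat) w => xi (t i.+1) w - xi (t i) w) ;
  levy_stationary_increments : forall s t : R, 0 <= s -> s <= t ->
    same_law P (fun w => xi t w - xi s w) (xi (t - s)) ;
  levy_stochastic_continuity : forall (t eps : R), 0 <= t -> 0 < eps ->
    P [set w | eps < `|xi s w - xi t w|]
      @[s --> within [set s | 0 <= s] (nbhs t)] --> 0%E }.

Record symmetric_stable_levy_process (R : realType) (d : measure_display)
    (Omega : measurableType d) (P : probability Omega R) (beta : R)
    (xi : R -> {RV P >-> R}) : Prop := {
  stable_levy : levy_process xi ;
  stable_char_fun : forall t theta : R, 0 <= t ->
    char_fun P (xi t) theta = (expR (- (t * `|theta| `^ beta)))%:C%C }.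

(** For all times [t_0, ..., t_(n-1) >= 0], the vectors
    [(Y T t_0, ..., Y T t_(n-1))] converge in law as [T] goes to infinity,
    in the sense of bounded continuous test functions on [R^n]. *)
Definition fdd_cvg (R : realType)
    (d : measure_display) (Omega : measurableType d) (P : probability Omega R)
    (d' : measure_display) (Omega' : measurableType d')
    (P' : probability Omega' R)
    (Y : R -> R -> Omega -> R) (Z : R -> Omega' -> R) : Prop :=
  forall (n : nat) (t : 'I_n -> R), (forall i, 0 <= t i) ->
  forall f : 'rV[R]_n -> R, continuous f ->
    (exists M : R, forall x, `|f x| <= M) ->
    ('E_P[fun w => f (\row_i Y T (t i) w)])%E @[T --> +oo] -->
    ('E_P'[fun w => f (\row_i Z (t i) w)])%E.

(* Main.v *)
(* Characteristic functions turn the theorem into a deterministic limit.  A finite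
   linear combination of time integrals of [X] is the integral against [Lambda]
   of the occupation function
     f (x, y) = sum_j th_j * |{s in [0, T t_j] : (x, y) in A_s}|,
   so its characteristic function is exp (- area integral of psi (f / F_T)).  In
   the variable [r] with [y = g r], a point contributes the length of the
   intersection of [0, T t_j] and [x, x + r].  Rescaling by [x = T x'] and
   [r = F_T u], the density [T * F_T * |g' (F_T u)|] tends to
   [Cg * u ^ (- 2 - gamma)] and the integrand to
   psi (u * sum_j th_j 1_{0 <= x' < t_j}); the limit splits as
   [Cg * int psi (u) u ^ (- 2 - gamma) du] times
   [int |sum_j th_j 1_{0 <= x < t_j}| ^ (1 + gamma) dx], which is the exponent of a
   symmetric (1 + gamma)-stable process.

   Convergence in law then follows from Levy's continuity theorem, proved through
   the density of trigonometric polynomials on large cubes and a tail estimate.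
   The passage from Riemann sums to time integrals uses that [s |-> X s] is
   continuous in L^1, a consequence of the finiteness of
   [int psi (u) u ^ (- 2 - gamma) du]. *)

From HB Require Import structures.
Require Import Defs.
From mathcomp Require Import measurable_realfun ring lra.

Set Implicit Arguments.
Unset Strict Implicit.
Unset Printing Implicit Defensive.

Local Open Scope classical_set_scope.
Local Open Scope ring_scope.

(** * Trigonometric polynomials *)

(** Both hypotheses on psi fit one scheme: psi is bounded by a function [p], nondecreasing on the
    half-line, with p (u) u ^ (- 2 - gamma) integrable. Monotonicity matters because the rescaled
    occupation function is known only through upper bounds on its absolute value. Three ranges of u
    behave differently. Up to r0 / F_T the density |g'| has no power bound: this range is empty when
    r0 = 0, and otherwise the decay of [p] at 0 and the integrability of g' make it negligible.
    Beyond E = T / F_T the trawl is wider than the time horizon, the occupation time saturates, and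
    the contribution is of order p (c E) E ^ (- 1 - gamma), which tends to 0. In between, dominated
    convergence applies. Matching exponents gives K ^ (1 + gamma) = Cg * int_0^oo psi (u) u ^ (- 2 -
    gamma) du. All the laws are symmetric, so the sine parts vanish and only real exponents are
    compared. The estimates are in L^1 because X may have an infinite variance, while E |Z| is
    controlled by 1 - E cos (u Z) integrated against u ^ (- 2). *)

Lemma continuous_affine_comb (R : realType) (T : topologicalType) (h k : T -> R)
    (c a : R) (x : T) : {for x, continuous h} -> {for x, continuous k} ->
  {for x, continuous (fun x => c * h x - a + k x)}.
Proof.
move=> ch ck; apply: cvgD => //; apply: cvgB; last exact: cvg_cst.
by apply: cvgM => //; exact: cvg_cst.
Qed.

Section trigonometric_approximation.
Context {R : realType} {n : nat}.
Implicit Types (f g : 'rV[R]_n -> R) (th : 'I_n -> R) (a b c L M e : R).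

Definition lin_form th (x : 'rV[R]_n) : R := \sum_i th i * x 0 i.

(** The free phase [b] covers sines, so the class stays real; its induction principle reduces
    products and expectations to single cosines. *)
Inductive trig_poly : ('rV[R]_n -> R) -> Prop :=
| trig_poly_cos a b th : trig_poly (fun x => a * cos (lin_form th x + b))
| trig_poly_add f g : trig_poly f -> trig_poly g ->
    trig_poly (fun x => f x + g x).

Lemma lin_formD th th' x :
  lin_form (fun i => th i + th' i) x = lin_form th x + lin_form th' x.
Proof. by rewrite -big_split/=; apply: eq_bigr => i _; rewrite mulrDl. Qed.

Lemma lin_formB th th' x :
  lin_form (fun i => th i - th' i) x = lin_form th x - lin_form th' x.
Proof. by rewrite -sumrB; apply: eq_bigr => i _; rewrite mulrBl. Qed.

Lemma lin_form0 x : lin_form (fun=> 0) x = 0.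
Proof. by rewrite /lin_form big1// => i _; rewrite mul0r. Qed.

Lemma trig_poly_cst a : trig_poly (fun=> a).
Proof.
have -> : (fun=> a) = (fun x => a * cos (lin_form (fun=> 0) x + 0)).
  by apply/funext => x; rewrite lin_form0 addr0 cos0 mulr1.
exact: trig_poly_cos.
Qed.

(** Product-to-sum formula: cos A cos B = (cos (A + B) + cos (A - B)) / 2, with linear forms that
    add and subtract coefficientwise. *)
Lemma trig_polyM f g : trig_poly f -> trig_poly g ->
  trig_poly (fun x => f x * g x).
Proof.
elim=> [a b th|f1 f2 _ ih1 _ ih2] tg; last first.
  under eq_fun do rewrite mulrDl.
  by apply: trig_poly_add; [exact: ih1|exact: ih2].
elim: tg => [c d th'|f1 f2 _ ih1 _ ih2]; last first.
  by under eq_fun do rewrite mulrDr; exact: trig_poly_add.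
have -> : (fun x => a * cos (lin_form th x + b) * (c * cos (lin_form th' x + d)))
  = (fun x => a * c / 2 * cos (lin_form (fun i => th i + th' i) x + (b + d)) +
              a * c / 2 * cos (lin_form (fun i => th i - th' i) x + (b - d))).
  apply/funext => x; rewrite lin_formD lin_formB.
  rewrite addrACA [X in _ + _ * cos X](_ : _ =
    (lin_form th x + b) - (lin_form th' x + d)); last by ring.
  by rewrite (cosD (lin_form th x + b) (lin_form th' x + d)) cosB; field.
by apply: trig_poly_add; exact: trig_poly_cos.
Qed.

Lemma trig_poly_bounded f : trig_poly f -> exists2 M, 0 < M & forall x, `|f x| <= M.
Proof.
elim=> [a b th|f1 f2 _ [M1 M10 f1M] _ [M2 M20 f2M]].
  exists (`|a| + 1) => [|x]; first by rewrite ltr_wpDl.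
  rewrite normrM (@le_trans _ _ `|a|) ?lerDl//.
  by rewrite ler_piMr// cos_max.
exists (M1 + M2) => [|x]; first exact: addr_gt0.
by rewrite (le_trans (ler_normD _ _))// lerD.
Qed.

(** Bohr almost periodic functions: the closure of the trigonometric polynomials for uniform
    convergence on the whole space. Unlike the polynomials themselves, this class is stable under
    maxima and minima. *)
Definition almost_periodic f := forall e, 0 < e ->
  exists2 p, trig_poly p & forall x, `|f x - p x| <= e.

Lemma trig_poly_ap f : trig_poly f -> almost_periodic f.
Proof. by move=> tf e e0; exists f => // x; rewrite subrr normr0 ltW. Qed.

Lemma ap_closed f : (forall e, 0 < e ->
  exists2 p, almost_periodic p & forall x, `|f x - p x| <= e) ->
  almost_periodic f.
Proof.
move=> h e e0; have e20 : 0 < e / 2 by rewrite divr_gt0.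
have [p /(_ _ e20)[q tq pq] fp] := h _ e20.
exists q => // x; rewrite [X in `|X|](_ : _ = (f x - p x) + (p x - q x)); last by ring.
by rewrite (le_trans (ler_normD _ _))// [leRHS](splitr e) lerD.
Qed.

Lemma apD f g : almost_periodic f -> almost_periodic g ->
  almost_periodic (fun x => f x + g x).
Proof.
move=> hf hg e e0; have [|p tp fp] := hf (e / 2); first by rewrite divr_gt0.
have [|q tq gq] := hg (e / 2); first by rewrite divr_gt0.
exists (fun x => p x + q x); first exact: trig_poly_add.
move=> x; rewrite [X in `|X|](_ : _ = (f x - p x) + (g x - q x)); last by ring.
by rewrite (le_trans (ler_normD _ _))// [leRHS](splitr e) lerD.
Qed.

Lemma ap_cst a : almost_periodic (fun=> a).
Proof. exact/trig_poly_ap/trig_poly_cst. Qed.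

Lemma apM f g : almost_periodic f -> almost_periodic g ->
  almost_periodic (fun x => f x * g x).
Proof.
move=> hf hg e e0.
(* The approximation within 1 serves only to bound [f] by M + 1. The order of choices is [q] from
   that bound, then [p] from a bound N of [q]. *)
have [//|p0 /trig_poly_bounded[M M0 pM] fp0] := hf 1.
have [|q tq gq] := hg (e / (2 * (M + 1))); first by rewrite divr_gt0// mulr_gt0// addr_gt0.
have [N N0 qN] := trig_poly_bounded tq.
have [|p tp fp] := hf (e / (2 * N)); first by rewrite divr_gt0// mulr_gt0.
exists (fun x => p x * q x); first exact: trig_polyM.
move=> x.
rewrite [X in `|X|](_ : _ = f x * (g x - q x) + (f x - p x) * q x); last by ring.
rewrite (le_trans (ler_normD _ _))// [leRHS](splitr e) lerD// normrM.
  apply: (@le_trans _ _ ((M + 1) * (e / (2 * (M + 1))))).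
    apply: ler_pM => //.
    rewrite -[f x](subrK (p0 x)) (le_trans (ler_normD _ _))// addrC lerD//.
  by rewrite le_eqVlt; apply/orP; left; apply/eqP; field; rewrite gt_eqF// addr_gt0.
apply: (@le_trans _ _ (e / (2 * N) * N)); first exact: ler_pM.
by rewrite le_eqVlt; apply/orP; left; apply/eqP; field; rewrite gt_eqF.
Qed.

Lemma apZ a f : almost_periodic f -> almost_periodic (fun x => a * f x).
Proof. by apply: apM; exact: ap_cst. Qed.

Lemma apN f : almost_periodic f -> almost_periodic (fun x => - f x).
Proof. by move=> /(apZ (-1)); under eq_fun do rewrite mulN1r. Qed.

Lemma ap_bounded f : almost_periodic f -> exists2 M, 0 < M & forall x, `|f x| <= M.
Proof.
move=> /(_ 1 ltr01)[p /trig_poly_bounded[M M0 pM] fp].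
exists (M + 1) => [|x]; first by rewrite addr_gt0.
by rewrite -[f x](subrK (p x)) (le_trans (ler_normD _ _))// addrC lerD.
Qed.

(** The classical polynomial iteration for the absolute value, that is for the square root of t ^ 2,
    on [-1, 1]. *)
Fixpoint abs_approx (k : nat) (t : R) : R :=
  if k is k'.+1 then
    abs_approx k' t + (t ^+ 2 - abs_approx k' t ^+ 2) / 2
  else 0.

(** With s = |t| and e = s - p, the next error is e * (1 - (s + p) / 2), at most e * (1 - e / 2)
    because s + p >= s - p. The map e -> e * (1 - e / 2) is nondecreasing on [0, 1] and sends 2 / m
    to 2 * (m - 1) / m ^ 2, below 2 / (m + 1); this propagates the rate 2 / (k + 2). *)
Lemma abs_approxP k t : `|t| <= 1 ->
  0 <= abs_approx k t <= `|t| /\ `|t| - abs_approx k t <= 2 / k.+2%:R.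
Proof.
move=> t1; elim: k => [|k [/andP[p0 pt] ih]] /=.
  by rewrite lexx normr_ge0 subr0 divff.
have t0 : 0 <= `|t| by [].
rewrite -(real_normK (num_real t)).
set s := `|t| in t1 t0 pt ih *; set p := abs_approx k t in p0 pt ih *.
have -> : p + (s ^+ 2 - p ^+ 2) / 2 = s - (s - p) * (1 - (s + p) / 2) by field.
have h1 : 0 <= (s - p) * (1 - (s + p) / 2) by apply: mulr_ge0; lra.
have h2 : (s - p) * (1 - (s + p) / 2) <= s - p.
  by rewrite ler_piMr//; lra.
split; first by apply/andP; split; lra.
rewrite opprB addrCA subrr addr0.
have h3 : (s - p) * (1 - (s + p) / 2) <= (s - p) * (1 - (s - p) / 2).
  by apply: ler_wpM2l; lra.
apply: (le_trans h3).
set e := s - p in ih *.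
have e1 : e <= 1 by rewrite /e; lra.
have e0 : 0 <= e by rewrite /e; lra.
set m : R := k.+2%:R in ih *.
have m2 : 2 <= m by rewrite /m ler_nat.
have m0 : 0 < m by lra.
have -> : k.+3%:R = m + 1 by rewrite /m -natr1.
have e2 : e * (1 - e / 2) <= 2 / m * (1 - 2 / m / 2).
  have i1 : 2 / m <= 1 by rewrite ler_pdivrMr// mul1r.
  set c := 2 / m in ih i1 *.
  have : 0 <= (c - e) * (1 - (c + e) / 2) by apply: mulr_ge0; lra.
  by rewrite [X in 0 <= X](_ : _ = c * (1 - c / 2) - e * (1 - e / 2)) ?subr_ge0//; field.
apply: (le_trans e2).
rewrite -subr_ge0 [X in 0 <= X](_ : _ = 2 / (m ^+ 2 * (m + 1))); last first.
  by field; rewrite !gt_eqF//; lra.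
by rewrite divr_ge0// mulr_ge0// ?exprn_ge0//; lra.
Qed.

(** [abs_approx] converges only on [-1, 1], hence the division by a bound of [f]; a polynomial in an
    almost periodic function is almost periodic. The choice of k gives 2 / (k + 2) <= e. *)
Lemma ap_abs f : almost_periodic f -> almost_periodic (fun x => `|f x|).
Proof.
move=> hf; have [M M0 fM] := ap_bounded hf.
have -> : (fun x => `|f x|) = (fun x => M * `|M^-1 * f x|).
  apply/funext => x; rewrite normrM gtr0_norm ?invr_gt0// mulrA mulfV ?mul1r//.
  by rewrite gt_eqF.
apply/apZ/ap_closed => e e0.
pose h x := M^-1 * f x.
have ah : almost_periodic h by exact: apZ.
have h1 x : `|h x| <= 1.
  by rewrite normrM gtr0_norm ?invr_gt0// ler_pdivrMl// mulr1.
pose k := Num.truncn (2 / e).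
exists (abs_approx k \o h).
  elim: (k) => [|j ihj] /=; first exact: ap_cst.
  apply: apD => //=.
  under eq_fun do rewrite mulrC !expr2; apply/apZ/apD; first exact: apM.
  by apply/apN/apM.
move=> x /=; have [/andP[_ le1] le2] := abs_approxP k (h1 x).
rewrite ger0_norm ?subr_ge0//; apply: (le_trans le2).
rewrite ler_pdivrMr// mulrC -ler_pdivrMr//.
have /ltW/le_trans -> // : 2 / e < k.+1%:R by rewrite truncnS_gt.
by rewrite ler_nat.
Qed.

Lemma ap_max f g : almost_periodic f -> almost_periodic g ->
  almost_periodic (fun x => Num.max (f x) (g x)).
Proof.
move=> hf hg; under eq_fun do rewrite maxr_absE mulrC.
by apply/apZ/apD; [exact: apD|apply/ap_abs/apD => //; exact: apN].
Qed.

Lemma ap_min f g : almost_periodic f -> almost_periodic g ->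
  almost_periodic (fun x => Num.min (f x) (g x)).
Proof.
move=> hf hg; under eq_fun do rewrite minr_absE mulrC.
by apply/apZ/apD; [exact: apD|apply/apN/ap_abs/apD => //; exact: apN].
Qed.

Lemma ap_sum (I : Type) (s : seq I) (F : I -> 'rV[R]_n -> R) :
  (forall i, almost_periodic (F i)) ->
  almost_periodic (fun x => \sum_(i <- s) F i x).
Proof.
move=> hF; elim: s => [|i s ih].
  by under eq_fun do rewrite big_nil; exact: ap_cst.
by under eq_fun do rewrite big_cons; exact: apD.
Qed.

(** A periodic substitute for the distance to [p]. Dividing by L keeps the arguments in [-2, 2] when
    both points lie in the cube of half-side L; there, inside [-pi, pi], 1 - cos grows with the
    absolute value. *)
Definition cos_dist (L : R) (p x : 'rV[R]_n) : R :=
  \sum_i (1 - cos ((x 0 i - p 0 i) / L)).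

Lemma ap_cos_dist L p : almost_periodic (cos_dist L p).
Proof.
apply: ap_sum => i; apply: apD; first exact: ap_cst.
apply: apN; apply: trig_poly_ap.
have -> : (fun x : 'rV[R]_n => cos ((x 0 i - p 0 i) / L)) =
  (fun x => 1 * cos (lin_form (fun j => if j == i then L^-1 else 0) x + - p 0 i / L)).
  apply/funext => x; rewrite mul1r /lin_form (bigD1 i)//= eqxx big1 ?addr0.
    by rewrite mulrBl mulrC mulNr.
  by move=> j /negPf ->; rewrite mul0r.
exact: trig_poly_cos.
Qed.

Lemma cos_dist_ge0 L p x : 0 <= cos_dist L p x.
Proof. by apply: sumr_ge0 => i _; rewrite subr_ge0 cos_le1. Qed.

Lemma continuous_cos_dist L p : continuous (cos_dist L p).
Proof.
have h i : continuous (fun y : R => 1 - cos ((y - p 0 i) / L)).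
  move=> y; apply: cvgB; first exact: cvg_cst.
  apply: (@continuous_comp _ _ _ (fun y : R => (y - p 0 i) / L)); last exact: continuous_cos.
  by apply: cvgM; [apply: cvgB; [exact: cvg_id|exact: cvg_cst]|exact: cvg_cst].
apply: (continuous_big (op := +%R)) => [|i _]; first exact: add_continuous.
by move=> x; exact: (continuous_comp (@coord_continuous R 1 n 0 i x) (h i _)).
Qed.

Lemma cos_dist_gt L (p x : 'rV[R]_n) i d : 0 < L -> 0 < d ->
  d <= L * 2 -> d <= `|x 0 i - p 0 i| <= L * 2 ->
  1 - cos (d / L) <= cos_dist L p x.
Proof.
move=> L0 d0 dL /andP[dx xL].
rewrite /cos_dist (bigD1 i)//= -[leLHS]addr0 lerD//; last first.
  by apply: sumr_ge0 => j _; rewrite subr_ge0 cos_le1.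
rewrite lerD2l lerNr opprK -(cos_norm (_ / L)) normrM (gtr0_norm (_ : 0 < L^-1)) ?invr_gt0//.
have decr : {in `[0, pi] &, {homo @cos R : x y /~ x < y}}.
  by move=> a b ha hb ab; rewrite ltr_cos.
have inpi y : 0 <= y -> y <= L * 2 -> y / L \in `[0, pi].
  move=> y0 yL; rewrite in_itv/= divr_ge0 ?(ltW L0)//= (@le_trans _ _ 2) ?pi_ge2//.
  by rewrite ler_pdivrMr// mulrC.
by rewrite (le_nmono_in decr) ?inpi ?(ltW d0)// ler_pM2r// invr_gt0.
Qed.


Definition cube (L : R) : set 'rV[R]_n := [set x | forall i, `|x 0 i| <= L].

Lemma compact_cube L : compact (cube L).
Proof.
have := @rV_compact R n (fun=> `[-L, L]%classic) (fun=> @segment_compact _ _ _).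
congr (compact _); apply/seteqP; split => x /= h i.
  by have := h i; rewrite /= in_itv/= ler_norml.
by have := h i; rewrite /= in_itv/= ler_norml.
Qed.

(* The lattice form of Stone-Weierstrass, in the spirit of McShane's
   extension: on the cube, f is close to the maximum of f p - C p * d(p, x)
   over finitely many points p, d being itself a trigonometric polynomial. *)
Lemma trig_poly_dense_cube f M L e : continuous f -> (forall x, `|f x| <= M) ->
  0 < L -> 0 < e ->
  exists2 p, trig_poly p &
    (forall x, cube L x -> `|f x - p x| <= e) /\ (forall x, `|p x| <= M + e).
Proof.
move=> cf fM L0 e0.
have e30 : 0 < e / 3 by rewrite divr_gt0.
have M0 : 0 <= M by exact: le_trans (fM 0).
have /choice[C hC] : forall p, exists C, 0 <= C /\ (cube L p ->
    forall x, cube L x -> f p - C * cos_dist L p x <= f x + e / 3).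
  (* Points outside the cube receive the dummy constant 0; the finite cover below uses only points
     of the cube. *)
  move=> p; have [Kp|nKp] := pselect (cube L p); last by exists 0; split.
  have /cvgrPdist_lt /(_ _ e30) /nbhs_ballP[d0 /= d00 hd] := cf p.
  pose d := Num.min (d0 / 2) (L * 2).
  have dgt0 : 0 < d by rewrite lt_min divr_gt0// mulr_gt0.
  have dL : d <= L * 2 by rewrite ge_min lexx orbT.
  have dd0 : d < d0 by rewrite gt_min ltr_pdivrMr// ltr_pMr ?ltr1n.
  have c0 : 0 < 1 - cos (d / L).
    rewrite subr_gt0 -cos0 ltr_cos ?divr_gt0// in_itv/= ?lexx ?pi_ge0//.
    rewrite divr_ge0 ?(ltW dgt0) ?(ltW L0)//= (le_trans _ (@pi_ge2 R))//.
    by rewrite ler_pdivrMr// mulrC.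
  (* If some coordinate moves by at least d, then [cos_dist] is at least 1 - cos (d / L), so the
     cone based at [p] has dropped by 2 * M and lies below - M <= f x. Closer to [p], continuity of
     [f] gives the bound. *)
  exists (2 * M / (1 - cos (d / L))); split; first by rewrite divr_ge0// ?mulr_ge0// ltW.
  move=> _ x Kx; have [px|/existsNP[i /negP]] := pselect (forall i, `|x 0 i - p 0 i| < d).
    have bpx : ball p d0 x.
      split=> // i j; rewrite ord1 /ball/= distrC; exact: lt_trans dd0.
    have /= := hd _ bpx.
    have : 0 <= 2 * M / (1 - cos (d / L)) * cos_dist L p x.
      by rewrite mulr_ge0 ?cos_dist_ge0// divr_ge0// ?mulr_ge0// ltW.
    by move: (f p) (f x) (_ * _) => a b c c1; rewrite ltr_norml; lra.
  rewrite -leNgt => dx.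
  have : 1 - cos (d / L) <= cos_dist L p x.
    apply: (@cos_dist_gt _ _ _ i) => //; rewrite dx/= (le_trans (ler_normB _ _))//.
    by rewrite mulr_natr mulr2n lerD.
  move=> kD; have : 2 * M <= 2 * M / (1 - cos (d / L)) * cos_dist L p x.
    by rewrite mulrAC ler_pdivlMr// ler_wpM2l// mulr_ge0.
  have := fM p; have := fM x; rewrite !ler_norml.
  by move: (2 * M / _ * _) => c; move: e0; lra.
(* On this open set the cone based at [p] exceeds f - 2 * e / 3; it contains [p] since
   [cos_dist L p p] vanishes. *)
pose U p := [set x | C p * cos_dist L p x - f p + f x < 2 * e / 3].
have oU p : open (U p).
  have -> : U p = (fun x => C p * cos_dist L p x - f p + f x) @^-1` [set y | y < 2 * e / 3] by [].
  apply: open_comp; last exact: open_lt.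
  by move=> x _; apply: continuous_affine_comb; [exact: continuous_cos_dist|exact: cf].
have KU : cube L `<=` cover (cube L) U.
  move=> x Kx; exists x => //; rewrite /U/= /cos_dist big1 ?mulr0.
    by rewrite add0r addNr divr_gt0// mulr_gt0.
  by move=> i _; rewrite subrr mul0r cos0 subrr.
have := @compact_cube L; rewrite compact_cover => /(_ _ _ _ (fun p _ => oU p) KU)[D DK KD].
pose g x := \big[Num.max/(- M)]_(p <- D) (f p - C p * cos_dist L p x).
have apg : almost_periodic g.
  rewrite /g; elim: {DK KD g} (enum_fset D) => [|p s ih].
    by under eq_fun do rewrite big_nil; exact: ap_cst.
  under eq_fun do rewrite big_cons; apply: ap_max => //.
  by apply/apD; [exact: ap_cst|apply/apN/apZ/ap_cos_dist].
(* Capping at M, while the maximum starts from - M, bounds the approximation off the cube, where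
   nothing ties it to [f]. Neither cap spoils the estimates on the cube because |f| <= M. *)
have apg' : almost_periodic (fun x => Num.min M (g x)) by apply: ap_min => //; exact: ap_cst.
have [p tp gp] := apg' _ e30; exists p => //.
have gM x : - M <= Num.min M (g x) <= M.
  rewrite le_min ge_min lexx/= andbT; apply/andP; split; first by move: M0; lra.
  rewrite /g; elim: (enum_fset D) => [|q s ih]; first by rewrite big_nil.
  by rewrite big_cons le_max ih orbT.
split=> [x Kx|x]; last first.
  have := gM x; have := gp x; rewrite !ler_norml; move: e0; lra.
have gf : g x <= f x + e / 3.
  rewrite /g; have : {subset enum_fset D <= cube L} by move=> q /DK.
  elim: (enum_fset D) => [|q s ih] sD.
    by rewrite big_nil; have := fM x; rewrite ler_norml; move: e0; lra.
  rewrite big_cons ge_max ih ?andbT; last by move=> r rs; apply: sD; rewrite inE rs orbT.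
  have [_ ->//] := hC q; apply: set_mem; apply: sD; exact: mem_head.
have fg : f x - 2 * e / 3 <= g x.
  have [q /= qD] := KD _ Kx; rewrite /U/= => Uq.
  apply: (@le_trans _ _ (f q - C q * cos_dist L q x)); first by move: Uq; lra.
  have : q \in enum_fset D by [].
  rewrite /g; elim: (enum_fset D) => // r s ih; rewrite inE big_cons le_max.
  by move=> /predU1P[->|/ih ->]; rewrite ?lexx ?orbT.
have : f x - 2 * e / 3 <= Num.min M (g x) <= f x + e / 3.
  rewrite le_min fg ge_min gf orbT !andbT.
  by have := fM x; rewrite ler_norml; move: e0; lra.
have := gp x; rewrite !ler_norml; lra.
Qed.

End trigonometric_approximation.

(** * Levy's continuity theorem *)

Section trigonometric_inequalities.
Context {R : realType}.
Implicit Types x y : R.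

Lemma norm_sin_le x : `|sin x| <= `|x|.
Proof.
have h (y : R) : 0 <= y -> `|sin y| <= y.
  move=> y0; have cs : {within `[0, y], continuous (@sin R)}.
    by apply: continuous_subspaceT; exact: continuous_sin.
  have [c _] := @MVT_segment R sin cos 0 y y0 (fun z _ => is_derive_sin z) cs.
  rewrite sin0 !subr0 => ->; rewrite normrM (ger0_norm y0).
  by rewrite ler_piMl// cos_max.
have [x0|/ltW x0] := leP 0 x; first by rewrite (ger0_norm x0) h.
by rewrite -normrN -sinN (ler0_norm x0) h// oppr_ge0.
Qed.

Lemma cosB_prod x y : cos x - cos y = - 2 * sin ((x + y) / 2) * sin ((x - y) / 2).
Proof.
have -> : cos x = cos ((x + y) / 2 + (x - y) / 2) by congr cos; field.
have -> : cos y = cos ((x + y) / 2 - (x - y) / 2) by congr cos; field.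
by rewrite cosB cosD; ring.
Qed.

Lemma sinB_prod x y : sin x - sin y = 2 * cos ((x + y) / 2) * sin ((x - y) / 2).
Proof.
have -> : sin x = sin ((x + y) / 2 + (x - y) / 2) by congr sin; field.
have -> : sin y = sin ((x + y) / 2 - (x - y) / 2) by congr sin; field.
by rewrite sinB sinD; ring.
Qed.

Lemma cos_lip x y : `|cos x - cos y| <= `|x - y|.
Proof.
rewrite cosB_prod !normrM normrN (ger0_norm (_ : 0 <= 2))//.
have := norm_sin_le ((x - y) / 2); rewrite normrM [X in _ <= _ * X]ger0_norm// => h.
have : `|sin ((x + y) / 2)| * `|sin ((x - y) / 2)| <= `|sin ((x - y) / 2)|.
  by rewrite ler_piMl// sin_max.
by move: h; lra.
Qed.

Lemma sin_lip x y : `|sin x - sin y| <= `|x - y|.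
Proof.
rewrite sinB_prod !normrM (ger0_norm (_ : 0 <= 2))//.
have := norm_sin_le ((x - y) / 2); rewrite normrM [X in _ <= _ * X]ger0_norm// => h.
have : `|cos ((x + y) / 2)| * `|sin ((x - y) / 2)| <= `|sin ((x - y) / 2)|.
  by rewrite ler_piMl// cos_max.
by move: h; lra.
Qed.

Lemma onemcos_le x : 1 - cos x <= x ^+ 2.
Proof.
have -> : 1 - cos x = 2 * `|sin (x / 2)| ^+ 2.
  rewrite real_normK ?num_real// {1}(_ : x = x / 2 + x / 2); last by field.
  by rewrite cosD -!expr2 cos2sin2; ring.
rewrite -[leRHS](real_normK (num_real x)).
have := norm_sin_le (x / 2); rewrite normrM [X in _ <= _ * X]ger0_norm// => h.
have : `|sin (x / 2)| ^+ 2 <= (`|x| / 2) ^+ 2 by rewrite lerXn2r// nnegrE divr_ge0.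
have : 0 <= `|x| ^+ 2 by rewrite exprn_ge0.
by rewrite expr_div_n; lra.
Qed.

Lemma onemcos_ge0 x : 0 <= 1 - cos x.
Proof. by rewrite subr_ge0 cos_le1. Qed.

Lemma onemcos_le2 x : 1 - cos x <= 2.
Proof. by have := cos_geN1 x; lra. Qed.

Lemma measurable_cos : measurable_fun setT (@cos R).
Proof. by apply: continuous_measurable_fun; exact: continuous_cos. Qed.

Lemma measurable_sin : measurable_fun setT (@sin R).
Proof. by apply: continuous_measurable_fun; exact: continuous_sin. Qed.

End trigonometric_inequalities.

Section bounded_functions.
Context {R : realType} d (T : measurableType d) (P : probability T R).
Implicit Types (f g : T -> R) (M : R).

Lemma bounded_integrable f M : measurable_fun setT f ->
  (forall w, `|f w| <= M) -> P.-integrable setT (EFin \o f).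
Proof.
move=> mf fM; apply: measurable_bounded_integrable => //.
  by rewrite (le_lt_trans (probability_le1 P measurableT))// ltry.
exists M; split; first exact: num_real.
by move=> x Mx w _ /=; rewrite (le_trans (fM w))// ltW.
Qed.

Lemma expectationE f : ('E_P[f])%E = (\int[P]_w (f w)%:E)%E.
Proof. by rewrite unlock. Qed.

Lemma expectation_bounded f M : measurable_fun setT f ->
  (forall w, `|f w| <= M) -> ('E_P[f])%E = (\int[P]_w f w)%:E.
Proof.
move=> mf fM; rewrite expectationE /Rintegral fineK//.
by apply: integrable_fin_num => //; exact: bounded_integrable fM.
Qed.

Lemma integral_prob_cst (a : R) : (\int[P]_w a%:E = a%:E)%E.
Proof.
have -> : (\int[P]_w a%:E = a%:E * P setT)%E by rewrite integral_cst.
by have -> := @probability_setT _ _ _ P; rewrite mule1.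
Qed.

Lemma Rintegral_prob_cst (a : R) : \int[P]_w a = a.
Proof. by rewrite /Rintegral integral_prob_cst. Qed.

Lemma Rintegral_bounded f M : measurable_fun setT f ->
  (forall w, `|f w| <= M) -> `|\int[P]_w f w| <= M.
Proof.
move=> mf fM; have fi := bounded_integrable mf fM.
rewrite (le_trans (le_normr_Rintegral _ fi))//.
rewrite -[leRHS]Rintegral_prob_cst; apply: le_Rintegral => //.
- exact: integrable_norm.
- exact: finite_measure_integrable_cst.
Qed.

End bounded_functions.

Section restricted_integral.
Context d (T : measurableType d) {R : realType} (mu : {measure set T -> \bar R}).

(** Moves the domain into the integrand, the form in which Tonelli's theorem is applied
    throughout. *)
Lemma integral_mul_indic (D : set T) (h : T -> R) :
  (\int[mu]_(u in D) (h u)%:E = \int[mu]_u (h u * \1_D u)%:E)%E.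
Proof.
rewrite integral_mkcond; apply: eq_integral => u _.
by rewrite patchE indicE; case: (u \in D); rewrite ?mulr1 ?mulr0.
Qed.

End restricted_integral.

Section truncation_inequality.
Context {R : realType}.
Notation mu := (@lebesgue_measure R).

(* Its expectation is an average of [1 - E cos (u Y)], while it is at least 1/2
   where [2 <= |Y|]: this is how characteristic functions control tails. *)
Definition averaged_onemcos (v : R) : \bar R :=
  (\int[mu]_(u in `[0%R, 1%R]) (1 - cos (u * v))%:E)%E.

Lemma averaged_onemcos_ge0 v : (0 <= averaged_onemcos v)%E.
Proof. by apply: integral_ge0 => u _; rewrite lee_fin onemcos_ge0. Qed.

Lemma averaged_onemcosE v : v != 0 ->
  averaged_onemcos v = (1 - sin v / v)%:E.
Proof.
move=> v0; pose F u := u - sin (u * v) / v.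
have dF (u : R) : is_derive u 1 F (1 - cos (u * v)).
  rewrite /F; apply: is_derive_eq.
  by rewrite /GRing.scale/=; field.
have dFd (u : R) : derivable F u 1 by have [] := dF u.
have cF : continuous F by move=> u; apply: differentiable_continuous; exact/derivable1_diffP.
rewrite /averaged_onemcos (@continuous_FTC2 R _ F)//.
- by rewrite /F mul1r mul0r sin0 mul0r subr0 -EFinB subr0.
- apply: continuous_subspaceT => u; apply: cvgB; first exact: cvg_cst.
  apply: (@continuous_comp _ _ _ (fun u : R => u * v)); last exact: continuous_cos.
  by apply: cvgM; [exact: cvg_id|exact: cvg_cst].
- split; first by move=> u _; exact: dFd.
    by apply: cvg_at_right_filter; exact: cF.
  by apply: cvg_at_left_filter; exact: cF.
- by move=> u _; rewrite derive1E; exact: derive_val.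
Qed.

Lemma averaged_onemcos_ge v : 2 <= `|v| -> ((1 / 2)%:E <= averaged_onemcos v)%E.
Proof.
move=> v2; have v0 : v != 0 by rewrite -normr_gt0 (lt_le_trans _ v2).
rewrite averaged_onemcosE// lee_fin.
have : `|sin v / v| <= 1 / 2.
  rewrite normrM normfV ler_pdivrMr ?(lt_le_trans _ v2)//.
  by rewrite (le_trans (sin_max v))//; lra.
by rewrite ler_norml; lra.
Qed.

End truncation_inequality.

Section averaged_truncation.
Context {R : realType} d (T : measurableType d) (P : probability T R).
Notation mu := (@lebesgue_measure R).
Local Open Scope ereal_scope.

Let integrand (Y : T -> R) (p : R * T) : \bar R :=
  ((1 - cos (p.1 * Y p.2)) * \1_`[0%R, 1%R] p.1)%:E.

Let measurable_integrand (Y : T -> R) : measurable_fun setT Y ->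
  measurable_fun setT (integrand Y).
Proof.
move=> mY; apply/measurable_EFinP; apply: measurable_funM.
  apply: measurable_funB; first exact: measurable_cst.
  apply: (measurableT_comp measurable_cos).
  by apply: measurable_funM => //; exact: measurableT_comp.
have mi : measurable_fun setT (\1_`[0%R, 1%R] : R -> R) by exact: measurable_indic.
exact: (measurableT_comp mi).
Qed.

Let integrand_ge0 (Y : T -> R) p : 0 <= integrand Y p.
Proof. by rewrite lee_fin mulr_ge0// onemcos_ge0. Qed.

Lemma measurable_averaged_onemcos (Y : T -> R) : measurable_fun setT Y ->
  measurable_fun setT (fun w => averaged_onemcos (Y w)).
Proof.
move=> mY; under eq_fun do rewrite /averaged_onemcos integral_mul_indic.
exact: (@measurable_fun_fubini_tonelli_G _ _ _ _ _ mu _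
  (measurable_integrand mY) (integrand_ge0 Y)).
Qed.

Lemma integral_averaged_onemcos (Y : T -> R) : measurable_fun setT Y ->
  \int[P]_w averaged_onemcos (Y w) =
  \int[mu]_(u in `[0%R, 1%R]) (1 - \int[P]_w cos (u * Y w))%:E.
Proof.
move=> mY.
rewrite [LHS](_ : _ = \int[P]_w \int[mu]_u integrand Y (u, w)); last first.
  by apply: eq_integral => w _; rewrite /averaged_onemcos integral_mul_indic.
rewrite -(@fubini_tonelli _ _ _ _ _ mu P (integrand Y)) //; last exact: measurable_integrand.
rewrite integral_mul_indic; apply: eq_integral => u _ /=.
rewrite /integrand/=.
have mc : measurable_fun setT (fun w => cos (u * Y w)).
  by apply: (measurableT_comp measurable_cos); exact: measurable_funM.
have ic := @bounded_integrable _ _ _ P _ 1%R mc (fun w => cos_max _).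
have i1 : P.-integrable setT (EFin \o cst (1%R : R)) by exact: finite_measure_integrable_cst.
have -> : (1 - \int[P]_w cos (u * Y w) = \int[P]_w (1 - cos (u * Y w)))%R.
  by rewrite RintegralB// Rintegral_prob_cst.
rewrite -RintegralZr//; last by apply: (integrableB _ i1 ic).
rewrite /Rintegral fineK//; apply: integrable_fin_num => //.
have mm : measurable_fun setT (fun w => ((1 - cos (u * Y w)) * \1_`[0%R, 1%R] u)%R).
  by apply: measurable_funM => //; exact: measurable_funB.
apply: (@bounded_integrable _ _ _ P _ 2%R mm) => w.
rewrite ger0_norm ?mulr_ge0 ?onemcos_ge0//.
by rewrite indicE; case: (u \in _); rewrite ?mulr1 ?onemcos_le2// mulr0.
Qed.

End averaged_truncation.

Section tails.
Context {R : realType} d (T : measurableType d) (P : probability T R).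
Notation mu := (@lebesgue_measure R).
Local Open Scope ereal_scope.

Lemma averaged_onemcos_le (v c : R) : (forall u, `[0%R, 1%R]%classic u -> 1 - cos (u * v) <= c)%R ->
  averaged_onemcos v <= c%:E.
Proof.
move=> h; apply: (@le_trans _ _ (\int[mu]_(u in `[0%R, 1%R]) c%:E)).
  apply: ge0_le_integral => //=.
  apply/measurable_EFinP; apply: measurable_funB => //.
  by apply: (measurableT_comp measurable_cos); exact: measurable_funM.
by rewrite integral_cst//= lebesgue_measure_itv/= lte_fin ltr01 sube0 mule1.
Qed.

Lemma averaged_onemcos_le2 (v : R) : averaged_onemcos v <= 2%:E.
Proof. by apply: averaged_onemcos_le => u _; exact: onemcos_le2. Qed.

Lemma averaged_onemcos_leX (v : R) : averaged_onemcos v <= (v ^+ 2)%:E.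
Proof.
apply: averaged_onemcos_le => u /=; rewrite in_itv/= => /andP[u0 u1].
rewrite (le_trans (onemcos_le _))// exprMn ler_piMl ?sqr_ge0//.
by rewrite exprn_ile1.
Qed.

(** Tightness of a single law: dominated convergence with the constant bound 2, the pointwise limit
    coming from the bound v ^ 2. *)
Lemma cvg_averaged_onemcos0 (Y : T -> R) : measurable_fun setT Y ->
  \int[P]_w averaged_onemcos (m.+1%:R^-1 * Y w) @[m --> \oo] --> 0.
Proof.
move=> mY.
have mYm m : measurable_fun setT (fun w => (m.+1%:R^-1 * Y w)%R) by exact: measurable_funM.
have [|||_ _] := @dominated_convergence _ T R P setT measurableT
  (fun m w => averaged_onemcos (m.+1%:R^-1 * Y w)) (cst 0) (cst 2%:E)
  (fun m => measurable_averaged_onemcos (mYm m)) (measurable_cst _).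
- apply: aeW => w _; apply: (@squeeze_cvge _ _ _ _ (cst 0) _ (fun m => ((m.+1%:R^-1 * Y w)^+2)%:E)).
  + by apply: nearW => m; rewrite averaged_onemcos_ge0 averaged_onemcos_leX.
  + exact: cvg_cst.
  + apply: cvg_EFin; first exact: nearW.
    rewrite -[X in _ --> X](_ : (0 * Y w) * (0 * Y w) = 0)%R; last by rewrite !mul0r.
    under eq_fun do rewrite expr2.
    have h : (m.+1%:R^-1 * Y w)%R @[m --> \oo] --> (0 * Y w)%R.
      by apply: cvgM; [exact: cvg_harmonic|exact: cvg_cst].
    exact: cvgM.
- by apply: finite_measure_integrable_cst.
- apply: aeW => w m _; rewrite gee0_abs ?averaged_onemcos_ge0//.
  exact: averaged_onemcos_le2.
- by rewrite integral0.
Qed.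

(** Markov's inequality: where |Y| > L the argument 2 / L * Y exceeds 2 in absolute value, so the
    averaged quantity is at least 1/2. *)
Lemma prob_gt_le (Y : T -> R) (L : R) : (0 < L)%R -> measurable_fun setT Y ->
  P [set w | (L < `|Y w|)%R] <= 2%:E * \int[P]_w averaged_onemcos (2 / L * Y w).
Proof.
move=> L0 mY.
have mA : measurable [set w | (L < `|Y w|)%R].
  rewrite -[X in measurable X]setTI; apply: (measurable_fun_ltr (f := cst L)) => //.
  exact: measurableT_comp.
have mYL : measurable_fun setT (fun w => (2 / L * Y w)%R) by exact: measurable_funM.
rewrite -ge0_integralZl//; last 2 first.
- exact: measurable_averaged_onemcos.
- by move=> w _; exact: averaged_onemcos_ge0.
rewrite -[X in P X]setIT -integral_indic//.
apply: ge0_le_integral => //.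
- by apply/measurable_EFinP; exact: measurable_indic.
- by apply: emeasurable_funM => //; exact: measurable_averaged_onemcos.
- move=> w _; rewrite indicE; case: (boolP (w \in _)) => [|_]; last first.
    by rewrite mule_ge0// averaged_onemcos_ge0.
  rewrite inE/= => Lw.
  rewrite -[leLHS](_ : 2%:E * (1 / 2)%:E = 1); last by rewrite -EFinM; congr EFin; field.
  rewrite lee_pmul2l ?lte_fin//; apply: averaged_onemcos_ge.
  rewrite normrM ger0_norm ?divr_ge0 ?(ltW L0)//.
  by rewrite mulrAC ler_pdivlMr// ler_pM2l// ltW.
Qed.

End tails.

Section cvg_averaged.
Context {R : realType} d (T : measurableType d) (P : probability T R)
  d' (T' : measurableType d') (P' : probability T' R).
Notation mu := (@lebesgue_measure R).
Local Open Scope ereal_scope.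

(** Dominated convergence over the frequencies u in [0, 1]. The tails of the sequence are thereby
    governed by those of the limit, without assuming tightness. *)
Lemma cvg_averaged_onemcos (Y : nat -> T -> R) (Z : T' -> R) :
  (forall k, measurable_fun setT (Y k)) -> measurable_fun setT Z ->
  (forall u, (\int[P]_w cos (u * Y k w) @[k --> \oo] --> \int[P']_w cos (u * Z w))%R) ->
  \int[P]_w averaged_onemcos (Y k w) @[k --> \oo] -->
  \int[P']_w averaged_onemcos (Z w).
Proof.
move=> mY mZ h.
rewrite integral_averaged_onemcos//.
under eq_fun do rewrite integral_averaged_onemcos//.
have mphi dd (U : measurableType dd) (Q : probability U R) (V : U -> R) :
    measurable_fun setT V ->
    measurable_fun (`[0%R, 1%R]%classic : set R) (fun u : R => (1 - \int[Q]_w cos (u * V w))%:E).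
  move=> mV; apply/measurable_EFinP/measurable_funB => //.
  apply: (@measurableT_comp _ _ _ _ _ _ (fine : \bar R -> R)); first exact: fine_measurable.
  apply: (@measurable_funS _ _ _ _ setT) => //.
  (* Adding 2 makes the integrand nonnegative, so that Tonelli's theorem yields measurability in u;
     the constant is subtracted again below. *)
  have mg : measurable_fun setT (fun p : R * U => (2 + cos (p.1 * V p.2))%R).
    apply: measurable_funD => //; apply: (measurableT_comp measurable_cos).
    by apply: measurable_funM => //; exact: measurableT_comp.
  have mg' : measurable_fun setT (fun p : R * U => (2 + cos (p.1 * V p.2))%:E).
    exact/measurable_EFinP.
  have g0 (p : R * U) : 0 <= (2 + cos (p.1 * V p.2))%:E.
    by rewrite lee_fin; have := cos_geN1 (p.1 * V p.2); lra.
  have := @measurable_fun_fubini_tonelli_F _ _ _ _ _ Q _ mg' g0.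
  rewrite /fubini_F/= => m2.
  have -> : (fun u => \int[Q]_x (cos (u * V x))%:E) =
            (fun u => \int[Q]_y (2 + cos (u * V y))%:E - 2%:E).
    apply/funext => u.
    have mc : measurable_fun setT (fun w => cos (u * V w)).
      by apply: (measurableT_comp measurable_cos); exact: measurable_funM.
    have ic := @bounded_integrable _ _ _ Q _ 1%R mc (fun w => cos_max _).
    under [in RHS]eq_integral do rewrite EFinD.
    rewrite integralD//=; last exact: finite_measure_integrable_cst.
    by rewrite integral_prob_cst addeAC subee// add0e.
  exact: emeasurable_funB.
have bphi dd (U : measurableType dd) (Q : probability U R) (V : U -> R) u :
    measurable_fun setT V -> (`|1 - \int[Q]_w cos (u * V w)| <= 2)%R.
  move=> mV; have : (`|\int[Q]_w cos (u * V w)| <= 1)%R.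
    apply: Rintegral_bounded => [|w]; last exact: cos_max.
    by apply: (measurableT_comp measurable_cos); exact: measurable_funM.
  by rewrite !ler_norml; lra.
have [|||_ _] := @dominated_convergence _ _ R mu `[0%R, 1%R] (measurable_itv _)
  (fun k u => (1 - \int[P]_w cos (u * Y k w))%:E)
  (fun u => (1 - \int[P']_w cos (u * Z w))%:E) (cst 2%:E)
  (fun k => mphi _ _ _ _ (mY k)) (mphi _ _ _ _ mZ).
- apply: aeW => u _; apply: cvg_EFin; first exact: nearW.
  by apply: cvgB; [exact: cvg_cst|exact: h].
- apply/integrableP; split => //=.
  by rewrite integral_cst//= lebesgue_measure_itv/= lte_fin ltr01 sube0 mule1 ltry.
- by apply: aeW => u k _; rewrite lee_fin bphi.
- by [].
Qed.

End cvg_averaged.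

Section random_vectors.
Context {R : realType} d (T : measurableType d) (P : probability T R) (n : nat).
Variable Y : 'I_n -> T -> R.
Hypothesis mY : forall i, measurable_fun setT (Y i).
Local Notation row w := (\row_i Y i w).

Lemma measurable_lin_form th : measurable_fun setT (fun w => lin_form th (row w)).
Proof.
rewrite /lin_form; apply: measurable_sum => i.
by under eq_fun do rewrite mxE; exact: measurable_funM.
Qed.

Lemma measurable_trig_poly p : trig_poly p -> measurable_fun setT (fun w => p (row w)).
Proof.
elim=> [a b th|f g _ mf _ mg]; last exact: measurable_funD.
apply: measurable_funM => //; apply: (measurableT_comp measurable_cos).
by apply: measurable_funD => //; exact: measurable_lin_form.
Qed.

(** [f] is the pointwise limit of trigonometric polynomials approximating it within 1 / (k + 1) on
    cubes of half-side k + 1, and these are visibly measurable functions of the coordinates. *)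
Lemma measurable_continuous_row (f : 'rV[R]_n -> R) (M : R) : continuous f -> (forall x, `|f x| <= M) ->
  measurable_fun setT (fun w => f (row w)).
Proof.
move=> cf fM.
have /choice[p hp] : forall k : nat, exists p : 'rV[R]_n -> R, trig_poly p /\
    forall x, cube k.+1%:R x -> `|f x - p x| <= k.+1%:R^-1.
  move=> k; have [//||p tp [fp _]] := @trig_poly_dense_cube R n f M k.+1%:R k.+1%:R^-1 cf fM.
    by rewrite invr_gt0.
  by exists p.
apply: (@measurable_fun_cvg _ _ _ _ (fun k w => p k (row w))) => [k|w _].
  by apply: measurable_trig_poly; have [] := hp k.
apply/cvgrPdist_le => /= e e0.
near=> k.
have [_ /(_ (row w))] := hp k; move=> h; apply: (le_trans (h _)).
  move=> i; rewrite (@le_trans _ _ (\sum_i `|row w 0 i|))//.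
    by rewrite (bigD1 i)//= lerDl sumr_ge0.
  rewrite (@le_trans _ _ k%:R) ?ler_nat//; near: k; exact: nbhs_infty_ger.
rewrite invf_ple ?posrE//; apply: (@le_trans _ _ k%:R); last by rewrite ler_nat.
by near: k; exact: nbhs_infty_ger.
Unshelve. all: by end_near. Qed.

Local Open Scope ereal_scope.

Lemma outside_cube_le L : (0 < L)%R ->
  d.-measurable [set w | ~ cube L (row w)] /\
  P [set w | ~ cube L (row w)] <=
  \sum_i 2%:E * \int[P]_w averaged_onemcos (2 / L * Y i w).
Proof.
move=> L0.
have mA i : d.-measurable [set w | (L < `|Y i w|)%R].
  rewrite -[X in measurable X]setTI; apply: (measurable_fun_ltr (f := cst L)) => //.
  exact: measurableT_comp.
have -> : [set w | ~ cube L (row w)] =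
    \big[setU/set0]_(i <- index_enum 'I_n) [set w | (L < `|Y i w|)%R].
  rewrite -bigcup_seq; apply/seteqP; split => w /=.
    by move=> /existsNP[i /negP]; rewrite mxE -ltNge => h; exists i => //=; rewrite mem_index_enum.
  by move=> [i _ /= h] /(_ i); rewrite mxE leNgt h.
split; first exact: bigsetU_measurable.
elim: (index_enum _) => [|i s ih]; first by rewrite !big_nil measure0.
rewrite !big_cons (le_trans (measureU2 _ _ _))//; first exact: bigsetU_measurable.
by apply: leeD => //; exact: prob_gt_le.
Qed.

(** On the cube the two integrands differ by at most e; off the cube they differ by at most 2 * M +
    e, on an event of probability at most e. *)
Lemma trig_poly_approx (f p : 'rV[R]_n -> R) (M L e : R) :
  (0 < L)%R -> (0 < e)%R -> continuous f -> (forall x, `|f x| <= M)%R ->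
  trig_poly p -> (forall x, cube L x -> `|f x - p x| <= e)%R ->
  (forall x, `|p x| <= M + e)%R ->
  \sum_i 2%:E * \int[P]_w averaged_onemcos (2 / L * Y i w) < e%:E ->
  (`|\int[P]_w f (row w) - \int[P]_w p (row w)| <= e + (2 * M + e) * e)%R.
Proof.
move=> L0 e0 cf fM tp fp pM he.
have M0 : (0 <= M)%R by exact: le_trans (fM 0%R).
have [mB PB] := outside_cube_le L0; set B := [set w | _] in mB PB.
have PBe : (fine (P B) <= e)%R.
  rewrite -lee_fin fineK ?fin_num_measure//; exact: le_trans (ltW he).
have mf := measurable_continuous_row cf fM.
have mp := measurable_trig_poly tp.
have fi := @bounded_integrable _ _ _ P _ M mf (fun w => fM _).
have pin := @bounded_integrable _ _ _ P _ (M + e)%R mp (fun w => pM _).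
rewrite -RintegralB//.
rewrite (le_trans (le_normr_Rintegral _ (integrableB _ fi pin)))//.
have bi : P.-integrable setT (EFin \o (fun w => (2 * M + e) * \1_B w)%R).
  apply: (@bounded_integrable _ _ _ P _ (2 * M + e)%R) => [|w].
    by apply: measurable_funM => //; exact: measurable_indic.
  rewrite normrM ger0_norm ?addr_ge0 ?mulr_ge0 ?(ltW e0)//.
  rewrite ler_piMr ?addr_ge0 ?mulr_ge0 ?(ltW e0)//.
  by rewrite indicE; case: (_ \in _); rewrite ?normr1 ?normr0.
have ei : P.-integrable setT (EFin \o cst e) by exact: finite_measure_integrable_cst.
have ii : P.-integrable setT (EFin \o (\1_B : T -> R)) by exact: integrable_indic.
apply: (@le_trans _ _ (\int[P]_w (e + (2 * M + e) * \1_B w))%R).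
  apply: le_Rintegral => //.
  - exact: (integrable_norm (integrableB _ fi pin)).
  - exact: (integrableD _ ei bi).
  - move=> w _; have := fp (row w); have := fM (row w); have := pM (row w).
    rewrite indicE; case: (boolP (w \in B)) => [_ p1 f1 _|wB _ _ h].
      by rewrite mulr1 (le_trans (ler_normB _ _))//; move: p1 f1; lra.
    rewrite mulr0 addr0 h//; apply: contrapT => nc; move/negP: wB; apply.
    by rewrite inE.
rewrite RintegralD// Rintegral_prob_cst lerD2l RintegralZl//.
rewrite ler_wpM2l ?addr_ge0 ?mulr_ge0 ?(ltW e0)//.
by rewrite /Rintegral integral_indic// setIT.
Qed.

End random_vectors.

Section levy_continuity.
Context {R : realType} d (T : measurableType d) (P : probability T R)
  d' (T' : measurableType d') (P' : probability T' R) (n : nat).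
Variables (Y : nat -> 'I_n -> T -> R) (Z : 'I_n -> T' -> R).
Hypotheses (mY : forall k i, measurable_fun setT (Y k i))
  (mZ : forall i, measurable_fun setT (Z i)).
Hypothesis hcos : forall th,
  \int[P]_w cos (\sum_i th i * Y k i w) @[k --> \oo] -->
  \int[P']_w cos (\sum_i th i * Z i w).
Hypothesis hsin : forall th,
  \int[P]_w sin (\sum_i th i * Y k i w) @[k --> \oo] -->
  \int[P']_w sin (\sum_i th i * Z i w).

Let lin_formE (U : Type) (V : 'I_n -> U -> R) th w :
  lin_form th (\row_i V i w) = \sum_i th i * V i w.
Proof. by apply: eq_bigr => i _; rewrite mxE. Qed.

Let cvg_trig_poly p : trig_poly p ->
  \int[P]_w p (\row_i Y k i w) @[k --> \oo] --> \int[P']_w p (\row_i Z i w).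
Proof.
elim=> [a b th|f g tf cf tg cg].
  have E dd (U : measurableType dd) (Q : probability U R) (V : 'I_n -> U -> R) :
      (forall i, measurable_fun setT (V i)) ->
      \int[Q]_w (a * cos (lin_form th (\row_i V i w) + b)) =
      a * cos b * \int[Q]_w cos (\sum_i th i * V i w) -
      a * sin b * \int[Q]_w sin (\sum_i th i * V i w).
    move=> mV.
    have ml : measurable_fun setT (fun w => \sum_i th i * V i w).
      by under eq_fun do rewrite -lin_formE; exact: measurable_lin_form.
    have ic := @bounded_integrable _ _ _ Q _ 1 (measurableT_comp measurable_cos ml)
      (fun w => cos_max _).
    have is_ := @bounded_integrable _ _ _ Q _ 1 (measurableT_comp measurable_sin ml)
      (fun w => sin_max _).
    rewrite -RintegralZl// -RintegralZl// -RintegralB//; last 2 first.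
    - exact: (integrableZl _ _ ic).
    - exact: (integrableZl _ _ is_).
    by apply: eq_Rintegral => w _; rewrite lin_formE cosD; ring.
  rewrite E//; under eq_fun do rewrite E//.
  by apply: cvgB; apply: cvgM; (try exact: cvg_cst).
have E dd (U : measurableType dd) (Q : probability U R) (V : 'I_n -> U -> R) :
    (forall i, measurable_fun setT (V i)) ->
    \int[Q]_w (f (\row_i V i w) + g (\row_i V i w)) =
    \int[Q]_w f (\row_i V i w) + \int[Q]_w g (\row_i V i w).
  move=> mV; have [M1 _ fM] := trig_poly_bounded tf.
  have [M2 _ gM] := trig_poly_bounded tg.
  rewrite RintegralD//.
    exact: (@bounded_integrable _ _ _ Q _ M1 (measurable_trig_poly mV tf)).
  exact: (@bounded_integrable _ _ _ Q _ M2 (measurable_trig_poly mV tg)).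
rewrite E//; under eq_fun do rewrite E//.
exact: cvgD.
Qed.

Let cvg_tail L i :
  (2%:E * \int[P]_w averaged_onemcos (2 / L * Y k i w) @[k --> \oo] -->
   2%:E * \int[P']_w averaged_onemcos (2 / L * Z i w))%E.
Proof.
apply: cvgeZl => //; apply: cvg_averaged_onemcos.
- by move=> k; exact: measurable_funM.
- exact: measurable_funM.
(* A frequency vector supported on the coordinate i isolates the marginal [Y k i]. *)
- move=> u; have := @hcos (fun j => if j == i then u * (2 / L) else 0).
  have E (U : Type) (V : 'I_n -> U -> R) w :
      \sum_j (if j == i then u * (2 / L) else 0) * V j w = u * (2 / L * V i w).
    rewrite (bigD1 i)//= eqxx big1 ?addr0 ?mulrA//.
    by move=> j /negPf ->; rewrite mul0r.
  by under eq_fun do under eq_Rintegral do rewrite E; under eq_Rintegral do rewrite E.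
Qed.

Let sum_tail_lt e : (0 < e)%R -> exists2 L, 0 < L &
  (\sum_i 2%:E * \int[P']_w averaged_onemcos (2 / L * Z i w) < e%:E)%E.
Proof.
move=> e0.
have h i : (2%:E * \int[P']_w averaged_onemcos (m.+1%:R^-1 * Z i w) @[m --> \oo] --> 0%E)%E.
  by rewrite -(mule0 2%:E); apply: cvgeZl => //; exact: cvg_averaged_onemcos0.
have : (\sum_i 2%:E * \int[P']_w averaged_onemcos (m.+1%:R^-1 * Z i w) @[m --> \oo] --> \sum_(i < n) 0)%E.
  apply: cvg_nnesum => // i _; first by apply: nearW => m; rewrite mule_ge0// integral_ge0// => w _; exact: averaged_onemcos_ge0.
rewrite big1// => /(_ [set x | x < e%:E]%E) [].
  by apply: open_nbhs_nbhs; split; [exact: open_ereal_lt_ereal|rewrite /= lte_fin].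
(* With L = 2 * (m + 1) the factor 2 / L is 1 / (m + 1). *)
move=> m _ /(_ m (leqnn m)) /= hm; exists (2 * m.+1%:R); first by rewrite mulr_gt0.
by rewrite invfM mulVKf ?pnatr_eq0.
Qed.

(** One cube and one trigonometric polynomial, chosen from the tails of [Z], serve both sides: the
    truncated tails of [Y k] converge to those of [Z], so for large k they satisfy the same
    bound. *)
Theorem levy_continuity (f : 'rV[R]_n -> R) M : continuous f ->
  (forall x, `|f x| <= M) ->
  ('E_P[fun w => f (\row_i Y k i w)] @[k --> \oo] --> 'E_P'[fun w => f (\row_i Z i w)])%E.
Proof.
move=> cf fM.
have M0 : 0 <= M by exact: le_trans (fM 0).
rewrite (@expectation_bounded _ _ _ _ _ M) => [||w]; [|exact: measurable_continuous_row fM|exact: fM].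
under eq_fun do [rewrite (@expectation_bounded _ _ _ _ _ M) => [||w]; [|exact: measurable_continuous_row fM|exact: fM]].
apply: cvg_EFin; first exact: nearW.
apply/cvgrPdist_lt => /= eta eta0.
(* Two approximation errors e + (2 * M + e) * e and one error e for the polynomial add up, for e <=
   1, to at most (4 * M + 5) * e; the 6 leaves room for a strict inequality. *)
pose e := Num.min 1 (eta / (4 * M + 6)).
have M60 : 0 < 4 * M + 6 by lra.
have e0 : 0 < e by rewrite lt_min ltr01 divr_gt0.
have e1 : e <= 1 by rewrite ge_min lexx.
have ee : e * (4 * M + 6) <= eta.
  by rewrite -ler_pdivlMr// ge_min lexx orbT.
have [L L0 hL] := sum_tail_lt e0.
have [p tp [fp pM]] := trig_poly_dense_cube cf fM L0 e0.
have hZ := trig_poly_approx mZ L0 e0 cf fM tp fp pM hL.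
have hY : \forall k \near \oo,
    (\sum_i 2%:E * \int[P]_w averaged_onemcos (2 / L * Y k i w) < e%:E)%E.
  have : (\sum_i 2%:E * \int[P]_w averaged_onemcos (2 / L * Y k i w) @[k --> \oo] -->
      \sum_i 2%:E * \int[P']_w averaged_onemcos (2 / L * Z i w))%E.
    apply: cvg_nnesum => i _; last exact: cvg_tail.
    by apply: nearW => m; rewrite mule_ge0// integral_ge0// => w _; exact: averaged_onemcos_ge0.
  move=> /(_ [set x | x < e%:E]%E); apply.
  by apply: open_nbhs_nbhs; split; [exact: open_ereal_lt_ereal|].
have /cvgrPdist_lt /(_ _ e0) hp := cvg_trig_poly tp.
near=> k.
have hk : (\sum_i 2%:E * \int[P]_w averaged_onemcos (2 / L * Y k i w) < e%:E)%E by near: k.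
have {}hk := trig_poly_approx (mY k) L0 e0 cf fM tp fp pM hk.
have hpk : `|\int[P']_w p (\row_i Z i w) - \int[P]_w p (\row_i Y k i w)| < e by near: k.
move: hk hpk hZ.
move: (\int[P]_w f _) (\int[P]_w p _) (\int[P']_w f _) (\int[P']_w p _) => a b c' d1.
have : (2 * M + e) * e <= (2 * M + 1) * e by rewrite ler_pM2r//; lra.
rewrite !ler_norml !ltr_norml.
move: ((2 * M + e) * e) => q.
have : e * M * 4 + 6 * e <= eta by move: ee; lra.
lra.
Unshelve. all: by end_near. Qed.

End levy_continuity.

(** * Independent sums and stable processes *)

Section decoupling.
Context {R : realType} d (T : measurableType d) (P : probability T R).
Variables (W X : T -> R) (C : R).
Hypotheses (mW : measurable_fun setT W) (mX : measurable_fun setT X)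
  (WC : forall w, `|W w| <= C).
Hypothesis decW : forall B : set R, measurable B ->
  \int[P]_w (W w * \1_B (X w)) = \int[P]_w W w * fine (P (X @^-1` B)).

Let decoupled (f : R -> R) := [/\ measurable_fun setT f,
  (exists M, forall x, `|f x| <= M) &
  \int[P]_w (W w * f (X w)) = \int[P]_w W w * \int[P]_w f (X w)].

Let int_comp (f : R -> R) (M : R) : measurable_fun setT f -> (forall x, `|f x| <= M) ->
  P.-integrable setT (EFin \o (f \o X)).
Proof.
move=> mf fM; apply: (@bounded_integrable _ _ _ _ _ M) => [|w]; last exact: fM.
exact: (measurableT_comp mf mX).
Qed.

Let int_mul (f : R -> R) (M : R) : measurable_fun setT f -> (forall x, `|f x| <= M) ->
  P.-integrable setT (EFin \o (fun w => W w * f (X w))).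
Proof.
move=> mf fM; apply: (@bounded_integrable _ _ _ _ _ (C * M)) => [|w].
  by apply: measurable_funM => //; exact: (measurableT_comp mf mX).
by rewrite normrM ler_pM.
Qed.

Let decoupledD f g : decoupled f -> decoupled g -> decoupled (fun x => f x + g x).
Proof.
move=> [mf [M fM] Ef] [mg [M' gM] Eg]; split; first exact: measurable_funD.
  by exists (M + M') => x; rewrite (le_trans (ler_normD _ _))// lerD.
under eq_Rintegral do rewrite mulrDr.
rewrite [LHS]RintegralD//; [|exact: (int_mul mf fM)|exact: (int_mul mg gM)].
by rewrite Ef Eg RintegralD// ?mulrDr//; [exact: (int_comp mf fM)|exact: (int_comp mg gM)].
Qed.

Let decoupledZ c f : decoupled f -> decoupled (fun x => c * f x).
Proof.
move=> [mf [M fM] Ef]; split; first exact: measurable_funM.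
  by exists (`|c| * M) => x; rewrite normrM ler_wpM2l.
under eq_Rintegral do rewrite mulrCA.
rewrite [LHS]RintegralZl//; last exact: (int_mul mf fM).
by rewrite Ef RintegralZl//; [rewrite mulrCA|exact: (int_comp mf fM)].
Qed.

Let decoupled_indic (B : set R) : measurable B -> decoupled \1_B.
Proof.
move=> mB; split; first exact: measurable_indic.
  by exists 1 => x; rewrite indicE; case: (_ \in _); rewrite ?normr1 ?normr0.
rewrite decW//; congr (_ * _).
have mXB : d.-measurable (X @^-1` B).
  by rewrite -[X in measurable X]setTI; exact: mX.
rewrite -[X in P X]setIT -integral_indic//.
Qed.

Let decoupled_sum (s : seq nat) (c : nat -> R) (B : nat -> set R) :
  (forall j, measurable (B j)) ->
  decoupled (fun x => \sum_(j <- s) c j * \1_(B j) x).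
Proof.
move=> mB; elim: s => [|j s ih].
  have := decoupledZ 0 (decoupled_indic measurable0).
  by under eq_fun do rewrite mul0r; under [X in _ -> decoupled X]eq_fun do rewrite big_nil.
under eq_fun do rewrite big_cons.
by apply: decoupledD => //; apply: decoupledZ; exact: decoupled_indic.
Qed.

(** Linearity extends the factorization from indicators to simple functions. The simple function [s]
    rounds [f] down to a grid of step 1 / n, so replacing [f] by [s] costs at most C / n on each
    side of the identity. *)
Lemma decoupling (f : R -> R) M : measurable_fun setT f -> (forall x, `|f x| <= M) ->
  \int[P]_w (W w * f (X w)) = \int[P]_w W w * \int[P]_w f (X w).
Proof.
move=> mf fM.
have C0 : 0 <= C by exact: le_trans (WC point).
have M0 : 0 <= M by exact: le_trans (fM 0).
suff h (N : nat) : `|\int[P]_w (W w * f (X w)) - \int[P]_w W w * \int[P]_w f (X w)|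
    <= C * 2 / N.+1%:R.
  apply/eqP; rewrite -subr_eq0 -normr_le0; apply/ler_addgt0Pr => e e0; rewrite add0r.
  apply: (le_trans (h (Num.truncn (C * 2 / e)))).
  rewrite ler_pdivrMr// [leRHS]mulrC -ler_pdivrMr//.
  by rewrite ltW// truncnS_gt.
pose n : R := N.+1%:R.
have n0 : 0 < n by rewrite ltr0n.
pose t x := n * (f x + M).
have t0 x : 0 <= t x.
  by rewrite mulr_ge0 ?(ltW n0)//; have := fM x; rewrite ler_norml; lra.
pose B j := [set x : R | j%:R <= t x < j.+1%:R].
have mt : measurable_fun setT t by apply: measurable_funM => //; exact: measurable_funD.
have mB j : measurable (B j).
  have -> : B j = t @^-1` `[j%:R, j.+1%:R[%classic.
    by apply/seteqP; split => x; rewrite /B/= in_itv.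
  by rewrite -[X in measurable X]setTI; exact: mt.
(* [t] takes its values in [0, 2 * n * M], so K unit levels exhaust its range. *)
pose K := (Num.truncn (n * (2 * M))).+1.
pose s x := \sum_(j <- iota 0 K) (j%:R / n - M) * \1_(B j) x.
have sE x : s x = (Num.truncn (t x))%:R / n - M.
  have tK : Num.truncn (t x) \in iota 0 K.
    rewrite mem_iota/= add0n ltnS; apply: le_truncn.
    by rewrite ler_pM2l//; have := fM x; rewrite ler_norml; lra.
  rewrite /s (bigD1_seq _ tK (iota_uniq _ _)) /= big1 ?addr0.
    rewrite indicE mem_set ?mulr1// /B/=.
    by have := truncn_itv (t0 x) => /andP[-> ->].
  move=> j jt; rewrite indicE; case: (boolP (x \in B j)); rewrite ?mulr0//.
  rewrite inE /B/= => /andP[h1 h2]; move/eqP: jt; case; apply/esym/eqP.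
  by rewrite truncn_eq// h1.
have sf x : `|f x - s x| <= n^-1.
  have /andP[h1 h2] := truncn_itv (t0 x).
  have -> : f x - s x = (t x - (Num.truncn (t x))%:R) / n.
    by rewrite sE /t; field; rewrite gt_eqF.
  rewrite ger0_norm ?divr_ge0 ?subr_ge0 ?(ltW n0)//.
  rewrite ler_pdivrMr// mulVf ?gt_eqF//.
  by rewrite lerBlDr addrC natr1 ltW.
have [ms [M' sM] Es] := decoupled_sum (iota 0 K) (fun j => j%:R / n - M) mB.
rewrite -/s in ms sM Es.
have -> : \int[P]_w (W w * f (X w)) - \int[P]_w W w * \int[P]_w f (X w) =
  \int[P]_w (W w * (f (X w) - s (X w))) + \int[P]_w W w * \int[P]_w (s (X w) - f (X w)).
  under [X in _ = X + _]eq_Rintegral do rewrite mulrBr.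
  rewrite [X in _ = X + _]RintegralB//; [|exact: (int_mul mf fM)|exact: (int_mul ms sM)].
  by rewrite RintegralB//; [|exact: (int_comp ms sM)|exact: (int_comp mf fM)]; rewrite Es; ring.
rewrite (le_trans (ler_normD _ _))//.
have mfX := measurableT_comp mf mX.
have msX := measurableT_comp ms mX.
have h1 : `|\int[P]_w (W w * (f (X w) - s (X w)))| <= C * n^-1.
  apply: Rintegral_bounded => [|w]; last by rewrite normrM ler_pM.
  by apply: measurable_funM => //; exact: measurable_funB.
have h2 : `|\int[P]_w W w * \int[P]_w (s (X w) - f (X w))| <= C * n^-1.
  rewrite normrM ler_pM//; first exact: Rintegral_bounded.
  apply: Rintegral_bounded => [|w]; first exact: measurable_funB.
  by rewrite distrC.
have -> : C * 2 / N.+1%:R = C * n^-1 + C * n^-1 by rewrite -/n; ring.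
exact: lerD.
Qed.

End decoupling.

Section independent_symmetric_sum.
Context {R : realType} d (T : measurableType d) (P : probability T R).
Variables (X : nat -> T -> R) (a c : nat -> R) (N : nat).
Hypotheses (mX : forall i, measurable_fun setT (X i))
  (indX : mutually_independent P X)
  (cosX : forall i, (i < N)%N -> \int[P]_w cos (a i * X i w) = c i)
  (sinX : forall i, (i < N)%N -> \int[P]_w sin (a i * X i w) = 0).

Let S k w := \sum_(0 <= i < k) a i * X i w.
Let I k (B : nat -> set R) w := \prod_(k <= i < N) \1_(B i) (X i w) : R.

Let mS k : measurable_fun setT (S k).
Proof. by apply: measurable_sum => i; exact: measurable_funM. Qed.

Let mI k B : (forall i, measurable (B i)) -> measurable_fun setT (I k B).
Proof.
move=> mB; apply: measurable_prod => i _.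
by apply: measurableT_comp (mX i); exact: measurable_indic.
Qed.

Let I_le1 k B w : `|I k B w| <= 1.
Proof.
rewrite /I normr_prod prodr_ile1// => i _; rewrite normr_ge0/=.
by rewrite indicE; case: (_ \in _); rewrite ?normr1 ?normr0.
Qed.

Let pr i (B : set R) := fine (P (X i @^-1` B)).

Let mpre i B : measurable B -> d.-measurable (X i @^-1` B).
Proof. by move=> mB; rewrite -[X in measurable X]setTI; exact: mX. Qed.

Let integral_I B : (forall i, measurable (B i)) ->
  \int[P]_w I 0 B w = \prod_(0 <= i < N) pr i (B i).
Proof.
move=> mB.
have IE w : I 0 B w = \1_(\bigcap_(i in [set` iota 0 N]) (X i @^-1` B i)) w.
  rewrite /I /index_iota subn0 indicE.
  have [wB|wB] := boolP (w \in _).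
    rewrite big_seq big1// => i iN; rewrite indicE mem_set//.
    by move: wB; rewrite inE => /(_ i iN).
  have [i iN nB] : exists2 i, i \in iota 0 N & ~ B i (X i w).
    apply: contrapT => nE; move/negP: wB; apply; rewrite inE => i iN.
    by apply: contrapT => nB; apply: nE; exists i.
  by rewrite (big_rem i)//= indicE memNset// mul0r.
under eq_Rintegral do rewrite IE.
have := indX [fset i in iota 0 N]%fset mB.
have -> : [set` [fset i in iota 0 N]%fset] = [set` iota 0 N].
  by apply/seteqP; split => i /=; rewrite inE.
have pe : perm_eq [fset i in iota 0 N]%fset (iota 0 N).
  by apply: uniq_perm; [exact: fset_uniq|exact: iota_uniq|move=> i; rewrite !inE].
rewrite (perm_big _ pe)/= => h.
rewrite /Rintegral integral_indic//; last first.
  by apply: bigcap_measurableType => i _; exact: mpre.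
rewrite setIT [X in fine X]h /index_iota subn0.
elim: (iota 0 N) => [|i s ih]; first by rewrite !big_nil.
rewrite !big_cons fineM ?ih//; first by apply: fin_num_measure; exact: mpre.
by apply: prode_fin_num => j _; apply: fin_num_measure; exact: mpre.
Qed.

(** Induction trading one indicator at a time for a cosine. Since the indicators of the variables
    not yet absorbed are kept, the induction hypothesis with an arbitrary set at index k is exactly
    the factorization required by [decoupling]. The sine is carried along because the addition
    formulas mix it with the cosine. *)
Let charfun_partial k : (k <= N)%N -> forall B, (forall i, measurable (B i)) ->
  \int[P]_w (cos (S k w) * I k B w) =
    \prod_(0 <= i < k) c i * \prod_(k <= i < N) pr i (B i) /\
  \int[P]_w (sin (S k w) * I k B w) = 0.
Proof.
elim: k => [_|k ih kN] B mB.
  rewrite [X in _ = X * _]big_nil mul1r; split.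
    rewrite -integral_I//; apply: eq_Rintegral => w _.
    by rewrite /S big_nil cos0 mul1r.
  under eq_Rintegral do rewrite /S big_nil sin0 mul0r.
  by rewrite Rintegral_prob_cst.
have {}ih := ih (ltnW kN).
pose B' A i := if i == k then A else B i.
have mB' A i : measurable A -> measurable (B' A i) by rewrite /B'; case: ifP.
have IB' A w : I k (B' A) w = I k.+1 B w * \1_A (X k w).
  rewrite /I (big_ltn kN) /B' eqxx mulrC; congr (_ * _).
  by apply: eq_big_nat => i /andP[ki _]; rewrite gtn_eqF.
have prE A : \prod_(k <= i < N) pr i (B' A i) = pr k A * \prod_(k.+1 <= i < N) pr i (B i).
  rewrite (big_ltn kN) /B' eqxx; congr (_ * _).
  by apply: eq_big_nat => i /andP[ki _]; rewrite gtn_eqF.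
have prT i : pr i setT = 1.
  by rewrite /pr preimage_setT; have -> := @probability_setT _ _ _ P.
have IT w : I k (B' setT) w = I k.+1 B w by rewrite IB' indicE mem_set// mulr1.
pose c0 := \prod_(0 <= i < k) c i; pose p0 := \prod_(k.+1 <= i < N) pr i (B i).
pose W1 w := cos (S k w) * I k.+1 B w; pose W2 w := sin (S k w) * I k.+1 B w.
have mW1 : measurable_fun setT W1.
  by apply: measurable_funM; [exact: (measurableT_comp measurable_cos (mS k))|exact: mI].
have mW2 : measurable_fun setT W2.
  by apply: measurable_funM; [exact: (measurableT_comp measurable_sin (mS k))|exact: mI].
have W1b w : `|W1 w| <= 1 by rewrite normrM mulr_ile1// cos_max.
have W2b w : `|W2 w| <= 1 by rewrite normrM mulr_ile1// sin_max.
have hW1 A : measurable A -> \int[P]_w (W1 w * \1_A (X k w)) = c0 * (pr k A * p0).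
  move=> mA; have [h _] := ih (B' A) (fun i => mB' A i mA).
  by rewrite -prE -h; apply: eq_Rintegral => w _; rewrite IB' mulrA.
have hW2 A : measurable A -> \int[P]_w (W2 w * \1_A (X k w)) = 0.
  move=> mA; have [_ h] := ih (B' A) (fun i => mB' A i mA).
  by rewrite -[RHS]h; apply: eq_Rintegral => w _; rewrite IB' mulrA.
have iW1 : \int[P]_w W1 w = c0 * p0.
  have := hW1 setT measurableT; rewrite prT mul1r => <-.
  by apply: eq_Rintegral => w _; rewrite indicE mem_set// mulr1.
have iW2 : \int[P]_w W2 w = 0.
  rewrite -[RHS](hW2 setT measurableT).
  by apply: eq_Rintegral => w _; rewrite indicE mem_set// mulr1.
have dW1 : forall (f : R -> R) (M : R), measurable_fun setT f -> (forall x, `|f x| <= M) ->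
    \int[P]_w (W1 w * f (X k w)) = \int[P]_w W1 w * \int[P]_w f (X k w).
  apply: (decoupling mW1 (mX k) W1b) => A mA.
  by rewrite hW1// iW1 [pr k A * _]mulrC mulrA.
have dW2 : forall (f : R -> R) (M : R), measurable_fun setT f -> (forall x, `|f x| <= M) ->
    \int[P]_w (W2 w * f (X k w)) = \int[P]_w W2 w * \int[P]_w f (X k w).
  by apply: (decoupling mW2 (mX k) W2b) => A mA; rewrite hW2// iW2 mul0r.
have mak : measurable_fun setT (fun x : R => a k * x) by exact: measurable_funM.
have mc := measurableT_comp (@measurable_cos R) mak.
have ms := measurableT_comp (@measurable_sin R) mak.
have E1c := dW1 _ 1 mc (fun x => cos_max _).
have E1s := dW1 _ 1 ms (fun x => sin_max _).
have E2c := dW2 _ 1 mc (fun x => cos_max _).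
have E2s := dW2 _ 1 ms (fun x => sin_max _).
rewrite /= cosX// iW1 in E1c; rewrite /= sinX// mulr0 in E1s.
rewrite /= iW2 mul0r in E2c; rewrite /= iW2 mul0r in E2s.
have int (W : T -> R) (f : R -> R) : measurable_fun setT W -> (forall w, `|W w| <= 1) ->
    measurable_fun setT f -> (forall x, `|f x| <= 1) ->
    P.-integrable setT (EFin \o (fun w => W w * f (X k w))).
  move=> mW Wb mf fb; apply: (@bounded_integrable _ _ _ _ _ 1) => [|w].
    by apply: measurable_funM => //; exact: (measurableT_comp mf (mX k)).
  by rewrite normrM mulr_ile1.
have SE w : S k.+1 w = S k w + a k * X k w by rewrite /S big_nat_recr.
split.
  under eq_Rintegral do rewrite SE cosD mulrBl mulrAC -/(W1 _) [X in _ - X]mulrAC -/(W2 _).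
  rewrite RintegralB//; [|exact: (int _ _ mW1 W1b mc (fun=> cos_max _))|
    exact: (int _ _ mW2 W2b ms (fun=> sin_max _))].
  by rewrite [X in X - _]E1c [X in _ - X]E2s subr0 big_nat_recr//= mulrAC.
under eq_Rintegral do rewrite SE sinD mulrDl mulrAC -/(W2 _) [X in _ + X]mulrAC -/(W1 _).
rewrite RintegralD//; [|exact: (int _ _ mW2 W2b mc (fun=> cos_max _))|
  exact: (int _ _ mW1 W1b ms (fun=> sin_max _))].
by rewrite [X in X + _]E2c [X in _ + X]E1s addr0.
Qed.

Lemma charfun_independent_sum :
  \int[P]_w cos (\sum_(0 <= i < N) a i * X i w) = \prod_(0 <= i < N) c i /\
  \int[P]_w sin (\sum_(0 <= i < N) a i * X i w) = 0.
Proof.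
have [] := charfun_partial (leqnn N) (fun=> measurableT).
rewrite [X in _ * X]big_geq// mulr1 => hc hs; split.
  by rewrite -[RHS]hc; apply: eq_Rintegral => w _; rewrite /I big_geq// mulr1.
by rewrite -[RHS]hs; apply: eq_Rintegral => w _; rewrite /I big_geq// mulr1.
Qed.

End independent_symmetric_sum.

Section equality_in_law.
Context {R : realType} d (T : measurableType d) (P : probability T R).

Lemma same_law_Rintegral (U V : T -> R) (f : R -> R) (M : R) :
  measurable_fun setT U -> measurable_fun setT V -> same_law P U V ->
  measurable_fun setT f -> (forall x, `|f x| <= M) ->
  \int[P]_w f (U w) = \int[P]_w f (V w).
Proof.
move=> mU mV UV mf fM; congr fine.
have E (W : T -> R) (mW : measurable_fun setT W) :
    (\int[P]_w (f (W w))%:E = \int[pushforward P W]_y (f y)%:E)%E.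
  rewrite integral_pushforward ?preimage_setT//; first exact/measurable_EFinP.
  apply: (@bounded_integrable _ _ _ _ _ M) => [|w]; last exact: fM.
  exact: (measurableT_comp mf mW).
rewrite !E//.
pose U' : {mfun T >-> R} := HB.pack U (isMeasurableFun.Build _ _ _ _ _ mU).
pose V' : {mfun T >-> R} := HB.pack V (isMeasurableFun.Build _ _ _ _ _ mV).
apply: (@eq_measure_integral _ _ _ _ (distribution P V') (distribution P U')) => A mA _.
exact: UV.
Qed.

Lemma ae_eq_Rintegral (U V : T -> R) : measurable_fun setT U -> measurable_fun setT V ->
  {ae P, forall w, U w = V w} -> \int[P]_w U w = \int[P]_w V w.
Proof.
move=> mU mV UV; congr fine; apply: ae_eq_integral => //; try exact/measurable_EFinP.
by apply: filterS UV => w -> _.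
Qed.

Lemma char_funE (X : T -> R) (th a : R) : measurable_fun setT X ->
  char_fun P X th = (a%:C)%C ->
  \int[P]_w cos (th * X w) = a /\ \int[P]_w sin (th * X w) = 0.
Proof. by move=> mX; rewrite /char_fun !unlock => -[]. Qed.

End equality_in_law.

(** * Finitely many times and their common partition *)

Section partition_of_times.
Context {R : realType} (n : nat) (t : 'I_n -> R) (t_ge0 : forall j, 0 <= t j).

Lemma exists_partition : exists tau : nat -> R,
  [/\ tau 0 = 0, (forall i, tau i <= tau i.+1) &
      forall j, exists2 m, (m <= n)%N & t j = tau m].
Proof.
pose s := sort <=%R (codom t).
have s_sorted : sorted <=%R (0 :: s).
  have s0 : all (<=%R 0) s by apply/allP => x; rewrite mem_sort => /codomP[j ->].
  by rewrite /= (path_min_sorted s0); apply: sort_sorted; exact: le_total.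
have ss : size s = n by rewrite size_sort size_codom card_ord.
(* The default value makes [tau] constant beyond the list, hence nondecreasing on all of nat, as the
   independence of increments is stated for infinite sequences of times. *)
pose tau i := nth (last 0 s) (0 :: s) i.
exists tau; split => // [i|j].
  have [iN|iN] := ltnP i.+1 (size (0 :: s)).
    by apply: (sorted_leq_nth le_trans lexx _ s_sorted); rewrite ?inE// ltnW.
  rewrite /tau [leRHS]nth_default//.
  move: iN; rewrite leq_eqVlt => /predU1P[iE|iN]; last by rewrite nth_default.
  have -> : i = (size (0 :: s)).-1 by rewrite iE.
  by rewrite nth_last.
have tjs : t j \in s by rewrite mem_sort codom_f.
exists (index (t j) s).+1; first by rewrite -ss index_mem.
by rewrite /tau /= nth_index.
Qed.

Variable tau : nat -> R.
Hypotheses (tau0 : tau 0 = 0) (tau_nd : forall i, tau i <= tau i.+1)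
  (tau_t : forall j, exists2 m, (m <= n)%N & t j = tau m).

Lemma partition_le i j : (i <= j)%N -> tau i <= tau j.
Proof. exact: (homo_leq lexx le_trans). Qed.

Lemma partition_telescope (F : R -> R) j :
  F (t j) - F 0 = \sum_(0 <= i < n) (if tau i.+1 <= t j then 1 else 0) * (F (tau i.+1) - F (tau i)).
Proof.
have [m mn ->] := tau_t j.
rewrite (big_cat_nat (leq0n m) mn) /= [X in _ = _ + X]big1_seq ?addr0; last first.
  (* When times are repeated, an index beyond m can still pass the test, but its increment is then
     zero. *)
  move=> i /andP[_]; rewrite mem_index_iota => /andP[mi _].
  case: ifPn => [im|]; rewrite ?mul0r// mul1r.
  have E : tau i = tau i.+1.
    apply/eqP; rewrite eq_le tau_nd (le_trans im)//; exact: partition_le.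
  by rewrite -E subrr.
under eq_big_nat => i /andP[_ im] do rewrite partition_le// mul1r.
by rewrite telescope_sumr// tau0.
Qed.

(** The coefficient of the increment over [tau i, tau (i + 1)] after summation by parts, which is
    also the value on that cell of the step function sum_j th j * 1_[0, t j[. *)
Definition weight (th : 'I_n -> R) i := \sum_j th j * (if tau i.+1 <= t j then 1 else 0).

Lemma sum_partition (th : 'I_n -> R) (F : R -> R) : F 0 = 0 ->
  \sum_j th j * F (t j) =
  \sum_(0 <= i < n) weight th i * (F (tau i.+1) - F (tau i)).
Proof.
move=> F0; under [RHS]eq_bigr do rewrite /weight mulr_suml.
rewrite exchange_big/=; apply: eq_bigr => j _.
have := partition_telescope F j; rewrite F0 subr0 => ->; rewrite mulr_sumr.
by apply: eq_bigr => i _; rewrite mulrA.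
Qed.

(** The cells are disjoint, so at most one term is nonzero and the power passes through the sum; b
    != 0 is what makes the power of 0 vanish. *)
Lemma powR_sum_indic_partition (th : 'I_n -> R) (b x : R) : b != 0 ->
  `|\sum_j th j * \1_[set y | 0 <= y < t j] x| `^ b =
  \sum_(0 <= i < n) `|weight th i| `^ b * \1_`[tau i, tau i.+1[ x.
Proof.
move=> b0.
have [x0|x0] := leP 0 x; last first.
  rewrite big1; last first.
    by move=> j _; rewrite indicE memNset ?mulr0//= (leNgt 0 x) x0.
  rewrite normr0 powR0// big1// => i _; rewrite indicE memNset ?mulr0//=.
  rewrite in_itv/= => /andP[h _].
  by have := le_lt_trans (partition_le (leq0n i)) (le_lt_trans h x0); rewrite tau0 ltxx.
have E : \sum_j th j * \1_[set y | 0 <= y < t j] x =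
    \sum_(0 <= i < n) weight th i * \1_`[tau i, tau i.+1[ x.
  have -> : \sum_j th j * \1_[set y | 0 <= y < t j] x =
      \sum_j th j * (fun s : R => if x < s then 1 else 0) (t j).
    apply: eq_bigr => j _; congr (_ * _); rewrite indicE.
    have [xt|xt] := ltP x (t j); first by rewrite mem_set//= x0.
    by rewrite memNset//= x0 ltNge xt.
  (* For fixed x the indicator is read as a function of the right end s, so that the summation by
     parts applies to it. *)
  pose F (s : R) : R := if x < s then 1 else 0.
  have F0 : F 0 = 0 by rewrite /F ltNge x0.
  apply: (etrans (@sum_partition th F F0)).
  apply: eq_bigr => i _; congr (_ * _); rewrite indicE /F.
  have [xi|xi] := ltP x (tau i).
    by rewrite (lt_le_trans xi)// subrr memNset//= in_itv/= leNgt xi.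
  have [xi1|xi1] := ltP x (tau i.+1).
    by rewrite subr0 mem_set//= in_itv/= xi xi1.
  by rewrite subrr memNset//= in_itv/= xi ltNge xi1.
rewrite E.
have [[i0 [i0n hi0]]|none] := pselect (exists i, (i < n)%N /\ `[tau i, tau i.+1[%classic x).
  have other i : i != i0 -> \1_`[tau i, tau i.+1[ x = 0 :> R.
    move=> ii0; rewrite indicE memNset// => hi.
    move: hi0 hi; rewrite /= !in_itv/= => /andP[a1 a2] /andP[b1 b2].
    have [/partition_le h|/partition_le h|/eqP] := ltngtP i i0; last by rewrite (negPf ii0).
      by have := lt_le_trans b2 (le_trans h a1); rewrite ltxx.
    by have := lt_le_trans a2 (le_trans h b1); rewrite ltxx.
  have i0in : i0 \in index_iota 0 n by rewrite mem_index_iota.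
  rewrite !(bigD1_seq i0)//= ?iota_uniq//.
  rewrite !big1 ?addr0; last 2 first.
  - by move=> i /other ->; rewrite mulr0.
  - by move=> i /other ->; rewrite mulr0.
  by rewrite indicE mem_set// !mulr1.
rewrite !big1_seq ?normr0 ?powR0// => i /andP[_]; rewrite mem_index_iota => /andP[_ iN].
  by rewrite indicE memNset ?mulr0// => h; apply: none; exists i.
by rewrite indicE memNset ?mulr0// => h; apply: none; exists i.
Qed.

End partition_of_times.

Section stable_process.
Context {R : realType} d (T : measurableType d) (P : probability T R) (b : R)
  (xi : R -> {RV P >-> R}) (xiS : symmetric_stable_levy_process b xi).
Context (n : nat) (t : 'I_n -> R) (tau : nat -> R).
Hypotheses (tau0 : tau 0 = 0) (tau_nd : forall i, tau i <= tau i.+1)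
  (tau_t : forall j, exists2 m, (m <= n)%N & t j = tau m).

(** In terms of increments over the partition the sum has independent terms, each with a stable law
    by stationarity, so the exponents add up. The rewriting is only almost sure because [xi 0]
    vanishes only almost surely. *)
Lemma charfun_stable_fdd (th : 'I_n -> R) (K : R) : 0 < K ->
  \int[P]_w cos (\sum_j th j * (K * xi (t j) w)) =
    expR (- (K `^ b * \sum_(0 <= i < n) `|weight t tau th i| `^ b * (tau i.+1 - tau i))) /\
  \int[P]_w sin (\sum_j th j * (K * xi (t j) w)) = 0.
Proof.
move=> K0; have [xiL xiC] := xiS; have [xi0 xiI xiSt _] := xiL.
pose D i w := xi (tau i.+1) w - xi (tau i) w.
pose a i := K * weight t tau th i.
have mxi s : measurable_fun setT (xi s) by [].
have mD i : measurable_fun setT (D i) by exact: measurable_funB.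
have tau_ge0 i : 0 <= tau i by rewrite -tau0 (partition_le tau_nd).
have indD : mutually_independent P D by apply: xiI => //; rewrite tau0.
have DE (f : R -> R) M i : measurable_fun setT f -> (forall x, `|f x| <= M) ->
    \int[P]_w f (a i * D i w) = \int[P]_w f (a i * xi (tau i.+1 - tau i) w).
  move=> mf fM; apply: (@same_law_Rintegral _ _ _ P (D i) (xi (tau i.+1 - tau i)) (fun x => f (a i * x)) M) => //.
  - exact: xiSt.
  - by apply: (measurableT_comp mf); exact: measurable_funM.
have xiE i := char_funE (mxi (tau i.+1 - tau i)) (xiC _ (a i) (eqbRL (subr_ge0 _ _) (tau_nd i))).
have cosD i : (i < n)%N -> \int[P]_w cos (a i * D i w) =
    expR (- ((tau i.+1 - tau i) * `|a i| `^ b)).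
  by move=> _; rewrite (DE _ 1 i (@measurable_cos R) (@cos_max R)); have [] := xiE i.
have sinD i : (i < n)%N -> \int[P]_w sin (a i * D i w) = 0.
  by move=> _; rewrite (DE _ 1 i (@measurable_sin R) (@sin_max R)); have [] := xiE i.
have [hc hs] := charfun_independent_sum mD indD cosD sinD.
have mS1 : measurable_fun setT (fun w => \sum_j th j * (K * xi (t j) w)).
  by apply: measurable_sum => j; apply: measurable_funM => //; exact: measurable_funM.
have mS2 : measurable_fun setT (fun w => \sum_(0 <= i < n) a i * D i w).
  by apply: measurable_sum => i; exact: measurable_funM.
have SE : {ae P, forall w, \sum_j th j * (K * xi (t j) w) = \sum_(0 <= i < n) a i * D i w}.
  apply: filterS xi0 => w xi0w.
  have F0 : (fun s => K * xi s w) 0 = 0 by rewrite xi0w mulr0.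
  rewrite (sum_partition tau0 tau_nd tau_t th (F := fun s => K * xi s w)) //.
  by apply: eq_bigr => i _; rewrite /a /D; ring.
have SEc : {ae P, forall w, cos (\sum_j th j * (K * xi (t j) w)) = cos (\sum_(0 <= i < n) a i * D i w)}.
  by apply: filterS SE => w ->.
have SEs : {ae P, forall w, sin (\sum_j th j * (K * xi (t j) w)) = sin (\sum_(0 <= i < n) a i * D i w)}.
  by apply: filterS SE => w ->.
rewrite (ae_eq_Rintegral (measurableT_comp (@measurable_cos R) mS1) (measurableT_comp (@measurable_cos R) mS2) SEc).
rewrite (ae_eq_Rintegral (measurableT_comp (@measurable_sin R) mS1) (measurableT_comp (@measurable_sin R) mS2) SEs).
split; last exact: hs.
apply: (etrans hc); rewrite mulr_sumr -sumrN expR_sum.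
apply: eq_bigr => i _; congr (expR (- _)); rewrite /a normrM powRM// (gtr0_norm K0).
by ring.
Qed.

End stable_process.

Section step_function_integral.
Context {R : realType} (n : nat) (t : 'I_n -> R) (tau : nat -> R).
Hypotheses (tau0 : tau 0 = 0) (tau_nd : forall i, tau i <= tau i.+1)
  (tau_t : forall j, exists2 m, (m <= n)%N & t j = tau m).

(** Identifies the integral that the scaling limit produces with the exponent found in
    [charfun_stable_fdd]. *)
Lemma integral_powR_step (th : 'I_n -> R) (b : R) : b != 0 ->
  (\int[@lebesgue_measure R]_x (`|\sum_j th j * \1_[set y | 0%R <= y < t j]%R x| `^ b)%:E =
  (\sum_(0 <= i < n) `|weight t tau th i| `^ b * (tau i.+1 - tau i))%:E)%E.
Proof.
move=> b0; under eq_integral do rewrite (powR_sum_indic_partition tau0 tau_nd tau_t th _ b0) -sumEFin.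
have mI i : measurable_fun setT (\1_`[tau i, tau i.+1[ : R -> R) by exact: measurable_indic.
rewrite ge0_integral_sum//; last first.
  by move=> i; apply/measurable_EFinP; apply: measurable_funM => //; exact: mI.
rewrite -sumEFin; apply: eq_bigr => i _.
under eq_integral do rewrite EFinM.
rewrite ge0_integralZl//; last by apply/measurable_EFinP; exact: mI.
rewrite integral_indic//= setIT lebesgue_measure_itv/= lte_fin EFinM; congr (_ * _)%E.
case: ltP => // h; have -> : tau i.+1 = tau i by apply/eqP; rewrite eq_le h tau_nd.
by rewrite subrr.
Qed.

End step_function_integral.

(** * Levy exponents and Levy bases *)

Section levy_exponent.
Context {R : realType} (nu : {measure set R -> \bar R}).
Hypothesis hnu : symmetric_levy_measure nu.
Notation psi := (levy_exponent nu).

Let trunc_sq (y : R) : R := Num.min 1 (`|y| ^+ 2).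

Let measurable_trunc_sq : measurable_fun setT trunc_sq.
Proof. by apply: measurable_minr => //; exact: measurable_funX. Qed.

Let integrable_trunc_sq (c : R) : nu.-integrable setT (EFin \o (fun y => c * trunc_sq y)).
Proof.
apply: (integrableZl measurableT c (f := EFin \o trunc_sq)).
apply/integrableP; split; first exact/measurable_EFinP.
apply: le_lt_trans (levy_integral hnu).
rewrite le_eqVlt; apply/orP; left; apply/eqP; apply: eq_integral => y _ /=.
by rewrite ger0_norm// /trunc_sq le_min ler01 exprn_ge0.
Qed.

(** One integrable majorant for all |th| <= M: the constant 2 handles |y| >= 1, and M ^ 2 * y ^ 2
    handles small y. *)
Let onemcos_le_trunc_sq M (th y : R) : `|th| <= M ->
  `|1 - cos (th * y)| <= (M ^+ 2 + 2) * trunc_sq y.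
Proof.
move=> thM; rewrite ger0_norm ?onemcos_ge0// /trunc_sq.
have M0 : 0 <= M ^+ 2 by rewrite exprn_ge0// (le_trans _ thM).
have [_|_] := leP 1 (`|y| ^+ 2).
  by rewrite mulr1 (le_trans (onemcos_le2 _))// lerDr.
rewrite (le_trans (onemcos_le _))// exprMn -(real_normK (num_real th)) -(real_normK (num_real y)).
rewrite ler_wpM2r ?exprn_ge0// (@le_trans _ _ (M ^+ 2)) ?lerDl//.
by rewrite lerXn2r// nnegrE (le_trans _ thM).
Qed.

Let measurable_onemcos (th : R) : measurable_fun setT (fun y : R => 1 - cos (th * y)).
Proof.
apply: measurable_funB => //; apply: (measurableT_comp (@measurable_cos R)).
exact: measurable_funM.
Qed.

Lemma integrable_onemcos th : nu.-integrable setT (EFin \o (fun y => 1 - cos (th * y))).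
Proof.
apply: (le_integrable measurableT _ _ (integrable_trunc_sq (`|th| ^+ 2 + 2))).
  exact/measurable_EFinP.
move=> y _; rewrite lee_fin (le_trans (onemcos_le_trunc_sq y (lexx `|th|)))//.
exact: ler_norm.
Qed.

Lemma levy_exponent_ge0 th : 0 <= psi th.
Proof. by apply: Rintegral_ge0 => y _; exact: onemcos_ge0. Qed.

Lemma levy_exponent0 : psi 0 = 0.
Proof.
rewrite /levy_exponent /Rintegral; under eq_integral do rewrite mul0r cos0 subrr.
by rewrite integral0.
Qed.

Lemma levy_exponent_norm th : psi `|th| = psi th.
Proof.
rewrite /levy_exponent; apply: eq_Rintegral => y _; congr (1 - _).
by have [_|_] := ger0P th; rewrite // mulNr cosN.
Qed.

Lemma continuous_levy_exponent : continuous psi.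
Proof.
move=> th.
pose M := `|th| + 1.
apply: (@continuity_under_integral R _ _ nu (fun th y => 1 - cos (th * y)) setT
  measurableT (th - 1) (th + 1) (fun x _ => integrable_onemcos x) _
  (fun y => (M ^+ 2 + 2) * trunc_sq y) (integrable_trunc_sq _)).
- apply: aeW => y _ x _; apply: cvgB; first exact: cvg_cst.
  apply: (@continuous_comp _ _ _ (fun x : R => x * y)); last exact: continuous_cos.
  by apply: cvgM; [exact: cvg_id|exact: cvg_cst].
- move=> x /=; rewrite in_itv/= => /andP[x1 x2]; apply: aeW => y _.
  apply: onemcos_le_trunc_sq; rewrite /M.
  by have := ler_norm th; have := ler_norm (- th); rewrite normrN ler_norml; lra.
- by rewrite inE/= in_itv/= ltrBlDr ltrDl ltr01.
Qed.

Lemma measurable_levy_exponent : measurable_fun setT psi.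
Proof. by apply: continuous_measurable_fun; exact: continuous_levy_exponent. Qed.

Lemma levy_exponent_bounded M : exists2 C, 0 <= C & forall th, `|th| <= M -> psi th <= C.
Proof.
exists (\int[nu]_y ((M ^+ 2 + 2) * trunc_sq y)).
  apply: Rintegral_ge0 => y _; rewrite mulr_ge0 ?addr_ge0 ?sqr_ge0//.
  by rewrite /trunc_sq le_min ler01 exprn_ge0.
move=> th thM; apply: (le_Rintegral measurableT (integrable_onemcos th) (integrable_trunc_sq _)).
move=> y _; exact: le_trans (ler_norm _) (onemcos_le_trunc_sq y thM).
Qed.

(** If psi vanished at every 1 / (k + 1), then for almost every y all the numbers cos (y / (k + 1))
    would equal 1. For y != 0 and k + 1 > |y| the argument has absolute value in ]0, 1[, where cos <
    1; so the measure would be carried by {0}, which is a null set. *)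
Lemma levy_exponent_gt0 : nu setT <> 0%E -> exists2 u, 0 < u & 0 < psi u.
Proof.
move=> nu0; apply: contrapT => none; apply: nu0.
have psi0 k : psi k.+1%:R^-1 = 0.
  apply/eqP; rewrite eq_le levy_exponent_ge0 andbT leNgt; apply/negP => h.
  by apply: none; exists k.+1%:R^-1; rewrite ?invr_gt0.
have aek k : {ae nu, forall y, cos (k.+1%:R^-1 * y) = 1}.
  have : (\int[nu]_y `|(1 - cos (k.+1%:R^-1 * y))%:E| = 0)%E.
    have E : (\int[nu]_y (1 - cos (k.+1%:R^-1 * y))%:E = (psi k.+1%:R^-1)%:E)%E.
      rewrite fineK//; apply: integrable_fin_num => //; exact: integrable_onemcos.
    rewrite psi0 in E; rewrite -[RHS]E; apply: eq_integral => y _.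
    by rewrite gee0_abs// lee_fin onemcos_ge0.
  move/(ae_eq_integral_abs nu measurableT _).1 => h.
  have /h : measurable_fun setT (EFin \o (fun y : R => 1 - cos (k.+1%:R^-1 * y))).
    exact/measurable_EFinP.
  by apply: filterS => y /(_ I) /= [] /eqP; rewrite subr_eq0 => /eqP.
have : {ae nu, forall y, forall k, cos (k.+1%:R^-1 * y) = 1}.
  exact: ae_foralln.
move=> [N [mN N0 hN]].
have hs : setT `<=` N `|` [set 0].
  move=> y _; have [->|y0] := eqVneq y 0; [by right|left; apply: hN => /= h].
  pose k := Num.truncn `|y|.
  have ky : `|y| < k.+1%:R by rewrite truncnS_gt.
  have := h k; rewrite -cos_norm normrM gtr0_norm ?invr_gt0// => h1.
  have z0 : 0 < k.+1%:R^-1 * `|y| by rewrite mulr_gt0 ?invr_gt0// normr_gt0.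
  have z1 : k.+1%:R^-1 * `|y| < 1 by rewrite mulrC ltr_pdivrMr// mul1r.
  have : cos (k.+1%:R^-1 * `|y|) < cos 0.
    rewrite ltr_cos// in_itv/= ?lexx ?pi_ge0//.
    by rewrite (ltW z0)/= (le_trans (ltW z1))// (le_trans _ (@pi_ge2 R))// ler1n.
  by rewrite h1 cos0 ltxx.
apply/eqP; rewrite -measure_le0 (@le_trans _ _ (nu (N `|` [set 0])))//.
  by apply: le_measure => //; rewrite ?inE//; apply: measurableU.
by rewrite (le_trans (measureU2 _ _ _))// [X in (X + _)%E]N0 [X in (_ + X)%E](levy_no_atom0 hnu) adde0.
Qed.

End levy_exponent.

(** * Linear combinations of values of a Levy basis *)

Section levy_basis.
Context {R : realType} d (Omega : measurableType d) (P : probability Omega R)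
  (nu : {measure set R -> \bar R}) (Lambda : set (R * R) -> {RV P >-> R}).
Hypothesis hLambda : homogeneous_levy_basis nu Lambda.
Notation psi := (levy_exponent nu).
Notation leb2 := (@lebesgue_measure R \x @lebesgue_measure R)%E.

Lemma finite_area0 : finite_area (set0 : set (R * R)).
Proof. by split => //; rewrite /area measure0. Qed.

Lemma sub_finite_area (A B : set (R * R)) : measurable A -> A `<=` B ->
  finite_area B -> finite_area A.
Proof.
move=> mA AB [mB fB]; split => //; apply: le_lt_trans fB.
by apply: le_measure; rewrite ?inE.
Qed.

(** Additivity over a sequence of empty sets makes the partial sums n * Lambda set0 converge, so
    their increments tend to 0; but these increments are all equal to Lambda set0. *)
Lemma basis_set0 : {ae P, forall w, Lambda set0 w = 0}.
Proof.
have := basis_additive hLambda (B := fun=> set0) (fun=> finite_area0).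
have tr : trivIset setT (fun _ : nat => set0 : set (R * R)).
  by move=> i j _ _ [x []].
have fa : finite_area (\bigcup_(j : nat) (set0 : set (R * R))).
  by rewrite bigcup0//; exact: finite_area0.
move=> /(_ tr fa); rewrite bigcup0//; apply: filterS => w.
set l := Lambda set0 w => h.
have h1 : (\sum_(0 <= j < n.+1) l) @[n --> \oo] --> l by move: h; rewrite (cvg_shiftS (fun n => \sum_(0 <= j < n) l)).
have h2 : (\sum_(0 <= j < n.+1) l - \sum_(0 <= j < n) l) @[n --> \oo] --> l - l by exact: cvgB.
have h3 : (\sum_(0 <= j < n.+1) l - \sum_(0 <= j < n) l) @[n --> \oo] --> l.
  under eq_fun do rewrite big_nat_recr//= addrAC subrr add0r.
  exact: cvg_cst.
have := cvg_unique _ h3 h2; rewrite subrr; apply.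
exact: norm_hausdorff.
Qed.

Lemma basis_finite_additive (N : nat) (B : nat -> set (R * R)) :
  (forall j, finite_area (B j)) -> trivIset setT B ->
  (forall j, (N <= j)%N -> B j = set0) -> finite_area (\bigcup_j B j) ->
  {ae P, forall w, Lambda (\bigcup_j B j) w = \sum_(0 <= j < N) Lambda (B j) w}.
Proof.
move=> fB tB B0 fU; have := basis_additive hLambda fB tB fU.
apply: filterS2 basis_set0 => w w0 h.
have : (\sum_(0 <= j < n) Lambda (B j) w) @[n --> \oo] --> \sum_(0 <= j < N) Lambda (B j) w.
  apply: cvg_near_cst; near=> n.
  have Nn : (N <= n)%N by near: n; exact: nbhs_infty_ge.
  rewrite (big_cat_nat (leq0n N) Nn) /= [X in _ + X]big1_seq ?addr0// => j /andP[_].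
  by rewrite mem_index_iota => /andP[Nj _]; rewrite B0.
by move=> h'; apply: (cvg_unique _ h h'); exact: norm_hausdorff.
Unshelve. all: by end_near. Qed.

Section atoms.
Variables (J : finType) (A : J -> set (R * R)) (c : J -> R).
Hypothesis fA : forall i, finite_area (A i).

Let mA i : measurable (A i). Proof. by have [] := fA i. Qed.

(* The sets [A i] overlap, so the linear combination is rewritten over the
   disjoint atoms of the algebra that they generate. *)
Let signature (p : R * R) : {set J} := [set i | p \in A i]%SET.

(** The empty signature is excluded: its points form the complement of the union of the [A i], which
    has infinite area. *)
Let atom (S : {set J}) : set (R * R) :=
  [set p | S != finset.set0 /\ signature p = S].

Let measurable_atom S : measurable (atom S).
Proof.
have -> : atom S = (if S != finset.set0 then
    \bigcap_(i in [set: J]) (if i \in S then A i else ~` A i) else set0).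
  rewrite /atom; case: ifPn => [S0|S0]; apply/seteqP; split => p //=; last by case.
    move=> [_ <-] i _; rewrite inE; case: ifPn; first by rewrite inE.
    by rewrite notin_setE.
  move=> h; split => //; apply/setP => i; rewrite inE.
  have := h i I; case: ifPn => iS; first by move=> ?; rewrite mem_set.
  by move=> ?; rewrite memNset.
case: ifP => // _; apply: fin_bigcap_measurable; first exact: finite_finset.
by move=> i _; case: ifP => // _; exact: measurableC.
Qed.

Let sub_atom (S : {set J}) i : i \in S -> atom S `<=` A i.
Proof. by move=> iS p [_ Sp]; move: iS; rewrite -Sp !inE. Qed.

Let finite_area_atom (S : {set J}) : finite_area (atom S).
Proof.
have [->|[i iS]] := set_0Vmem S.
  suff -> : atom finset.set0 = set0 by exact: finite_area0.
  by apply/seteqP; split => // p []; rewrite eqxx.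
exact: (sub_finite_area _ (sub_atom iS)).
Qed.

Let N := #|{set J}|.
(** Past the last index the default signature is empty and so is its atom; the finitely many atoms
    thus become a disjoint sequence indexed by nat, the form of the axioms of the basis. *)
Let sets j : {set J} := nth finset.set0 (enum {set J}) j.
Let B j := atom (sets j).

Let atom0 : atom finset.set0 = set0.
Proof. by apply/seteqP; split => // p []; rewrite eqxx. Qed.

Let B_out j : (N <= j)%N -> B j = set0.
Proof. by move=> Nj; rewrite /B /sets nth_default ?atom0// -cardE. Qed.

Let B_inj i j p : B i p -> B j p -> i = j.
Proof.
move=> Bip Bjp.
have iN : (i < N)%N by rewrite ltnNge; apply/negP => /B_out iN; rewrite iN in Bip.
have jN : (j < N)%N by rewrite ltnNge; apply/negP => /B_out jN; rewrite jN in Bjp.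
move: Bip Bjp => [_ Si] [_ Sj]; apply/eqP.
rewrite -(nth_uniq finset.set0 (s := enum {set J})) ?enum_uniq -?cardE//.
by rewrite -/(sets i) -/(sets j) -Si -Sj.
Qed.

Let trivB : trivIset setT B.
Proof. by move=> i j _ _ [p [Bi Bj]]; exact: B_inj Bi Bj. Qed.

Let B_cover p i : A i p -> exists j, [/\ (j < N)%N, i \in sets j & B j p].
Proof.
move=> Aip; have Sin : signature p \in enum {set J} by rewrite mem_enum.
have iS : i \in signature p by rewrite inE mem_set.
exists (index (signature p) (enum {set J})).
rewrite /B /sets nth_index//; split => //; first by rewrite /N cardE index_mem.
by split => //; apply/finset.set0Pn; exists i.
Qed.

Let a j := \sum_i c i * (if i \in sets j then 1 else 0).

Let sub_basis i j := if i \in sets j then B j else set0.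

Let bigcup_sub_basis i : \bigcup_j sub_basis i j = A i.
Proof.
apply/seteqP; split => p /=.
  by move=> [j _]; rewrite /sub_basis; case: ifP => // ij /(sub_atom ij).
by move=> /B_cover[j [_ ij Bj]]; exists j => //; rewrite /sub_basis ij.
Qed.

Let basis_decompose i : {ae P, forall w, Lambda (A i) w =
  \sum_(0 <= j < N) (if i \in sets j then 1 else 0) * Lambda (B j) w}.
Proof.
have := @basis_finite_additive N (sub_basis i).
have f1 j : finite_area (sub_basis i j).
  by rewrite /sub_basis; case: ifP => _; [exact: finite_area_atom|exact: finite_area0].
have f2 : trivIset setT (sub_basis i).
  move=> k l _ _ [p []]; rewrite /sub_basis.
  by case: ifP => // _; case: ifP => // _; exact: B_inj.
have f3 j : (N <= j)%N -> sub_basis i j = set0.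
  by move=> /B_out Bj; rewrite /sub_basis Bj if_same.
rewrite bigcup_sub_basis => /(_ f1 f2 f3 (fA i)).
apply: filterS2 basis_set0 => w w0 ->; apply: eq_bigr => j _.
by rewrite /sub_basis; case: ifP => _; rewrite ?mul1r// mul0r.
Qed.

Let psi_sum p : psi (\sum_i c i * \1_(A i) p) = \sum_(0 <= j < N) psi (a j) * \1_(B j) p.
Proof.
have [[j Bj]|none] := pselect (exists j, B j p).
  have jN : (j < N)%N by rewrite ltnNge; apply/negP => /B_out jN; rewrite jN in Bj.
  have jin : j \in index_iota 0 N by rewrite mem_index_iota.
  rewrite [RHS](bigD1_seq _ jin (iota_uniq _ _)) /= [X in _ = _ + X]big1 ?addr0; last first.
    move=> k kj; rewrite indicE memNset ?mulr0// => Bk.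
    by rewrite (B_inj Bk Bj) eqxx in kj.
  rewrite indicE mem_set// mulr1; congr psi; apply: eq_bigr => i _; congr (_ * _).
  move: Bj => [_ <-]; rewrite inE indicE; by case: (p \in A i).
rewrite [RHS]big1 => [|j _]; last first.
  by rewrite indicE memNset ?mulr0// => Bj; apply: none; exists j.
rewrite big1 ?levy_exponent0// => i _; rewrite indicE memNset ?mulr0// => /B_cover[j [_ _ Bj]].
by apply: none; exists j.
Qed.

(** Over the atoms the sum has independent terms. Their exponents area (B j) * psi (a j) add up to
    the integral of psi along a simple function, [a j] being the value of the combination of
    indicators on the atom [B j]. *)
Lemma charfun_levy_basis :
  \int[P]_w cos (\sum_i c i * Lambda (A i) w) =
    expR (- fine (\int[leb2]_p (psi (\sum_i c i * \1_(A i) p))%:E)) /\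
  \int[P]_w sin (\sum_i c i * Lambda (A i) w) = 0.
Proof.
have mL (C : set (R * R)) : measurable_fun setT (Lambda C) by [].
have hB j := char_funE (mL (B j)) (basis_char_fun hLambda (a j) (finite_area_atom (sets j))).
have [hc hs] := @charfun_independent_sum R _ _ P (fun j => Lambda (B j)) a
  (fun j => expR (- (fine (area (B j)) * psi (a j)))) N (fun j => mL (B j))
  (basis_independent hLambda (fun j => finite_area_atom (sets j)) trivB)
  (fun j _ => (hB j).1) (fun j _ => (hB j).2).
have SE : {ae P, forall w, \sum_i c i * Lambda (A i) w = \sum_(0 <= j < N) a j * Lambda (B j) w}.
  have : {ae P, forall w, forall i : J, Lambda (A i) w =
      \sum_(0 <= j < N) (if i \in sets j then 1 else 0) * Lambda (B j) w}.
    apply: filter_forall => i; exact: basis_decompose.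
  apply: filterS => w h; under eq_bigr do rewrite h mulr_sumr.
  rewrite exchange_big/=; apply: eq_bigr => j _; rewrite mulr_suml.
  by apply: eq_bigr => i _; rewrite mulrA.
have mS1 : measurable_fun setT (fun w => \sum_i c i * Lambda (A i) w).
  by apply: measurable_sum => j; exact: measurable_funM.
have mS2 : measurable_fun setT (fun w => \sum_(0 <= i < N) a i * Lambda (B i) w).
  by apply: measurable_sum => i; exact: measurable_funM.
have SEc : {ae P, forall w, cos (\sum_i c i * Lambda (A i) w) = cos (\sum_(0 <= j < N) a j * Lambda (B j) w)}.
  by apply: filterS SE => w ->.
have SEs : {ae P, forall w, sin (\sum_i c i * Lambda (A i) w) = sin (\sum_(0 <= j < N) a j * Lambda (B j) w)}.
  by apply: filterS SE => w ->.
rewrite (ae_eq_Rintegral (measurableT_comp (@measurable_cos R) mS1) (measurableT_comp (@measurable_cos R) mS2) SEc).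
rewrite (ae_eq_Rintegral (measurableT_comp (@measurable_sin R) mS1) (measurableT_comp (@measurable_sin R) mS2) SEs).
split; last exact: hs.
apply: (etrans hc).
have mIB j : measurable_fun setT (\1_(B j) : R * R -> R).
  by apply: measurable_indic; exact: measurable_atom.
under eq_integral do rewrite psi_sum -sumEFin.
rewrite ge0_integral_sum//; last 2 first.
- by move=> j; apply/measurable_EFinP; apply: measurable_funM => //; exact: mIB.
- by move=> j p _; rewrite lee_fin mulr_ge0// levy_exponent_ge0.
have E j : (\int[leb2]_p (psi (a j) * \1_(B j) p)%:E = (fine (area (B j)) * psi (a j))%:E)%E.
  have [mBj fBj] := finite_area_atom (sets j).
  under eq_integral do rewrite EFinM.
  rewrite ge0_integralZl//; last 2 first.
  - by apply/measurable_EFinP; exact: mIB.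
  - by rewrite lee_fin levy_exponent_ge0.
  rewrite integral_indic// setIT [LHS]muleC EFinM; congr (_ * _)%E.
  by rewrite fineK// ge0_fin_numE// measure_ge0.
rewrite (eq_bigr _ (fun j _ => E j)).
by rewrite sumEFin /= -sumrN expR_sum.
Qed.

End atoms.

End levy_basis.

(** * Trawl sets *)

Section affine_change_of_variables.
Context {R : realType}.
Notation mu := (@lebesgue_measure R).
Local Open Scope ereal_scope.

Let aff (a b x : R) : R := (a * x + b)%R.

Let measurable_aff a b : measurable_fun setT (aff a b).
Proof. by apply: measurable_funD => //; exact: measurable_funM. Qed.

(** By uniqueness of Lebesgue measure it suffices to compare both sides on the intervals ]p, q]. *)
Lemma lebesgue_measure_affine (a b : R) (A : set R) : (0 < a)%R -> measurable A ->
  mu A = a%:E * mu ((fun x => a * x + b)%R @^-1` A).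
Proof.
move=> a0 mA.
have mf : measurable_fun [set: measurableTypeR R] (aff a b : measurableTypeR R -> measurableTypeR R).
  exact: measurable_aff.
pose f' : {mfun measurableTypeR R >-> measurableTypeR R} :=
  HB.pack (aff a b) (isMeasurableFun.Build _ _ _ _ _ mf).
have a0' : (0 <= a)%R by exact: ltW.
apply: (@lebesgue_measure_unique R (mscale (NngNum a0') (pushforward mu f')) _ A mA).
move=> _ [[p q]] _ <-.
change (mu `]p, q]%classic = a%:E * mu (aff a b @^-1` `]p, q]%classic)).
have -> : aff a b @^-1` `]p, q] = `]((p - b) / a)%R, ((q - b) / a)%R]%classic.
  apply/seteqP; split => x /=; rewrite !in_itv/= /aff.
    by rewrite ltr_pdivrMr// ler_pdivlMr// ltrBlDr lerBrDr mulrC.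
  by rewrite ltr_pdivrMr// ler_pdivlMr// ltrBlDr lerBrDr mulrC.
rewrite !lebesgue_measure_itv/= !lte_fin ltr_pM2r ?invr_gt0// ltrD2r.
case: ifP => _; last by rewrite mule0.
by rewrite -!EFinB -EFinM; congr EFin; field; rewrite gt_eqF.
Qed.

Let measurable_affR a b :
  measurable_fun [set: measurableTypeR R] (aff a b : measurableTypeR R -> measurableTypeR R).
Proof. exact: measurable_aff. Qed.

Lemma ge0_integral_affine (a b : R) (f : R -> \bar R) : (0 < a)%R ->
  measurable_fun setT f -> (forall x, 0 <= f x) ->
  \int[mu]_x f x = a%:E * \int[mu]_x f (a * x + b)%R.
Proof.
move=> a0 mf f0.
have a0' : (0 <= a)%R by exact: ltW.
pose m := measure_function_pushforward__canonical__measure_function_Measure mu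
  (measurable_affR a b).
transitivity (\int[mscale (NngNum a0') m]_x f x).
  by apply: eq_measure_integral => A mA _; exact: lebesgue_measure_affine.
rewrite ge0_integral_mscale//; congr (_ * _).
exact: (ge0_integral_pushforward (measurable_affR a b)).
Qed.

Lemma ge0_integral_opp (f : R -> \bar R) :
  measurable_fun setT f -> (forall x, 0 <= f x) ->
  \int[mu]_x f x = \int[mu]_x f (- x)%R.
Proof.
move=> mf f0.
have mopp : measurable_fun [set: measurableTypeR R] (-%R : measurableTypeR R -> measurableTypeR R).
  exact: oppr_measurable.
pose m := measure_function_pushforward__canonical__measure_function_Measure mu mopp.
transitivity (\int[m]_x f x).
  by apply: eq_measure_integral => A mA _; apply/esym; exact: lebesgue_measureN.
exact: (ge0_integral_pushforward mopp).
Qed.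

Lemma ge0_integral_reflect (t : R) (f : R -> \bar R) :
  measurable_fun setT f -> (forall x, 0 <= f x) ->
  \int[mu]_x f (t - x)%R = \int[mu]_x f x.
Proof.
move=> mf f0; rewrite [RHS](ge0_integral_affine t ltr01)// mul1e.
rewrite [RHS](ge0_integral_opp (f := fun x => f (1 * x + t)%R))//.
  by apply: eq_integral => x _; rewrite mul1r addrC.
by apply: (measurableT_comp mf); exact: measurable_aff.
Qed.

End affine_change_of_variables.

Section trawl_sets.
Context {R : realType} (gamma : R) (g : R -> R) (hg : trawl_function gamma g).
Notation mu := (@lebesgue_measure R).
Notation leb2 := (mu \x mu)%E.
Notation A := (trawl_set g).

Lemma trawl_le x y : 0 <= x -> x <= y -> g y <= g x.
Proof.
move=> x0; rewrite le_eqVlt => /predU1P[->//|xy].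
by apply: ltW; exact: (trawl_decreasing hg).
Qed.

(** Extends [g] to the left by the constant g 0; the result is nonincreasing on the whole line,
    hence measurable. *)
Let gp (z : R) : R := g (Num.max z 0).

Let gpE z : 0 <= z -> gp z = g z.
Proof. by move=> z0; rewrite /gp max_l. Qed.

Lemma measurable_trawl_ext : measurable_fun setT gp.
Proof.
apply: nonincreasing_measurable => // x y xy; apply: trawl_le.
  by rewrite le_max lexx orbT.
by rewrite ge_max le_max xy/= le_max lexx orbT.
Qed.

Lemma measurable_trawl_set t : measurable (A t).
Proof.
have -> : A t = ([set p | p.1 <= t] `&` [set p | 0 <= p.2]) `&` [set p | p.2 <= gp (t - p.1)].
  apply/seteqP; split => p /=.
    by move=> [pt /andP[p0 pg]]; split => //; rewrite gpE// subr_ge0.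
  by move=> [[pt p0]]; rewrite gpE ?subr_ge0// => pg; split => //; rewrite p0.
have m1 : measurable_fun setT (fun p : R * R => p.1) by exact: measurable_fst.
have m2 : measurable_fun setT (fun p : R * R => p.2) by exact: measurable_snd.
have mg : measurable_fun setT (fun p : R * R => gp (t - p.1)).
  by apply: (measurableT_comp measurable_trawl_ext); exact: measurable_funB.
apply: measurableI; first apply: measurableI.
- by rewrite -[X in measurable X]setTI; apply: (measurable_fun_ler (g := cst t)).
- by rewrite -[X in measurable X]setTI; apply: (measurable_fun_ler (f := cst 0)).
- by rewrite -[X in measurable X]setTI; apply: measurable_fun_ler.
Qed.

Local Open Scope ereal_scope.

Let area_trawlE t : leb2 (A t) = \int[mu]_(x in `[0%R, +oo[) (g x)%:E.
Proof.
rewrite [LHS]/product_measure1.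
transitivity (\int[mu]_x (fun z => (g z * \1_`[0%R, +oo[ z)%:E) (t - x)%R).
  apply: eq_integral => x _ /=.
  have [xt|xt] := leP x t.
    have -> : xsection (A t) x = `[0%R, g (t - x)]%classic.
      apply/seteqP; split => y; rewrite /xsection/= inE/= in_itv/=.
        by move=> [].
      by [].
    rewrite lebesgue_measure_itv/= lte_fin indicE mem_set ?mulr1; last first.
      by rewrite /= in_itv/= subr_ge0 xt.
    case: ltP => [_|]; first by rewrite oppr0 addr0.
    have := @trawl_ge0 _ _ _ hg (t - x)%R; rewrite subr_ge0 => /(_ xt) h1 h2.
    by congr EFin; apply/eqP; rewrite eq_le h1 h2.
  have -> : xsection (A t) x = set0.
    by apply/seteqP; split => y //; rewrite /xsection/= inE => -[/=]; rewrite leNgt xt.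
  rewrite measure0 indicE memNset ?mulr0//= in_itv/= andbT subr_ge0 leNgt xt//.
rewrite (@ge0_integral_reflect R t (fun z => (g z * \1_`[0%R, +oo[ z)%:E)).
- by rewrite -integral_mul_indic.
- apply/measurable_EFinP.
  have -> : (fun z => (g z * \1_`[0%R, +oo[ z)%R) = (fun z => (gp z * \1_`[0%R, +oo[ z)%R).
    apply/funext => z; rewrite indicE; case: (boolP (z \in _)) => [|_]; rewrite ?mulr0//.
    by rewrite inE/= in_itv/= andbT => z0; rewrite gpE.
  apply: measurable_funM; first exact: measurable_trawl_ext.
  exact: measurable_indic.
- move=> z; rewrite lee_fin indicE; case: (boolP (z \in _)) => [|_]; rewrite ?mulr0//.
  by rewrite inE/= in_itv/= andbT mulr1 => z0; exact: (trawl_ge0 hg).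
Qed.

Lemma area_trawl_set s t : leb2 (A s) = leb2 (A t).
Proof. by rewrite !area_trawlE. Qed.

Lemma finite_area_trawl_set t : finite_area (A t).
Proof.
split; first exact: measurable_trawl_set.
rewrite /area area_trawlE; apply: integrable_lty => //; exact: (trawl_integrable hg).
Qed.

(** At an abscissa x <= r the section of A s is contained in that of A r, since [g] decreases. What
    remains lies in the strip r < x <= s, below height g 0. *)
Let area_trawl_diff r s : (r <= s)%R -> leb2 (A s `\` A r) <= (g 0 * (s - r))%:E.
Proof.
move=> rs.
have sub : A s `\` A r `<=` `]r, s]%classic `*` `[0%R, g 0]%classic.
  move=> [x y] [] [/= xs /andP[y0 ys]] nr; split; rewrite /= in_itv/=.
    rewrite xs andbT ltNge; apply/negP => xr; apply: nr; split => //=.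
    by rewrite y0 (le_trans ys)// trawl_le// ?subr_ge0// lerD2r.
  by rewrite y0 (le_trans ys)// trawl_le// subr_ge0.
apply: (@le_trans _ _ (leb2 (`]r, s]%classic `*` `[0%R, g 0]%classic))).
  apply: le_measure; rewrite ?inE//.
    by apply: measurableD; exact: measurable_trawl_set.
  exact: measurableX.
rewrite [leLHS](_ : _ = mu `]r, s]%classic * mu `[0%R, g 0]%classic); last first.
  exact: product_measure1E.
rewrite !lebesgue_measure_itv/= !lte_fin.
have g0 : (0 <= g 0)%R by exact: (trawl_ge0 hg).
case: ifP => _; last by rewrite mul0e lee_fin mulr_ge0// subr_ge0.
case: ifP => _; last by rewrite mule0 lee_fin mulr_ge0// subr_ge0.
by rewrite -!EFinB -EFinM lee_fin subr0 mulrC.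
Qed.

(** All trawl sets have the same finite area, so the two differences have equal areas and the
    one-sided bound is used twice. *)
Lemma area_trawl_symdiff r s :
  leb2 (A s `\` A r) + leb2 (A r `\` A s) <= (2 * g 0 * `|s - r|)%:E.
Proof.
wlog rs : r s / (r <= s)%R.
  move=> h; have [|/ltW] := leP r s; first exact: h.
  by rewrite addeC distrC; exact: h.
have E : leb2 (A r `\` A s) = leb2 (A s `\` A r).
  have fin t : leb2 (A t) < +oo by have [] := finite_area_trawl_set t.
  have mA := measurable_trawl_set.
  have D1 := @measureD _ _ _ leb2 _ _ (mA r) (mA s) (fin r).
  have D2 := @measureD _ _ _ leb2 _ _ (mA s) (mA r) (fin s).
  apply: (etrans D1); apply/esym; apply: (etrans D2).
  by congr (_ - _); [exact: area_trawl_set|rewrite setIC].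
rewrite E ger0_norm ?subr_ge0//.
have -> : (2 * g 0 * (s - r) = g 0 * (s - r) + g 0 * (s - r))%R by ring.
by rewrite EFinD; apply: leeD; exact: area_trawl_diff.
Qed.

End trawl_sets.

(** * Moments and time integrals of the trawl process *)

Section power_integrals.
Context {R : realType}.
Notation mu := (@lebesgue_measure R).
Local Open Scope ereal_scope.

Lemma integral_powR_itv (a b q : R) : (0 < a)%R -> (a <= b)%R -> (q + 1 != 0)%R ->
  \int[mu]_(u in `[a, b]) (u `^ q)%:E = ((b `^ (q + 1) - a `^ (q + 1)) / (q + 1))%:E.
Proof.
move=> a0; rewrite le_eqVlt => /predU1P[<-|ab] q1.
  by rewrite set_itv1 integral_set1 subrr mul0r.
pose F (u : R) := (u `^ (q + 1) / (q + 1))%R.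
have dF (u : R) : (0 < u)%R -> is_derive u 1%R F (u `^ q)%R.
  move=> u0; have dp := is_derive1_powR (q + 1) u0; rewrite /F; apply: is_derive_eq.
  by rewrite /GRing.scale/= addrK; field.
have dFd (u : R) : (0 < u)%R -> derivable F u 1%R by move=> u0; have [] := dF _ u0.
have cF (u : R) : (0 < u)%R -> {for u, continuous F}.
  by move=> u0; apply: differentiable_continuous; exact/derivable1_diffP/dFd.
rewrite (@continuous_FTC2 R _ F)//.
- by rewrite -EFinB /F -mulrBl.
- apply/continuous_in_subspaceT => u; rewrite inE/= in_itv/= => /andP[au _].
  have u0 := lt_le_trans a0 au.
  apply: differentiable_continuous; apply/derivable1_diffP.
  by have [] := is_derive1_powR q u0.
- split; first by move=> u; rewrite in_itv/= => /andP[au _]; apply: dFd; exact: lt_trans au.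
    by apply: cvg_at_right_filter; exact: cF.
  by apply: cvg_at_left_filter; apply: cF; exact: lt_trans ab.
- move=> u; rewrite in_itv/= => /andP[au _].
  by rewrite derive1E; have [_ ->] := dF _ (lt_trans a0 au).
Qed.

Lemma itv0y_bigcup : `]0%R, +oo[%classic = \bigcup_k `[k.+1%:R^-1%R, k.+1%:R%R]%classic :> set R.
Proof.
apply/seteqP; split => x /=.
  rewrite in_itv/= andbT => x0; pose k := maxn (Num.truncn x) (Num.truncn x^-1).
  have h1 : (x < k.+1%:R)%R.
    by rewrite (lt_le_trans (truncnS_gt _))// ler_nat ltnS leq_maxl.
  have h2 : (x^-1 < k.+1%:R)%R.
    by rewrite (lt_le_trans (truncnS_gt _))// ler_nat ltnS leq_maxr.
  exists k => //=; rewrite in_itv/= (ltW h1) andbT.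
  by rewrite invf_ple ?posrE// ltW.
by move=> [k _]/=; rewrite !in_itv/= andbT => /andP[h _]; apply: lt_le_trans h; rewrite invr_gt0.
Qed.

Lemma nondecreasing_itv0y :
  nondecreasing_seq (fun k => `[k.+1%:R^-1%R, k.+1%:R%R]%classic : set R).
Proof.
apply/nondecreasing_seqP => k; apply/subsetPset => x /=; rewrite !in_itv/= => /andP[h1 h2].
rewrite (le_trans _ h1) ?(le_trans h2) ?ler_nat//.
by rewrite lef_pV2 ?posrE// ler_nat.
Qed.

(** Monotone convergence along the segments [1 / (k + 1), k + 1]; reduces improper power integrals
    to the fundamental theorem of calculus on segments. *)
Lemma integral_itv0y_le (f : R -> \bar R) (C : \bar R) :
  measurable_fun (`]0%R, +oo[ : set R) f -> (forall x, (0 < x)%R -> 0 <= f x) ->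
  (forall a b, (0 < a)%R -> (a <= b)%R -> \int[mu]_(x in `[a, b]) f x <= C) ->
  \int[mu]_(x in `]0%R, +oo[) f x <= C.
Proof.
move=> mf f0 h; rewrite itv0y_bigcup.
have k0 (k : nat) (x : R) : `[k.+1%:R^-1%R, k.+1%:R%R]%classic x -> (0 < x)%R.
  by rewrite /= in_itv/= => /andP[+ _]; apply: lt_le_trans; rewrite invr_gt0.
have mfk (k : nat) : measurable_fun (`[k.+1%:R^-1%R, k.+1%:R%R]%classic : set (measurableTypeR R)) f.
  apply: measurable_funS mf => //.
  by move=> x /k0 x0; rewrite /= in_itv/= andbT.
have /cvg_lim <- // := @ge0_nondecreasing_set_cvg_integral _ (measurableTypeR R) R
  (fun k => `[k.+1%:R^-1%R, k.+1%:R%R]%classic : set R) f mu nondecreasing_itv0y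
  (fun k => measurable_itv _) mfk (fun k x kx => f0 x (k0 k x kx)).
apply: lime_le.
  apply: ereal_nondecreasing_is_cvgn.
  apply: ge0_nondecreasing_set_nondecreasing_integral => //; first exact: nondecreasing_itv0y.
  by move=> k x /k0; exact: f0.
apply: nearW => k; apply: h; first by rewrite invr_gt0.
by rewrite invf_ple ?posrE// (@le_trans _ _ 1%R) ?invf_le1// ?ler1n// invr_le1.
Qed.

Lemma integral_powR_0a (a q : R) : (0 < a)%R -> (- 1 < q)%R ->
  \int[mu]_(u in `]0%R, a]) (u `^ q)%:E <= (a `^ (q + 1) / (q + 1))%:E.
Proof.
move=> a0 q1; have q10 : (0 < q + 1)%R by lra.
have -> : `]0%R, a]%classic = (`]0%R, +oo[%classic `&` `]-oo, a]%classic : set R).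
  by apply/seteqP; split => x /=; rewrite !in_itv/= andbT; [move=> /andP[-> ->]|move=> [-> ->]].
rewrite integral_mkcondr; apply: integral_itv0y_le.
- apply: (measurable_funS _ (@subsetT _ _)) => //; apply/measurable_restrict => //.
  by apply: measurable_funTS; apply/measurable_EFinP; exact: measurable_powR.
- by move=> x _; rewrite patchE; case: ifP; rewrite // lee_fin powR_ge0.
- move=> b c b0 bc; rewrite -integral_mkcondr.
  have [ab|ba] := ltP a b.
    rewrite (_ : _ `&` _ = set0) ?integral_set0 ?lee_fin ?divr_ge0 ?powR_ge0 ?(ltW q10)//.
    apply/seteqP; split => // x /= []; rewrite !in_itv/= => /andP[bx _] xa.
    by have := lt_le_trans ab (le_trans bx xa); rewrite ltxx.
  apply: (@le_trans _ _ (\int[mu]_(u in `[b, a]) (u `^ q)%:E)).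
    apply: ge0_subset_integral => //.
    - by apply: measurableI.
    - by apply: measurable_funTS; apply/measurable_EFinP; exact: measurable_powR.
    - by move=> x _; rewrite lee_fin powR_ge0.
    - by move=> x /= []; rewrite !in_itv/= => /andP[-> _] ->.
  rewrite integral_powR_itv ?gt_eqF// lee_fin ler_pM2r ?invr_gt0//.
  by rewrite lerBlDr lerDl powR_ge0.
Qed.

Lemma integral_powR_ay (a q : R) : (0 < a)%R -> (q < - 1)%R ->
  \int[mu]_(u in `[a, +oo[) (u `^ q)%:E <= (a `^ (q + 1) / - (q + 1))%:E.
Proof.
move=> a0 q1; have q10 : (0 < - (q + 1))%R by lra.
have -> : `[a, +oo[%classic = (`]0%R, +oo[%classic `&` `[a, +oo[%classic : set R).
  apply/seteqP; split => x /=; rewrite !in_itv/= !andbT; last by case.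
  by move=> ax; split => //; exact: lt_le_trans ax.
rewrite integral_mkcondr; apply: integral_itv0y_le.
- apply: (measurable_funS _ (@subsetT _ _)) => //; apply/measurable_restrict => //.
  by apply: measurable_funTS; apply/measurable_EFinP; exact: measurable_powR.
- by move=> x _; rewrite patchE; case: ifP; rewrite // lee_fin powR_ge0.
- move=> b c b0 bc; rewrite -integral_mkcondr.
  have [ca|ac] := ltP c a.
    rewrite (_ : _ `&` _ = set0) ?integral_set0 ?lee_fin ?divr_ge0 ?powR_ge0 ?(ltW q10)//.
    apply/seteqP; split => // x /= []; rewrite !in_itv/= andbT => /andP[_ xc] ax.
    by have := lt_le_trans ca (le_trans ax xc); rewrite ltxx.
  apply: (@le_trans _ _ (\int[mu]_(u in `[a, c]) (u `^ q)%:E)).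
    apply: ge0_subset_integral => //.
    - by apply: measurableI.
    - by apply: measurable_funTS; apply/measurable_EFinP; exact: measurable_powR.
    - by move=> x _; rewrite lee_fin powR_ge0.
    - by move=> x /= []; rewrite !in_itv/= andbT => /andP[_ ->] ->.
  rewrite integral_powR_itv ?lt_eqF//; last by rewrite -oppr_gt0.
  rewrite lee_fin invrN mulrBl mulrN gerDr.
  by rewrite mulr_ge0_le0 ?powR_ge0// invr_le0; lra.
Qed.

End power_integrals.

Section absolute_moment.
Context {R : realType}.
Notation mu := (@lebesgue_measure R).
Local Open Scope ereal_scope.

Lemma onemcos1_gt0 : (0 < 1 - cos 1 :> R)%R.
Proof.
rewrite subr_gt0 -[ltRHS]cos0 ltr_cos ?ltr01// in_itv/= ?lexx ?pi_ge0//.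
by rewrite ler01 (le_trans _ (@pi_ge2 R))// ler1n.
Qed.

Let measurable_onemcos_powR (z q : R) :
  measurable_fun setT (fun u : R => ((1 - cos (u * z)) * u `^ q)%:E).
Proof.
apply/measurable_EFinP; apply: measurable_funM; last exact: measurable_powR.
apply: measurable_funB => //; apply: (measurableT_comp (@measurable_cos R)).
exact: measurable_funM.
Qed.

(** By scaling the integral is a multiple of |z|, and a lower bound suffices. On 1 / |z| <= u <= 2 /
    |z| the product u * |z| lies in [1, 2], where 1 - cos is at least 1 - cos 1; the length 1 / |z|
    times (2 / |z|) ^ (- 2) gives |z| / 4. *)
Lemma abs_le_integral_onemcos (z : R) :
  ((1 - cos 1) / 4 * `|z|)%:E <=
  \int[mu]_(u in `]0%R, +oo[) ((1 - cos (u * z)) * u `^ (-2))%:E.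
Proof.
have f0 (u : R) : 0 <= ((1 - cos (u * z)) * u `^ (-2))%:E.
  by rewrite lee_fin mulr_ge0 ?onemcos_ge0 ?powR_ge0.
have [->|z0] := eqVneq z 0%R; first rewrite normr0 mulr0.
  by apply: integral_ge0 => u _; rewrite lee_fin mulr_ge0 ?onemcos_ge0 ?powR_ge0.
have az0 : (0 < `|z|)%R by rewrite normr_gt0.
have le12 : (`|z|^-1 <= 2 / `|z|)%R by rewrite ler_peMl ?invr_ge0// ler1n.
apply: (@le_trans _ _ (\int[mu]_(u in `[`|z|^-1%R, (2 / `|z|)%R]) ((1 - cos 1) * (2 / `|z|) `^ (-2))%:E)).
  rewrite integral_cst//= lebesgue_measure_itv/= lte_fin.
  have -> : (`|z|^-1 < 2 / `|z|)%R by rewrite ltr_pMl ?invr_gt0// ltr1n.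
  rewrite -EFinB -EFinM lee_fin.
  have -> : ((2 / `|z|) `^ (-2) = `|z| ^+ 2 / 4)%R.
    by rewrite powR_invn ?divr_ge0//; field; rewrite normr_eq0.
  by rewrite le_eqVlt; apply/orP; left; apply/eqP; field; rewrite normr_eq0.
apply: (@le_trans _ _ (\int[mu]_(u in `[`|z|^-1%R, (2 / `|z|)%R]) ((1 - cos (u * z)) * u `^ (-2))%:E)).
  apply: ge0_le_integral => //.
  - by apply: measurable_funTS; exact: measurable_onemcos_powR.
  - move=> u; rewrite /= in_itv/= => /andP[u1 u2]; rewrite lee_fin.
    have u0 : (0 < u)%R by rewrite (lt_le_trans _ u1)// invr_gt0.
    apply: ler_pM => //; rewrite ?powR_ge0 ?(ltW onemcos1_gt0)//.
      rewrite lerD2l lerN2 -(cos_norm (u * z)) normrM (gtr0_norm u0).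
      have c1 : (1 <= u * `|z|)%R by rewrite -ler_pdivrMr// mul1r.
      have c2 : (u * `|z| <= 2)%R by rewrite -ler_pdivlMr.
      move: c1; rewrite le_eqVlt => /predU1P[<-//|c1].
      rewrite ltW// ltr_cos// in_itv/=.
        by rewrite ler01/= (le_trans _ (@pi_ge2 R))// ler1n.
      by rewrite (le_trans ler01 (ltW c1))/= (le_trans c2)// pi_ge2.
    rewrite !powRN lef_pV2 ?posrE ?powR_gt0 ?divr_gt0//.
    by rewrite ge0_ler_powR// nnegrE ?divr_ge0// ltW.
apply: ge0_subset_integral => //.
- by apply: measurable_funTS; exact: measurable_onemcos_powR.
- move=> u /=; rewrite !in_itv/= andbT => /andP[u1 _].
  by rewrite (lt_le_trans _ u1)// invr_gt0.
Qed.

End absolute_moment.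

Section moment_bound.
Context {R : realType} d (T : measurableType d) (P : probability T R).
Variables (Z : T -> R) (psi : R -> R) (gamma : R).
Notation mu := (@lebesgue_measure R).
Hypotheses (mZ : measurable_fun setT Z) (mpsi : measurable_fun setT psi)
  (psi0 : forall u, 0 <= psi u) (gamma0 : 0 < gamma).
Local Open Scope ereal_scope.

Let integrand (p : R * T) : \bar R :=
  ((1 - cos (p.1 * Z p.2)) * p.1 `^ (-2) * \1_`]0%R, +oo[ p.1)%:E.

Let measurable_integrand : measurable_fun setT integrand.
Proof.
apply/measurable_EFinP; apply: measurable_funM.
  apply: measurable_funM.
    apply: measurable_funB => //; apply: (measurableT_comp (@measurable_cos R)).
    by apply: measurable_funM => //; exact: measurableT_comp.
  by apply: (measurableT_comp (measurable_powR (-2))).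
have mi : measurable_fun setT (\1_`]0%R, +oo[ : R -> R) by exact: measurable_indic.
exact: (measurableT_comp mi).
Qed.

Let integrand_ge0 p : 0 <= integrand p.
Proof. by rewrite lee_fin !mulr_ge0// ?onemcos_ge0 ?powR_ge0. Qed.

(* The integral in [abs_le_integral_onemcos] is cut at [L]: below [L],
   [u `^ (- 2) <= L `^ gamma * u `^ (- 2 - gamma)], and above it [1 - cos] is
   at most 2. *)
Lemma moment_bound (a L : R) : (0 <= a)%R -> (0 < L)%R ->
  (forall u, 1 - \int[P]_w cos (u * Z w) <= a * psi u)%R ->
  ((1 - cos 1) / 4)%:E * \int[P]_w `|Z w|%:E <=
  (a * L `^ gamma)%:E * \int[mu]_(u in `]0%R, +oo[) (psi u * u `^ (- 2 - gamma))%:E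
  + (2 / L)%:E.
Proof.
move=> a0 L0 h.
have c0 : (0 <= (1 - cos 1) / 4 :> R)%R by rewrite divr_ge0// ltW// onemcos1_gt0.
rewrite -ge0_integralZl//; last by apply/measurable_EFinP; exact: measurableT_comp.
apply: (@le_trans _ _ (\int[P]_w \int[mu]_u integrand (u, w))).
  apply: ge0_le_integral => //.
  - by apply: emeasurable_funM => //; apply/measurable_EFinP; exact: measurableT_comp.
  - exact: (@measurable_fun_fubini_tonelli_G _ _ _ _ _ mu _ measurable_integrand integrand_ge0).
  - move=> w _; rewrite -EFinM (le_trans (abs_le_integral_onemcos _))//.
    by rewrite integral_mul_indic.
rewrite -(@fubini_tonelli _ _ _ _ _ mu P integrand)//.
have mphi : measurable_fun setT (fun u => \int[P]_w integrand (u, w)).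
  exact: (@measurable_fun_fubini_tonelli_F _ _ _ _ _ P _ measurable_integrand integrand_ge0).
have mpp : measurable_fun setT (fun u : R => (psi u * u `^ (- 2 - gamma))%:E).
  by apply/measurable_EFinP; apply: measurable_funM => //; exact: measurable_powR.
apply: (@le_trans _ _ (\int[mu]_(u in `]0%R, +oo[)
    ((a * L `^ gamma)%:E * (psi u * u `^ (- 2 - gamma))%:E + (2 * u `^ (-2) * \1_`[L, +oo[ u)%:E))).
  rewrite [leRHS]integral_mkcond; apply: ge0_le_integral => //.
  - by move=> u _; apply: integral_ge0.
  - apply/(measurable_restrict _ _ _) => //.
    apply: measurable_funTS; apply: emeasurable_funD.
      exact: emeasurable_funM.
    apply/measurable_EFinP; apply: measurable_funM; last exact: measurable_indic.
    by apply: measurable_funM => //; exact: measurable_powR.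
  - move=> u _; rewrite patchE.
    case: (boolP (u \in _)) => [|u0]; last first.
      rewrite integral0_eq// => w _; rewrite /integrand/= indicE (negbTE u0).
      by rewrite mulr0.
    rewrite inE/= in_itv/= andbT => u0.
    have E : \int[P]_w integrand (u, w) = ((1 - \int[P]_w cos (u * Z w)) * u `^ (-2))%:E.
      have mc : measurable_fun setT (fun w => cos (u * Z w)).
        by apply: (measurableT_comp (@measurable_cos R)); exact: measurable_funM.
      have ic := @bounded_integrable _ _ _ P _ 1%R mc (fun w => cos_max _).
      have i1 : P.-integrable setT (EFin \o cst (1%R : R)) by exact: finite_measure_integrable_cst.
      have -> : (1 - \int[P]_w cos (u * Z w) = \int[P]_w (1 - cos (u * Z w)))%R.
        by rewrite RintegralB// Rintegral_prob_cst.
      rewrite -RintegralZr//; last by apply: (integrableB _ i1 ic).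
      rewrite /Rintegral fineK.
        apply: eq_integral => w _; rewrite /integrand/= indicE mem_set ?mulr1//.
        by rewrite /= in_itv/= andbT.
      apply: integrable_fin_num => //.
      apply: (@bounded_integrable _ _ _ P _ (2 * u `^ (-2))%R) => [|w].
        by apply: measurable_funM => //; exact: measurable_funB.
      rewrite ger0_norm ?mulr_ge0 ?onemcos_ge0 ?powR_ge0//.
      by rewrite ler_wpM2r ?powR_ge0// onemcos_le2.
    rewrite E -EFinM -EFinD lee_fin.
    have Ec : (`|\int[P]_w cos (u * Z w)| <= 1)%R.
      apply: Rintegral_bounded => [|w]; last exact: cos_max.
      by apply: (measurableT_comp (@measurable_cos R)); exact: measurable_funM.
    rewrite indicE; case: (boolP (u \in _)) => uL.
      rewrite mulr1 -[leLHS]add0r lerD//.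
        by rewrite !mulr_ge0// ?powR_ge0.
      by rewrite ler_wpM2r ?powR_ge0//; move: Ec; rewrite ler_norml; lra.
    have {uL} : (u < L)%R by move: uL; rewrite notin_setE /= in_itv/= andbT => /negP; rewrite -ltNge.
    move=> uL; rewrite mulr0 addr0.
    have -> : (u `^ (-2) = u `^ (- 2 - gamma) * u `^ gamma)%R.
      have hu : (- 2 - gamma + gamma == 0)%R ==> (u != 0)%R by rewrite (gt_eqF u0) implybT.
      by rewrite -powRD// subrK.
    have -> : (a * L `^ gamma * (psi u * u `^ (- 2 - gamma)) =
      (a * psi u) * (u `^ (- 2 - gamma) * L `^ gamma))%R by ring.
    apply: ler_pM => //.
    + by move: Ec; rewrite ler_norml; lra.
    + by rewrite mulr_ge0// powR_ge0.
    + by rewrite ler_wpM2l ?powR_ge0// ge0_ler_powR// ?nnegrE ltW.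
rewrite ge0_integralD//=; last 4 first.
- by move=> u _; rewrite -EFinM lee_fin !mulr_ge0// powR_ge0.
- by apply: measurable_funTS; exact: emeasurable_funM.
- by move=> u _; rewrite lee_fin !mulr_ge0// powR_ge0.
- apply: measurable_funTS; apply/measurable_EFinP.
  apply: measurable_funM; last exact: measurable_indic.
  by apply: measurable_funM => //; exact: measurable_powR.
apply: leeD.
  rewrite ge0_integralZl//.
  - exact: measurable_funTS.
  - by move=> u _; rewrite lee_fin mulr_ge0// powR_ge0.
  - by rewrite lee_fin mulr_ge0// powR_ge0.
apply: (@le_trans _ _ (\int[mu]_(u in `[L, +oo[) (2%:E * (u `^ (-2))%:E))).
  rewrite [leRHS](_ : _ = \int[mu]_u (2 * u `^ (-2) * \1_`[L, +oo[ u)%:E).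
    apply: ge0_subset_integral => //.
    - apply/measurable_EFinP; apply: measurable_funM; last exact: measurable_indic.
      by apply: measurable_funM => //; exact: measurable_powR.
    - by move=> u _; rewrite lee_fin !mulr_ge0// powR_ge0.
  rewrite -integral_mul_indic; apply: eq_integral => u _; by rewrite EFinM.
rewrite ge0_integralZl//; last 2 first.
- by apply/measurable_EFinP; apply: measurable_funTS; exact: measurable_powR.
- by move=> u _; rewrite lee_fin powR_ge0.
have h2 : (- 2 < - 1 :> R)%R by lra.
apply: (le_trans (lee_wpmul2l _ (integral_powR_ay L0 h2))); first by rewrite lee_fin.
have -> : (- 2 + 1 = - 1 :> R)%R by ring.
by rewrite powR_inv1 ?(ltW L0)// opprK divr1 -EFinM.
Qed.

End moment_bound.

(** * Riemann sums of functions and of processes *)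

Section step_functions.
Context {R : realType} (V : R) (V0 : 0 <= V).
Notation mu := (@lebesgue_measure R).

Definition grid (N k : nat) : R := k%:R * V / N%:R.

Definition grid_step (N : nat) (h : R -> R) (s : R) : R :=
  \sum_(k < N) h (grid N k) * \1_`[grid N k, grid N k.+1[ s.

Lemma grid_ge0 N k : 0 <= grid N k.
Proof. by rewrite /grid divr_ge0// mulr_ge0. Qed.

Lemma measurable_grid_step N h : measurable_fun setT (grid_step N h).
Proof.
by apply: measurable_sum => k; apply: measurable_funM => //; exact: measurable_indic.
Qed.

(** The point r is the left end of the mesh cell containing s. It does not depend on [h], so the
    same r serves paths, expectations and indicators. *)
Lemma grid_stepP N s : (0 < N)%N -> 0 <= s < V ->
  exists r, [/\ forall h, grid_step N h s = h r, 0 <= r <= s & s - V / N%:R < r].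
Proof.
move=> N0 /andP[s0 sV].
have V1 : 0 < V by exact: le_lt_trans sV.
have n0 : 0 < N%:R :> R by rewrite ltr0n.
pose x := s * N%:R / V.
have x0 : 0 <= x by rewrite divr_ge0// mulr_ge0.
have /andP[k1 k2] := truncn_itv x0; set k := Num.truncn x in k1 k2.
have xs : s = x * V / N%:R by rewrite /x; field; rewrite !gt_eqF.
have kN : (k < N)%N.
  rewrite -(ltr_nat R) (le_lt_trans k1)// /x ltr_pdivrMr// mulrC ltr_pM2l//.
have g1 : grid N k <= s by rewrite [leRHS]xs /grid ler_pM2r ?invr_gt0// ler_pM2r.
have g2 : s < grid N k.+1 by rewrite [ltLHS]xs /grid ltr_pM2r ?invr_gt0// ltr_pM2r.
exists (grid N k); rewrite grid_ge0 g1; split => //; last first.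
  rewrite ltrBlDr (lt_le_trans g2)// /grid -natr1 !mulrDl mul1r//.
move=> h; rewrite /grid_step (bigD1 (Ordinal kN))//= big1 ?addr0.
  by rewrite indicE mem_set ?mulr1//= in_itv/= g1.
move=> j jk; rewrite indicE memNset ?mulr0//= in_itv/= => /andP[h1 h2].
have jk' : j = k :> nat.
  have gi i l : grid N i < grid N l -> (i < l)%N.
    by rewrite /grid ltr_pM2r ?invr_gt0// ltr_pM2r// ltr_nat.
  have := gi _ _ (le_lt_trans h1 g2); have := gi _ _ (le_lt_trans g1 h2).
  by rewrite !ltnS => a1 a2; apply/eqP; rewrite eqn_leq a1 a2.
by move/eqP: jk; apply; apply/val_inj.
Qed.

Lemma grid_step_bound N h M s : 0 <= M -> (forall r, 0 <= r -> `|h r| <= M) -> (0 < N)%N -> 0 <= s < V ->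
  `|grid_step N h s| <= M.
Proof.
move=> M0 hM N0 sV; have [r [-> /andP[r0 _] _]] := grid_stepP N0 sV.
exact: hM.
Qed.

Lemma integral_grid_step N h : (0 < N)%N ->
  mu.-integrable `[0, V[ (EFin \o grid_step N h) /\
  \int[mu]_(s in `[0, V[) grid_step N h s = V / N%:R * \sum_(k < N) h (grid N k).
Proof.
move=> N0; have n0 : 0 < N%:R :> R by rewrite ltr0n.
have I1 (k : 'I_N) : mu.-integrable `[0, V[
    (EFin \o (fun s => h (grid N k) * \1_`[grid N k, grid N k.+1[ s)).
  have i0 : mu.-integrable `[0, V[ (EFin \o (\1_`[grid N k, grid N k.+1[ : R -> R)).
    by apply: (integrableS measurableT) => //; exact: integrable_indic_itv.
  exact: (integrableZl _ _ i0).
have E : EFin \o grid_step N h = (fun s => \sum_(k < N) (h (grid N k) * \1_`[grid N k, grid N k.+1[ s)%:E)%E.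
  by apply/funext => s /=; rewrite /grid_step sumEFin.
split; first by rewrite E; apply: integrable_sum => // k _; exact: I1.
rewrite /Rintegral -/(EFin \o grid_step N h).
have -> : (\int[mu]_(s in `[0%R, V[) (grid_step N h s)%:E =
    \int[mu]_(s in `[0%R, V[) (\sum_(k < N) (h (grid N k) * \1_`[grid N k, grid N k.+1[ s)%:E))%E.
  by apply: eq_integral => s _; rewrite /grid_step sumEFin.
rewrite integral_sum// mulr_sumr.
have Ik (k : 'I_N) : (\int[mu]_(s in `[0%R, V[) (h (grid N k) * \1_`[grid N k, grid N k.+1[ s)%:E =
    (V / N%:R * h (grid N k))%:E)%E.
  under eq_integral do rewrite EFinM.
  rewrite integralZl//=; last first.
    by apply: (integrableS measurableT) => //; exact: integrable_indic_itv.
  rewrite integral_indic//= setIidl; last first.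
    move=> s /=; rewrite !in_itv/= => /andP[s1 s2]; rewrite (le_trans (grid_ge0 _ _) s1)/=.
    rewrite (lt_le_trans s2)// /grid ler_pdivrMr// mulrC ler_wpM2l// ler_nat.
    exact: ltn_ord.
  rewrite lebesgue_measure_itv/= lte_fin.
  have -> : V / N%:R = grid N k.+1 - grid N k by rewrite /grid -natr1; field; rewrite gt_eqF.
  case: ltP => h1; first by rewrite -EFinB -EFinM mulrC.
  have h2 : grid N k <= grid N k.+1 by rewrite /grid ler_wpM2r ?invr_ge0// ler_wpM2r// ler_nat.
  have -> : grid N k.+1 = grid N k by apply/eqP; rewrite eq_le h1 h2.
  by rewrite subrr mul0r mule0.
by rewrite (eq_bigr _ (fun k _ => Ik k)) sumEFin.
Qed.

End step_functions.

Section process_integral.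
Context {R : realType} d (T : measurableType d) (P : probability T R).
Variables (X : R -> T -> R) (V M : R).
Notation mu := (@lebesgue_measure R).
Hypotheses (mX : measurable_fun ([set s : R | 0 <= s] `*` [set: T]) (fun p : R * T => X p.1 p.2))
  (XM : forall s, 0 <= s -> (\int[P]_w `|X s w|%:E <= M%:E)%E)
  (XX : forall e, 0 < e -> exists2 eta, 0 < eta & forall s r, 0 <= s -> 0 <= r ->
     `|s - r| <= eta -> (\int[P]_w `|X s w - X r w|%:E <= e%:E)%E)
  (V0 : 0 <= V).

(** The extension by 0 to negative times is jointly measurable on the whole product space, where
    Tonelli's theorem is applied. *)
Let Xe (p : R * T) : R := if 0 <= p.1 then X p.1 p.2 else 0.

Let measurable_Xe : measurable_fun setT Xe.
Proof.
have mD : measurable ([set s : R | 0 <= s] `*` [set: T]).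
  apply: measurableX => //.
  have -> : [set s : R | 0 <= s] = `[0, +oo[%classic by apply/seteqP; split => x /=; rewrite in_itv/= andbT.
  exact: measurable_itv.
have /(measurable_restrict _ mD measurableT) : measurable_fun (setT `&` ([set s : R | 0 <= s] `*` [set: T])) (fun p : R * T => X p.1 p.2).
  by rewrite setTI.
congr measurable_fun; apply/funext => p; rewrite patchE /Xe.
case: (boolP (0 <= p.1)) => p0; first by rewrite mem_set.
by rewrite memNset// => -[/= h _]; rewrite h in p0.
Qed.

Let measurable_Xs s : measurable_fun setT (fun w => Xe (s, w)).
Proof. by apply: (measurableT_comp measurable_Xe); exact: pair1_measurable. Qed.

Let measurable_Xw w : measurable_fun setT (fun s => Xe (s, w)).
Proof. by apply: (measurableT_comp measurable_Xe); exact: pair2_measurable. Qed.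

Let XeE s w : 0 <= s -> Xe (s, w) = X s w.
Proof. by rewrite /Xe/= => ->. Qed.

Let ind_measurable : measurable_fun setT (fun p : R * T => \1_`[0, V[ p.1 : R).
Proof.
have mi : measurable_fun setT (\1_`[0, V[ : R -> R) by exact: measurable_indic.
exact: (measurableT_comp mi).
Qed.

Local Open Scope ereal_scope.

Let absX (p : R * T) : \bar R := (`|Xe p| * \1_`[0%R, V[ p.1)%:E.

Let m_absX : measurable_fun setT absX.
Proof. by apply/measurable_EFinP; apply: measurable_funM => //; exact: measurableT_comp. Qed.

Let absX_ge0 p : 0 <= absX p.
Proof. by rewrite lee_fin mulr_ge0. Qed.

(** The expectation of int_0^V |X_s| ds is at most V * M, so almost every path is integrable. *)
Let ae_integrable : {ae P, forall w, mu.-integrable `[0%R, V[ (EFin \o (X ^~ w))}.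
Proof.
pose I w := \int[mu]_s absX (s, w).
have mI : measurable_fun setT I.
  exact: (@measurable_fun_fubini_tonelli_G _ _ _ _ _ mu _ m_absX absX_ge0).
have IM : \int[P]_w I w < +oo.
  rewrite /I -(@fubini_tonelli _ _ _ _ _ mu P absX)//.
  apply: (@le_lt_trans _ _ (\int[mu]_(s in `[0%R, V[) M%:E)).
    rewrite [leRHS]integral_mkcond; apply: ge0_le_integral => //.
    - by move=> s _; apply: integral_ge0.
    - exact: (@measurable_fun_fubini_tonelli_F _ _ _ _ _ P _ m_absX absX_ge0).
    - apply/(measurable_restrict _ _ _) => //.
    - move=> s _; rewrite patchE /absX/= indicE; case: (boolP (s \in _)) => [|_].
        rewrite inE/= in_itv/= => /andP[s0 _].
        under eq_integral do rewrite mulr1 XeE//.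
        exact: XM.
      by under eq_integral do rewrite mulr0; rewrite integral0.
  by rewrite integral_cst//= lebesgue_measure_itv/=; case: ifP; rewrite ?mule0// -EFinB -EFinM ltry.
have iI : P.-integrable setT I.
  apply/integrableP; split => //.
  by under eq_integral => w _ do rewrite gee0_abs ?integral_ge0//.
apply: filterS (integrable_ae measurableT iI) => w /(_ Logic.I) wfin.
have E : {in `[0%R, V[%classic, (fun s => Xe (s, w)) =1 X ^~ w}.
  by move=> s; rewrite inE/= in_itv/= => /andP[s0 _]; exact: XeE.
suff : mu.-integrable `[0%R, V[ (EFin \o (fun s => Xe (s, w))).
  by apply: eq_integrable => // s /E /= ->.
apply/integrableP; split.
  by apply: measurable_funTS; apply/measurable_EFinP; exact: measurable_Xw.
rewrite (_ : \int[mu]_(s in `[0%R, V[) _ = I w).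
  by rewrite -ge0_fin_numE ?integral_ge0.
by rewrite /I /absX -integral_mul_indic.
Qed.

Lemma measurable_process_section s : (0 <= s)%R -> measurable_fun setT (X s).
Proof. by move=> s0; have := measurable_Xs s; under eq_fun do rewrite XeE//. Qed.

(** The positive and negative parts are integrated separately, since measurability of partial
    integrals comes from Tonelli's theorem; no integrability of the paths enters. *)
Lemma measurable_process_integral :
  measurable_fun setT (fun w => (\int[mu]_(s in `[0%R, V]) X s w)%R).
Proof.
apply: (@measurableT_comp _ _ _ _ _ _ (fine : \bar R -> R)); first exact: fine_measurable.
have -> : (fun w => \int[mu]_(s in `[0%R, V]) (X s w)%:E) =
  (fun w => \int[mu]_s ((EFin \o Xe)^\+ (s, w) * (\1_`[0%R, V] s)%:E) -
            \int[mu]_s ((EFin \o Xe)^\- (s, w) * (\1_`[0%R, V] s)%:E)).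
  apply/funext => w; rewrite integralE; congr (_ - _).
    rewrite integral_mkcond; apply: eq_integral => s _; rewrite patchE indicE.
    case: (boolP (s \in _)) => [|_]; last by rewrite mule0.
    by rewrite inE/= in_itv/= mule1 => /andP[s0 _]; rewrite !funeposE/= XeE.
  rewrite integral_mkcond; apply: eq_integral => s _; rewrite patchE indicE.
  case: (boolP (s \in _)) => [|_]; last by rewrite mule0.
  by rewrite inE/= in_itv/= mule1 => /andP[s0 _]; rewrite !funenegE/= XeE.
have mi : measurable_fun setT (fun p : R * T => (\1_`[0%R, V] p.1)%:E : \bar R).
  apply/measurable_EFinP.
  have m1 : measurable_fun setT (\1_`[0%R, V] : R -> R) by exact: measurable_indic.
  exact: (measurableT_comp m1).
have mXe : measurable_fun setT (EFin \o Xe) by exact/measurable_EFinP.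
apply: emeasurable_funB.
  apply: (@measurable_fun_fubini_tonelli_G _ _ _ _ _ mu (fun p => (EFin \o Xe)^\+ p * (\1_`[0%R, V] p.1)%:E)).
    by apply: emeasurable_funM => //; exact: measurable_funepos.
  by move=> p; rewrite mule_ge0// lee_fin.
apply: (@measurable_fun_fubini_tonelli_G _ _ _ _ _ mu (fun p => (EFin \o Xe)^\- p * (\1_`[0%R, V] p.1)%:E)).
  by apply: emeasurable_funM => //; exact: measurable_funeneg.
by move=> p; rewrite mule_ge0// lee_fin.
Qed.

(** The Riemann sum is the integral of the step function through left ends, so the mean error is at
    most the integral over s of E |X_s - X_r|, with r the left end of the cell of s. Uniform
    continuity in L^1 bounds it. *)
Lemma riemann_sum_L1 e : (0 < e)%R -> \forall N \near \oo,
  \int[P]_w `|\int[mu]_(s in `[0%R, V]) X s w - V / N%:R * \sum_(k < N) X (grid V N k) w|%R%:E <= e%:E.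
Proof.
(* The added 1 keeps the denominator positive when V = 0. *)
move=> e0; pose e' := (e / (V + 1))%R.
have V10 : (0 < V + 1)%R by rewrite ltr_wpDl.
have e'0 : (0 < e')%R by rewrite divr_gt0.
have [eta eta0 Heta] := XX e'0.
near=> N.
have N0 : (0 < N)%N by near: N; exact: nbhs_infty_gt.
have Neta : (V / N%:R <= eta)%R.
  rewrite ler_pdivrMr ?ltr0n// mulrC -ler_pdivrMr//.
  by near: N; exact: nbhs_infty_ger.
pose D (p : R * T) : \bar R :=
  (`|Xe p - grid_step V N (fun s => Xe (s, p.2)) p.1| * \1_`[0%R, V[ p.1)%:E.
have mD : measurable_fun setT D.
  apply/measurable_EFinP; apply: measurable_funM => //.
  apply: (measurableT_comp (@normr_measurable R setT)).
  apply: measurable_funB => //; apply: measurable_sum => k; apply: measurable_funM.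
    by apply: (measurableT_comp (measurable_Xs _)).
  have mi : measurable_fun setT (\1_`[grid V N k, grid V N k.+1[ : R -> R) by exact: measurable_indic.
  exact: (measurableT_comp mi).
have D0 p : 0 <= D p by rewrite lee_fin mulr_ge0.
have mRS : measurable_fun setT (fun w => (V / N%:R * \sum_(k < N) X (grid V N k) w)%R).
  apply: measurable_funM => //; apply: measurable_sum => k.
  by under eq_fun do rewrite -XeE ?grid_ge0//; exact: measurable_Xs.
apply: (@le_trans _ _ (\int[P]_w \int[mu]_s D (s, w))).
  apply: ae_ge0_le_integral => //.
  - apply/measurable_EFinP; apply: (measurableT_comp (@normr_measurable R setT)).
    by apply: measurable_funB => //; exact: measurable_process_integral.
  - by move=> w _; apply: integral_ge0.
  - exact: (@measurable_fun_fubini_tonelli_G _ _ _ _ _ mu _ mD D0).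
  apply: filterS ae_integrable => w iX _.
  have [iS <-] := integral_grid_step V0 (X ^~ w) N0.
  have -> : (\int[mu]_(s in `[0%R, V]) X s w = \int[mu]_(s in `[0%R, V[) X s w)%R.
    by rewrite Rintegral_itv_bndo_bndc.
  rewrite -RintegralB//.
  apply: (@le_trans _ _ ((\int[mu]_(s in `[0%R, V[) `|X s w - grid_step V N (X ^~ w) s|)%R%:E)).
    by rewrite lee_fin; apply: le_normr_Rintegral => //; exact: (integrableB _ iX iS).
  have iXS : mu.-integrable `[0%R, V[ (EFin \o (fun s => X s w - grid_step V N (X ^~ w) s)%R).
    exact: (integrableB _ iX iS).
  have {}iXS := integrable_norm iXS.
  rewrite /Rintegral fineK; last by apply: (integrable_fin_num _ iXS).
  rewrite integral_mul_indic le_eqVlt; apply/orP; left; apply/eqP.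
  apply: eq_integral => s _; rewrite /D/= indicE.
  case: (boolP (s \in _)) => [|_]; last by rewrite !mulr0.
  rewrite inE/= in_itv/= => sV; rewrite XeE; last by case/andP: sV.
  have [r [hr /andP[r0 _] _]] := grid_stepP V0 N0 sV.
  by rewrite !hr XeE.
rewrite -(@fubini_tonelli _ _ _ _ _ mu P D)//.
apply: (@le_trans _ _ (\int[mu]_(s in `[0%R, V[) e'%:E)).
  rewrite [leRHS]integral_mkcond; apply: ge0_le_integral => //.
  - by move=> s _; apply: integral_ge0.
  - exact: (@measurable_fun_fubini_tonelli_F _ _ _ _ _ P _ mD D0).
  - apply/(measurable_restrict _ _ _) => //.
  - move=> s _; rewrite patchE /D/= indicE; case: (boolP (s \in _)) => [|_].
      rewrite inE/= in_itv/= => sV.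
      have [r [hr /andP[r0 rs] sr]] := grid_stepP V0 N0 sV.
      under eq_integral do rewrite mulr1 hr !XeE ?(le_trans r0 rs)//.
      apply: Heta => //; first exact: le_trans rs.
      by rewrite ger0_norm ?subr_ge0// (le_trans _ Neta)//; move: sr; lra.
    by under eq_integral do rewrite mulr0; rewrite integral0.
rewrite integral_cst//= lebesgue_measure_itv/= lte_fin; case: ifP => _; last first.
  by rewrite mule0 lee_fin ltW.
rewrite sube0 -EFinM lee_fin /e' mulrAC ler_pdivrMr//.
by rewrite ler_wpM2l ?(ltW e0)// lerDl.
Unshelve. all: by end_near. Qed.

End process_integral.

Section trawl_process_moments.
Context {R : realType} d (Omega : measurableType d) (P : probability Omega R)
  (nu : {measure set R -> \bar R}) (Lambda : set (R * R) -> {RV P >-> R})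
  (gamma : R) (g : R -> R) (X : R -> Omega -> R).
Hypotheses (hnu : symmetric_levy_measure nu) (hLambda : homogeneous_levy_basis nu Lambda)
  (gamma0 : 0 < gamma) (hg : trawl_function gamma g) (hX : trawl_process Lambda g X).
Notation psi := (levy_exponent nu).
Notation mu := (@lebesgue_measure R).
Notation leb2 := (mu \x mu)%E.
Hypothesis psi_fin : (\int[mu]_(u in `]0%R, +oo[) (psi u * u `^ (- 2 - gamma))%:E < +oo)%E.

Let mX : measurable_fun ([set s : R | 0 <= s] `*` [set: Omega]) (fun p : R * Omega => X p.1 p.2).
Proof. exact: trawl_process_measurable hX. Qed.

Lemma measurable_trawl_process s : 0 <= s -> measurable_fun setT (X s).
Proof. exact: (measurable_process_section mX). Qed.

(** The index type is arbitrary because the formula is applied to a single time, to a pair of times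
    indexed by booleans, and to pairs of a time and a grid index. *)
Lemma charfun_trawl_sum (J : finType) (c s : J -> R) : (forall j, 0 <= s j) ->
  \int[P]_w cos (\sum_j c j * X (s j) w) =
    expR (- fine (\int[leb2]_p (psi (\sum_j c j * \1_(trawl_set g (s j)) p))%:E)) /\
  \int[P]_w sin (\sum_j c j * X (s j) w) = 0.
Proof.
move=> s0.
have [hc hs] := charfun_levy_basis hLambda c (fun j => finite_area_trawl_set hg (s j)).
have m1 : measurable_fun setT (fun w => \sum_j c j * X (s j) w).
  by apply: measurable_sum => j; apply: measurable_funM => //; exact: measurable_trawl_process.
have m2 : measurable_fun setT (fun w => \sum_j c j * Lambda (trawl_set g (s j)) w).
  by apply: measurable_sum => j; exact: measurable_funM.
have E : {ae P, forall w, \sum_j c j * X (s j) w = \sum_j c j * Lambda (trawl_set g (s j)) w}.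
  have : {ae P, forall w, forall j, X (s j) w = Lambda (trawl_set g (s j)) w}.
    by apply: filter_forall => j; exact: (trawl_process_version hX).
  by apply: filterS => w h; apply: eq_bigr => j _; rewrite h.
split.
  rewrite -hc; apply: (ae_eq_Rintegral (measurableT_comp (@measurable_cos R) m1) (measurableT_comp (@measurable_cos R) m2)).
  by apply: filterS E => w /= ->.
rewrite -[RHS]hs; apply: (ae_eq_Rintegral (measurableT_comp (@measurable_sin R) m1) (measurableT_comp (@measurable_sin R) m2)).
by apply: filterS E => w /= ->.
Qed.

Let onem_expR_le (x : R) : 1 - expR (- x) <= x.
Proof. by have := expR_ge1Dx (- x); lra. Qed.

Let onem_charfun_single s u : 0 <= s ->
  1 - \int[P]_w cos (u * X s w) <= fine (leb2 (trawl_set g 0)) * psi u.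
Proof.
move=> s0; have [+ _] := charfun_trawl_sum (fun _ : 'I_1 => u) (fun=> s0).
under eq_Rintegral do rewrite big_ord1.
move=> ->; rewrite (le_trans (onem_expR_le _))//.
have [mA fA] := finite_area_trawl_set hg 0.
have [mAs fAs] := finite_area_trawl_set hg s.
have E : (\int[leb2]_p (psi (\sum_(j < 1) u * \1_(trawl_set g s) p))%:E =
    (psi u)%:E * leb2 (trawl_set g 0))%E.
  rewrite -(area_trawl_set hg s 0) -[X in leb2 X]setIT -integral_indic//.
  rewrite -ge0_integralZl//; last 2 first.
  - by apply/measurable_EFinP; exact: measurable_indic.
  - by rewrite lee_fin levy_exponent_ge0.
  apply: eq_integral => p _; rewrite big_ord1 indicE.
  by case: (p \in _); rewrite ?mulr1 ?mule1// mulr0 mule0 levy_exponent0.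
by rewrite E fineM//= ?ge0_fin_numE// mulrC.
Qed.

(** On the intersection of the two trawl sets the coefficients u and - u cancel and psi 0 = 0. On
    the symmetric difference psi takes the value psi u by evenness; then 1 - exp (- x) <= x. *)
Let onem_charfun_diff s r u : 0 <= s -> 0 <= r ->
  1 - \int[P]_w cos (u * (X s w - X r w)) <= 2 * g 0 * `|s - r| * psi u.
Proof.
move=> s0 r0.
have sb (b : bool) : 0 <= (if b then s else r) by case: b.
have [+ _] := charfun_trawl_sum (fun b : bool => if b then u else - u) sb.
under eq_Rintegral do rewrite big_bool/= mulNr -mulrBr.
move=> ->; rewrite (le_trans (onem_expR_le _))//.
have [mAr fAr] := finite_area_trawl_set hg r.
have [mAs fAs] := finite_area_trawl_set hg s.
have md (B C : set (R * R)) : measurable B -> measurable C -> measurable (B `\` C) by exact: measurableD.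
have E : (\int[leb2]_p (psi (\sum_b (if b then u else - u) * \1_(trawl_set g (if b then s else r)) p))%:E =
    (psi u)%:E * (leb2 (trawl_set g s `\` trawl_set g r) + leb2 (trawl_set g r `\` trawl_set g s)))%E.
  have id (D : set (R * R)) : measurable D -> (leb2 D = \int[leb2]_p (\1_D p)%:E)%E.
    by move=> mD; rewrite integral_indic// setIT.
  rewrite !id; [|exact: md..].
  rewrite -ge0_integralD//; last 2 first.
  - by apply/measurable_EFinP; apply: measurable_indic; exact: md.
  - by apply/measurable_EFinP; apply: measurable_indic; exact: md.
  rewrite -ge0_integralZl//; last 3 first.
  - by apply: emeasurable_funD; apply/measurable_EFinP; apply: measurable_indic; exact: md.
  - by move=> p _; rewrite adde_ge0.
  - by rewrite lee_fin levy_exponent_ge0.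
  apply: eq_integral => p _; rewrite big_bool/= !indicE !in_setD.
  have psiN : psi (- u) = psi u by rewrite -levy_exponent_norm normrN levy_exponent_norm.
  case: (p \in trawl_set g s); case: (p \in trawl_set g r) => /=;
    rewrite ?mulr1 ?mulr0 ?addr0 ?add0r ?subrr ?adde0 ?add0e ?mule1 ?mule0 ?levy_exponent0 ?psiN//.
have le := area_trawl_symdiff hg r s.
have fin : (leb2 (trawl_set g s `\` trawl_set g r) + leb2 (trawl_set g r `\` trawl_set g s))%E \is a fin_num.
  rewrite ge0_fin_numE; last by apply: adde_ge0; exact: measure_ge0.
  by apply: (le_lt_trans le); exact: ltry.
rewrite E -lee_fin fineK; last by rewrite fin_numM.
by rewrite muleC EFinM lee_wpmul2r// lee_fin levy_exponent_ge0.
Qed.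

Let c0 : R := (1 - cos 1) / 4.
Let c0_gt0 : 0 < c0. Proof. by rewrite divr_gt0// onemcos1_gt0. Qed.

Let Phi : R := fine (\int[mu]_(u in `]0%R, +oo[) (psi u * u `^ (- 2 - gamma))%:E)%E.
Let Phi_ge0 : 0 <= Phi.
Proof.
apply/fine_ge0/integral_ge0 => u _.
by rewrite lee_fin mulr_ge0 ?levy_exponent_ge0 ?powR_ge0.
Qed.

Let moment_le (Z : Omega -> R) (a L e : R) : measurable_fun setT Z -> 0 <= a -> 0 < L ->
  (forall u, 1 - \int[P]_w cos (u * Z w) <= a * psi u) ->
  a * L `^ gamma * Phi + 2 / L <= c0 * e -> (\int[P]_w `|Z w|%:E <= e%:E)%E.
Proof.
move=> mZ a0 L0 h he.
have := @moment_bound _ _ _ P Z psi gamma mZ (measurable_levy_exponent hnu)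
  (levy_exponent_ge0 nu) gamma0 a L a0 L0 h.
have -> : (\int[mu]_(u in `]0%R, +oo[) (psi u * u `^ (- 2 - gamma))%:E = Phi%:E)%E.
  rewrite fineK// ge0_fin_numE//; apply: integral_ge0 => u _.
  by rewrite lee_fin mulr_ge0 ?levy_exponent_ge0 ?powR_ge0.
rewrite -EFinM -EFinD => h1.
rewrite -(@lee_pmul2l _ c0%:E) ?lte_fin//.
by apply: (le_trans h1); rewrite -EFinM lee_fin.
Qed.

Lemma trawl_process_bounded_L1 : exists M, forall s, 0 <= s -> (\int[P]_w `|X s w|%:E <= M%:E)%E.
Proof.
pose a := fine (leb2 (trawl_set g 0)).
exists ((a * 1 `^ gamma * Phi + 2 / 1) / c0) => s s0.
apply: (@moment_le _ a 1) => //; first exact: measurable_trawl_process.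
- exact/fine_ge0/measure_ge0.
- by move=> u; exact: onem_charfun_single.
- by rewrite [leRHS]mulrC divfK// gt_eqF.
Qed.

Lemma trawl_process_continuous_L1 e : 0 < e -> exists2 eta, 0 < eta &
  forall s r, 0 <= s -> 0 <= r -> `|s - r| <= eta ->
    (\int[P]_w `|X s w - X r w|%:E <= e%:E)%E.
Proof.
(* This L makes the high-frequency term 2 / L equal to c0 * e / 2; the distance |s - r| is then
   taken small enough for the low-frequency term to fit in the other half. *)
move=> e0; pose L := 4 / (c0 * e).
have L0 : 0 < L by rewrite divr_gt0// mulr_gt0.
have Lg0 : 0 < L `^ gamma by exact: powR_gt0.
have g0 : 0 <= g 0 by exact: (trawl_ge0 hg).
pose k := (2 * (g 0 + 1)) * L `^ gamma * (Phi + 1).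
have k0 : 0 < k by rewrite !mulr_gt0// ?ltr_wpDl.
exists (c0 * e / 2 / k) => [|s r s0 r0 sr]; first by rewrite !divr_gt0// mulr_gt0.
apply: (@moment_le _ (2 * g 0 * `|s - r|) L) => //.
- by apply: measurable_funB; exact: measurable_trawl_process.
- by rewrite !mulr_ge0.
- by move=> u; exact: onem_charfun_diff.
have h1 : 2 * g 0 * `|s - r| * L `^ gamma * Phi <= `|s - r| * k.
  rewrite (_ : _ * Phi = `|s - r| * (2 * g 0 * L `^ gamma * Phi)); last by ring.
  rewrite ler_wpM2l// /k; apply: ler_pM; rewrite ?mulr_ge0 ?(ltW Lg0)//; last by rewrite lerDl.
  by rewrite ler_pM2r// ler_pM2l// lerDl.
have h2 : `|s - r| * k <= c0 * e / 2 by rewrite -ler_pdivlMr.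
have h3 : 2 / L = c0 * e / 2 by rewrite /L; field; rewrite !gt_eqF.
by rewrite h3 [leRHS](splitr (c0 * e)) lerD2r (le_trans h1).
Qed.

End trawl_process_moments.

(** * Time spent in the trawl sets by a point of the plane *)

Section occupation_time.
Context {R : realType} (gamma : R) (g : R -> R) (hg : trawl_function gamma g).
Notation mu := (@lebesgue_measure R).

Definition occupation (V : R) (p : R * R) : R :=
  \int[mu]_(s in `[0, V]) \1_(trawl_set g s) p.

Let ind (p : R * R) (s : R) : R := \1_(trawl_set g s) p.

Let ind_le1 p s : `|ind p s| <= 1.
Proof. by rewrite /ind indicE; case: (_ \in _); rewrite ?normr1 ?normr0. Qed.

(** The times s at which A s contains [p] form an interval: the point enters at time p.1 and leaves
    once g (s - p.1) has dropped below its height. *)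
Let measurable_ind p : measurable_fun setT (ind p).
Proof.
have -> : ind p = \1_([set s | trawl_set g s p]) by apply/funext => s; rewrite /ind !indicE; congr (nat_of_bool _)%:R; rewrite !asboolE.
apply: measurable_indic; apply: is_interval_measurable => s1 s2 /= [h1 h2] [h3 /andP[h4 h5]] z /andP[z1 z2].
have xz := le_trans h1 z1; split => //; rewrite h4 (le_trans h5)//.
by apply: (trawl_le hg); rewrite ?subr_ge0// lerD2r.
Qed.

(** The step functions sample the indicator at points to the left of s, so constancy on a left
    neighbourhood is enough. It can fail only at the entry time p.1; at a time after the exit it
    follows from continuity of [g]. *)
Let ind_left_constant p s : s != p.1 -> exists2 e, 0 < e &
  forall r, s - e < r -> r <= s -> ind p r = ind p s.
Proof.
move=> sp; have eqind r : (trawl_set g r p <-> trawl_set g s p) -> ind p r = ind p s.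
  by move=> h; rewrite /ind !indicE; congr (nat_of_bool _)%:R; apply/idP/idP; rewrite !inE => /h.
case: (ltgtP s p.1) sp => // [sp _|ps _].
  exists 1 => // r _ rs; apply: eqind; split => -[h _] //.
    by have := le_lt_trans h (le_lt_trans rs sp); rewrite ltxx.
  by have := le_lt_trans h sp; rewrite ltxx.
have [As|nAs] := pselect (trawl_set g s p).
  exists (s - p.1) => [|r]; first by rewrite subr_gt0.
  rewrite subKr => pr rs; apply: eqind; split => // _; split; first exact: ltW.
  have [_ /andP[-> h]] := As; rewrite (le_trans h)//.
  by apply: (trawl_le hg); rewrite ?subr_ge0 ?(ltW pr)// lerD2r.
have [y0|y0] := leP 0 p.2; last first.
  exists 1 => // r _ _; apply: eqind; split => [[_ /andP[h _]]|//].
  by move: h; rewrite leNgt y0.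
have gy : g (s - p.1) < p.2.
  by rewrite ltNge; apply/negP => h; apply: nAs; split; [exact: ltW|rewrite y0].
have sp0 : 0 < s - p.1 by rewrite subr_gt0.
have cg : {for s - p.1, continuous g}.
  by apply: differentiable_continuous; apply/derivable1_diffP; exact: (trawl_derivable hg).
have /cvgrPdist_lt /(_ (p.2 - g (s - p.1))) := cg; rewrite subr_gt0 => /(_ gy).
move=> /nbhs_ballP[e /= e0 he]; exists e => // r sr rs.
apply: eqind; split => // -[pr /andP[_ yr]].
have := he (r - p.1); rewrite /ball/= => h.
have : `|s - p.1 - (r - p.1)| < e.
  by rewrite ltr_norml; move: rs sr e0; lra.
by move=> /h; rewrite ltr_norml; lra.
Qed.

Let integrable_ind V p : mu.-integrable `[0, V] (EFin \o ind p).
Proof.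
apply: measurable_bounded_integrable => //.
- by rewrite /= lebesgue_measure_itv/=; case: ifP => _; rewrite ?ltry// -EFinB ltry.
- by apply: measurable_funTS; exact: measurable_ind.
- exists 1; split; first exact: num_real.
  by move=> x x1 s _ /=; rewrite (le_trans (ind_le1 _ _))// ltW.
Qed.

Lemma cvg_riemann_occupation V p : 0 <= V ->
  V / N%:R * \sum_(k < N) \1_(trawl_set g (grid V N k)) p @[N --> \oo] --> occupation V p.
Proof.
move=> V0.
(* The shift discards the degenerate mesh N = 0. *)
rewrite -(cvg_shiftS (fun N => V / N%:R * \sum_(k < N) \1_(trawl_set g (grid V N k)) p)).
have E N : V / N.+1%:R * \sum_(k < N.+1) \1_(trawl_set g (grid V N.+1 k)) p =
    \int[mu]_(s in `[0, V[) grid_step V N.+1 (ind p) s.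
  by have [_ ->] := integral_grid_step V0 (ind p) (ltn0Sn N).
under eq_fun do rewrite E.
have -> : occupation V p = \int[mu]_(s in `[0, V[) ind p s.
  rewrite /occupation Rintegral_itv_bndo_bndc//.
  by apply: (integrableS _ _ _ (integrable_ind V p)) => // s; rewrite /= !in_itv/= => /andP[-> /ltW].
apply: fine_cvg; rewrite fineK; last first.
  apply: integrable_fin_num => //; apply: (integrableS _ _ _ (integrable_ind V p)) => // s.
  by rewrite /= !in_itv/= => /andP[-> /ltW].
have [|||||_ _ h] := @dominated_convergence _ _ R mu `[0, V[ (measurable_itv _)
  (fun N s => (grid_step V N.+1 (ind p) s)%:E) (EFin \o ind p) (cst 1%E).
- by move=> N; apply/measurable_EFinP; apply: measurable_funTS; exact: measurable_grid_step.
- by apply/measurable_EFinP; apply: measurable_funTS; exact: measurable_ind.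
- have : mu.-negligible [set p.1] by apply/negligibleP => //; exact: lebesgue_measure_set1.
  apply: negligibleS => s /= /not_implyP[]; rewrite in_itv/= => sV; apply: contra_notP => /eqP sp.
  have [e e0 he] := ind_left_constant sp.
  apply: cvg_near_cst; near=> N; congr EFin.
  have [r [-> /andP[_ rs] sr]] := grid_stepP V0 (ltn0Sn N) sV.
  apply: he => //; apply: le_lt_trans sr; rewrite lerD2l lerN2.
  rewrite ler_pdivrMr// mulrC -ler_pdivrMr//.
  rewrite (@le_trans _ _ N%:R) ?ler_nat//.
  by near: N; exact: nbhs_infty_ger.
- apply/integrableP; split => //=.
  by rewrite integral_cst//= lebesgue_measure_itv/=; case: ifP => _; rewrite ?mule0 ?ltry// normr1 mul1e -EFinB ltry.
- apply: aeW => s N; rewrite /= in_itv/= => sV; rewrite lee_fin.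
  by apply: grid_step_bound.
- exact: h.
Unshelve. all: by end_near. Qed.

Lemma measurable_riemann_occupation V N :
  measurable_fun setT (fun p => V / N%:R * \sum_(k < N) \1_(trawl_set g (grid V N k)) p).
Proof.
apply: measurable_funM => //; apply: measurable_sum => k.
by apply: measurable_indic; exact: (measurable_trawl_set hg).
Qed.

Lemma measurable_occupation V : 0 <= V -> measurable_fun setT (occupation V).
Proof.
move=> V0; apply: (measurable_fun_cvg (measurable_riemann_occupation V)) => p _.
exact: cvg_riemann_occupation.
Qed.

Lemma riemann_occupation_le V N p : 0 <= V ->
  `|V / N%:R * \sum_(k < N) \1_(trawl_set g (grid V N k)) p| <= V.
Proof.
move=> V0; case: N => [|N]; first by rewrite invr0 mulr0 mul0r normr0.
rewrite normrM ger0_norm ?divr_ge0// mulrAC ler_pdivrMr// ler_wpM2l//.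
rewrite (le_trans (ler_norm_sum _ _ _))//.
have -> : N.+1%:R = \sum_(k < N.+1) 1 :> R by rewrite sumr_const card_ord.
by apply: ler_sum => k _; exact: ind_le1.
Qed.

(** A point with x <= 0 that some later A s contains is already in A 0, because [g] decreases; the
    other points lie in a bounded rectangle. The indicator of this finite-area set is the dominating
    function for the exponents. *)
Definition trawl_hull (V : R) : set (R * R) :=
  trawl_set g 0 `|` (`[0, V]%classic `*` `[0, g 0]%classic).

Lemma trawl_set_sub_hull V s : 0 <= s <= V -> trawl_set g s `<=` trawl_hull V.
Proof.
move=> /andP[s0 sV] [x y] [/= xs /andP[y0 ys]].
have [x0|x0] := leP x 0; [left|right]; split => /=.
- exact: x0.
- rewrite y0 (le_trans ys)//; apply: (trawl_le hg); rewrite ?subr_ge0//.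
  by rewrite lerD2r.
- by rewrite in_itv/= (ltW x0) (le_trans xs).
- rewrite in_itv/= y0 (le_trans ys)//; apply: (trawl_le hg) => //.
  by rewrite subr_ge0.
Qed.

Lemma finite_area_hull V : finite_area (trawl_hull V).
Proof.
have [mA fA] := finite_area_trawl_set hg 0.
have mX : measurable (`[0, V]%classic `*` `[0, g 0]%classic : set (R * R)) by exact: measurableX.
split; first exact: measurableU.
rewrite /area; apply: (le_lt_trans (@measureU2 _ _ _ (mu \x mu)%E _ _ mA mX)).
apply: lte_add_pinfty; first exact: fA.
pose m1 := mu `[0, V]%classic; pose m2 := mu `[0, g 0]%classic.
rewrite [X in (X < _)%E](_ : _ = (m1 * m2)%E); last exact: product_measure1E.
by rewrite /m1 /m2 !lebesgue_measure_itv/=; case: ifP => _; case: ifP => _; rewrite ?mule0 ?mul0e ?ltry// -!EFinB -EFinM ltry.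
Qed.

End occupation_time.

Section L1_convergence.
Context {R : realType} d (T : measurableType d) (P : probability T R).

Lemma cvg_Rintegral_lip (U : nat -> T -> R) (W : T -> R) (f : R -> R) :
  (forall N, measurable_fun setT (U N)) -> measurable_fun setT W ->
  measurable_fun setT f -> (forall x, `|f x| <= 1) ->
  (forall x y, `|f x - f y| <= `|x - y|) ->
  (forall e, 0 < e -> \forall N \near \oo, (\int[P]_w `|W w - U N w|%:E <= e%:E)%E) ->
  \int[P]_w f (U N w) @[N --> \oo] --> \int[P]_w f (W w).
Proof.
move=> mU mW mf f1 flip h; apply/cvgrPdist_le => e e0.
near=> N.
have mfU := measurableT_comp mf (mU N); have mfW := measurableT_comp mf mW.
have iU := @bounded_integrable _ _ _ P _ 1 mfU (fun w => f1 _).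
have iW := @bounded_integrable _ _ _ P _ 1 mfW (fun w => f1 _).
have iWU : P.-integrable setT (EFin \o (fun w => f (W w) - f (U N w))) by exact: (integrableB _ iW iU).
rewrite -RintegralB// (le_trans (le_normr_Rintegral _ iWU))//.
have iN := integrable_norm iWU.
rewrite -lee_fin /Rintegral fineK; last exact: integrable_fin_num.
apply: (@le_trans _ _ (\int[P]_w `|W w - U N w|%:E)%E); last by near: N; exact: h.
apply: ge0_le_integral => //.
- by case/integrableP : iN.
- apply/measurable_EFinP; apply: (measurableT_comp (@normr_measurable R setT)).
  exact: measurable_funB.
- by move=> w _; rewrite lee_fin.
Unshelve. all: by end_near. Qed.

End L1_convergence.

(** * Characteristic functions of time integrals of the trawl process *)

Section trawl_integrals.
Context {R : realType} d (Omega : measurableType d) (P : probability Omega R)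
  (nu : {measure set R -> \bar R}) (Lambda : set (R * R) -> {RV P >-> R})
  (gamma : R) (g : R -> R) (X : R -> Omega -> R).
Hypotheses (hnu : symmetric_levy_measure nu) (hLambda : homogeneous_levy_basis nu Lambda)
  (gamma0 : 0 < gamma) (hg : trawl_function gamma g) (hX : trawl_process Lambda g X).
Notation psi := (levy_exponent nu).
Notation mu := (@lebesgue_measure R).
Notation leb2 := (mu \x mu)%E.
Hypothesis psi_fin : (\int[mu]_(u in `]0%R, +oo[) (psi u * u `^ (- 2 - gamma))%:E < +oo)%E.
Variables (n : nat) (V th : 'I_n -> R).
Hypothesis V0 : forall j, 0 <= V j.

Let mX : measurable_fun ([set s : R | 0 <= s] `*` [set: Omega]) (fun p : R * Omega => X p.1 p.2).
Proof. exact: trawl_process_measurable hX. Qed.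

Lemma measurable_trawl_integral v : 0 <= v ->
  measurable_fun setT (fun w => \int[mu]_(s in `[0, v]) X s w).
Proof. by move=> v0; exact: (measurable_process_integral _ mX). Qed.

Let RS N w := \sum_j th j * (V j / N%:R * \sum_(k < N) X (grid (V j) N k) w).
Let occN N p := \sum_j th j * (V j / N%:R * \sum_(k < N) \1_(trawl_set g (grid (V j) N k)) p).
Let occ p := \sum_j th j * occupation g (V j) p.

Let charfun_RS N : (0 < N)%N ->
  \int[P]_w cos (RS N w) = expR (- fine (\int[leb2]_p (psi (occN N p))%:E)) /\
  \int[P]_w sin (RS N w) = 0.
Proof.
move=> N0.
have s0 (jk : 'I_n * 'I_N) : 0 <= grid (V jk.1) N jk.2 by exact: grid_ge0.
have [hc hs] := charfun_trawl_sum hLambda hg hX (fun jk => th jk.1 * (V jk.1 / N%:R)) s0.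
have E (U : Type) (F : R -> U -> R) w :
    \sum_j th j * (V j / N%:R * \sum_(k < N) F (grid (V j) N k) w) =
    \sum_(jk : 'I_n * 'I_N) th jk.1 * (V jk.1 / N%:R) * F (grid (V jk.1) N jk.2) w.
  rewrite -(pair_bigA _ (fun (j : 'I_n) (k : 'I_N) => th j * (V j / N%:R) * F (grid (V j) N k) w))/=.
  by apply: eq_bigr => j _; rewrite mulrA mulr_sumr.
split.
  under eq_Rintegral do rewrite /RS (E _ X).
  rewrite hc; congr (expR (- fine _)); apply: eq_integral => p _.
  by rewrite /occN (E _ (fun s p => \1_(trawl_set g s) p)).
by under eq_Rintegral do rewrite /RS (E _ X).
Qed.

Let mocc : measurable_fun setT occ.
Proof.
apply: measurable_sum => j; apply: measurable_funM => //.
exact: (measurable_occupation hg).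
Qed.

Let moccN N : measurable_fun setT (occN N).
Proof.
apply: measurable_sum => j; apply: measurable_funM => //.
exact: (measurable_riemann_occupation hg).
Qed.

Let cvg_occN p : occN N p @[N --> \oo] --> occ p.
Proof.
apply: (@cvg_big _ _ +%R 0 xpredT) => [|j _]; first exact: add_continuous.
apply: cvgM; first exact: cvg_cst.
exact: (cvg_riemann_occupation hg).
Qed.

Let Vm := \sum_j V j.
Let V_le j : V j <= Vm.
Proof. by rewrite /Vm (bigD1 j)//= lerDl sumr_ge0. Qed.

(** The sums stay within sum_j |th j| * V j, where psi is bounded, and vanish off the hull;
    dominated convergence applies by continuity of psi. *)
Let cvg_area_integral :
  fine (\int[leb2]_p (psi (occN N p))%:E) @[N --> \oo] --> fine (\int[leb2]_p (psi (occ p))%:E).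
Proof.
have [C C0 hC] := levy_exponent_bounded hnu (\sum_j `|th j| * V j).
have [mH fH] := finite_area_hull hg Vm.
have bound N p : psi (occN N p) <= C * \1_(trawl_hull g Vm) p.
  have [Hp|nHp] := boolP (p \in trawl_hull g Vm).
    rewrite indicE Hp mulr1; apply: hC; rewrite (le_trans (ler_norm_sum _ _ _))//.
    apply: ler_sum => j _; rewrite normrM ler_wpM2l//.
    exact: riemann_occupation_le.
  rewrite indicE (negbTE nHp) mulr0 (_ : occN N p = 0) ?levy_exponent0//.
  rewrite /occN big1// => j _; rewrite big1 ?mulr0// => k _.
  rewrite indicE memNset// => /(trawl_set_sub_hull hg (V := Vm)) h.
  move/negP: nHp; apply; rewrite inE; apply: h; rewrite grid_ge0//=.
  rewrite (le_trans _ (V_le j))// /grid; case: N k => [[]//|N k].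
  by rewrite ler_pdivrMr// mulrC ler_wpM2l// ler_nat ltnW.
have iC : leb2.-integrable setT (EFin \o (fun p => C * \1_(trawl_hull g Vm) p)).
  have i0 : leb2.-integrable setT (EFin \o (\1_(trawl_hull g Vm) : R * R -> R)).
    apply/integrableP; split; first by apply/measurable_EFinP; exact: measurable_indic.
    under eq_integral do rewrite gee0_abs ?lee_fin//.
    by rewrite integral_indic// setIT.
  exact: (integrableZl _ _ i0).
have cvgpsi p : psi (occN N p) @[N --> \oo] --> psi (occ p).
  have cp : {for occ p, continuous psi} by exact: continuous_levy_exponent.
  have cN := @cvg_occN p; exact: (cvg_comp _ _ cN cp).
have [|||||iocc _ h] := @dominated_convergence _ _ R leb2 setT measurableT
  (fun N p => (psi (occN N p))%:E) (fun p => (psi (occ p))%:E)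
  (EFin \o (fun p => C * \1_(trawl_hull g Vm) p)).
- move=> N; apply/measurable_EFinP.
  exact: (measurableT_comp (measurable_levy_exponent hnu) (moccN N)).
- apply/measurable_EFinP.
  exact: (measurableT_comp (measurable_levy_exponent hnu) mocc).
- apply: aeW => p _; apply: cvg_EFin; first exact: nearW.
  exact: cvgpsi.
- exact: iC.
- by apply: aeW => p N _; rewrite lee_fin ger0_norm ?levy_exponent_ge0.
by apply: fine_cvg; rewrite fineK//; exact: integrable_fin_num.
Qed.

(** The characteristic functions of the Riemann sums have two limits: one by L^1 convergence, since
    cos and sin are 1-Lipschitz, and one by convergence of the exponents. They must coincide. *)
Lemma charfun_trawl_integrals :
  \int[P]_w cos (\sum_j th j * \int[mu]_(s in `[0, V j]) X s w) =
    expR (- fine (\int[leb2]_p (psi (\sum_j th j * occupation g (V j) p))%:E)) /\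
  \int[P]_w sin (\sum_j th j * \int[mu]_(s in `[0, V j]) X s w) = 0.
Proof.
pose W w := \sum_j th j * \int[mu]_(s in `[0, V j]) X s w.
have mW : measurable_fun setT W.
  by apply: measurable_sum => j; apply: measurable_funM => //; exact: measurable_trawl_integral.
have mpart j N : measurable_fun setT (fun w => V j / N%:R * \sum_(k < N) X (grid (V j) N k) w).
  apply: measurable_funM => //; apply: measurable_sum => k.
  by apply: (measurable_trawl_process hX); exact: grid_ge0.
have mRS N : measurable_fun setT (RS N).
  by apply: measurable_sum => j; apply: measurable_funM.
have [M XM] := trawl_process_bounded_L1 hnu hLambda gamma0 hg hX psi_fin.
have XX := trawl_process_continuous_L1 hnu hLambda gamma0 hg hX psi_fin.
have cvgL1 e : 0 < e -> \forall N \near \oo, (\int[P]_w `|W w - RS N w|%:E <= e%:E)%E.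
  move=> e0; pose A := \sum_j `|th j| + 1.
  have A0 : 0 < A by rewrite ltr_wpDl// sumr_ge0.
  have near_j : \forall N \near \oo, forall j, (\int[P]_w `|\int[mu]_(s in `[0%R, V j]) X s w -
      V j / N%:R * \sum_(k < N) X (grid (V j) N k) w|%R%:E <= (e / A)%:E)%E.
    apply: filter_forall => j.
    by apply: (riemann_sum_L1 mX XM XX (V0 j)); rewrite divr_gt0.
  apply: filterS near_j => N hN.
  have mdiff j : measurable_fun setT (fun w => (`|\int[mu]_(s in `[0%R, V j]) X s w -
      V j / N%:R * \sum_(k < N) X (grid (V j) N k) w|%R)%:E).
    apply/measurable_EFinP; apply: (measurableT_comp (@normr_measurable R setT)).
    by apply: measurable_funB => //; exact: measurable_trawl_integral.
  apply: (@le_trans _ _ (\int[P]_w \sum_j (`|th j|%:E * (`|\int[mu]_(s in `[0%R, V j]) X s w -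
      V j / N%:R * \sum_(k < N) X (grid (V j) N k) w|%R)%:E))%E).
    apply: ge0_le_integral => //.
    - apply/measurable_EFinP; apply: (measurableT_comp (@normr_measurable R setT)).
      exact: measurable_funB.
    - by apply: emeasurable_sum => j; apply: emeasurable_funM.
    - move=> w _; rewrite sumEFin lee_fin /W /RS -sumrB (le_trans (ler_norm_sum _ _ _))//.
      by apply: ler_sum => j _; rewrite -mulrBr normrM.
  rewrite ge0_integral_sum//; last by move=> j; apply: emeasurable_funM.
  apply: (@le_trans _ _ (\sum_j (`|th j|%:E * (e / A)%:E))%E).
    apply: lee_sum => j _; rewrite ge0_integralZl//.
    by apply: lee_wpmul2l => //; exact: hN.
  under eq_bigr do rewrite -EFinM.
  rewrite sumEFin lee_fin -mulr_suml mulrCA ger_pMr// ler_pdivrMr// mul1r.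
  by rewrite lerDl.
have hcos := cvg_Rintegral_lip mRS mW (@measurable_cos R) (@cos_max R) (@cos_lip R) cvgL1.
have hsin := cvg_Rintegral_lip mRS mW (@measurable_sin R) (@sin_max R) (@sin_lip R) cvgL1.
split.
  have h : \int[P]_w cos (RS N w) @[N --> \oo] --> expR (- fine (\int[leb2]_p (psi (occ p))%:E)).
    apply: (@cvg_trans _ (expR (- fine (\int[leb2]_p (psi (occN N p))%:E)) @[N --> \oo])).
      apply: near_eq_cvg; apply: filterS (nbhs_infty_gt 0) => N N0.
      by have [->] := charfun_RS N0.
    have ca : - fine (\int[leb2]_p (psi (occN N p))%:E) @[N --> \oo] --> - fine (\int[leb2]_p (psi (occ p))%:E).
      exact: (cvgN cvg_area_integral).
    apply: (cvg_comp _ _ ca); exact: continuous_expR.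
  by apply: (cvg_unique _ hcos h); exact: norm_hausdorff.
have h : \int[P]_w sin (RS N w) @[N --> \oo] --> (0 : R).
  apply: cvg_near_cst; apply: filterS (nbhs_infty_gt 0) => N N0.
  by have [_ ->] := charfun_RS N0.
by apply: (cvg_unique _ hsin h); exact: norm_hausdorff.
Qed.

End trawl_integrals.

(** * Change of variables along the trawl function *)

Section trawl_substitution.
Context {R : realType} (gamma : R) (g : R -> R) (hg : trawl_function gamma g).
Notation mu := (@lebesgue_measure R).
Notation leb2 := (mu \x mu)%E.

Lemma trawl_gt0 x : 0 <= x -> 0 < g x.
Proof.
move=> x0; have x1 : x < x + 1 by rewrite ltrDl.
apply: (@le_lt_trans _ _ (g (x + 1))); last exact: (trawl_decreasing hg).
by apply: (trawl_ge0 hg); rewrite addr_ge0.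
Qed.

(** Monotonicity gives x * g x <= int_0^x g, which is bounded by the total integral of [g]. *)
Lemma trawl_cvg0 : g x @[x --> +oo] --> (0 : R).
Proof.
pose I := fine (\int[mu]_(x in `[0%R, +oo[) (g x)%:E)%E.
have gI x : 0 < x -> g x <= I / x.
  move=> x0; rewrite ler_pdivlMr// -lee_fin /I fineK; last first.
    by apply: integrable_fin_num => //; exact: (trawl_integrable hg).
  have mgI (A : set R) : measurable A -> A `<=` `[0, +oo[%classic -> measurable_fun A (EFin \o g).
    move=> mA AI; apply: (measurable_funS _ AI) => //.
    by have /integrableP[] := trawl_integrable hg.
  have sub : (`[0, x] : set R) `<=` `[0, +oo[.
    by move=> y /=; rewrite !in_itv/= andbT => /andP[].
  apply: (@le_trans _ _ (\int[mu]_(y in `[0%R, x]) (g y)%:E)%E); last first.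
    apply: ge0_subset_integral => //; first by apply: mgI.
    by move=> y /=; rewrite in_itv/= andbT lee_fin => /(trawl_ge0 hg).
  apply: (@le_trans _ _ (\int[mu]_(y in `[0%R, x]) (g x)%:E)%E).
    by rewrite integral_cst//= lebesgue_measure_itv/= lte_fin x0 oppr0 adde0 EFinM.
  apply: ge0_le_integral => //.
  - by move=> y _; rewrite lee_fin (trawl_ge0 hg)// ltW.
  - exact: mgI.
  - move=> y /=; rewrite in_itv/= => /andP[y0 yx]; rewrite lee_fin.
    exact: (trawl_le hg).
apply/cvgrPdist_le => e e0; near=> x.
have x0 : 0 < x by [].
have gx0 : 0 <= g x by apply: (trawl_ge0 hg); exact: ltW.
rewrite sub0r normrN ger0_norm// (le_trans (gI _ x0))//.
rewrite ler_pdivrMr// mulrC -ler_pdivrMr//.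
Unshelve. all: by end_near. Qed.

Lemma trawl_derive_le0 x : 0 < x -> derive1 g x <= 0.
Proof.
move=> x0; apply: (@decr_derive1_le0_itvy R g true 0 x) => //.
- by move=> y; rewrite inE/= in_itv/= andbT => /(trawl_derivable hg).
- move=> y z; rewrite !in_itv/= !andbT => y0 z0; exact: (trawl_decreasing hg).
- by rewrite in_itv/= x0.
Qed.

Lemma integral_trawl_derive_tail c : 0 < c ->
  (\int[mu]_(r in `[c, +oo[) (`|derive1 g r|)%:E = (g c)%:E)%E.
Proof.
move=> c0; pose f (r : R) := - derive1 g r.
transitivity (\int[mu]_(r in `[c, +oo[) (f r)%:E)%E.
  apply: eq_integral => r; rewrite inE/= in_itv/= andbT => cr.
  by rewrite /f ler0_norm// trawl_derive_le0// (lt_le_trans c0).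
have dN r : 0 < r -> derivable (fun x => - g x) r 1 by move=> r0; apply: derivableN; exact: (trawl_derivable hg).
rewrite (@ge0_continuous_FTC2y _ f (fun x => - g x) c 0).
- by rewrite sub0e EFinN oppeK.
- by move=> x cx; rewrite oppr_ge0 trawl_derive_le0// (lt_le_trans c0).
- apply: continuous_in_subspaceT => x; rewrite inE/= in_itv/= andbT => cx.
  by apply: continuousN; apply: (trawl_derive_continuous hg); exact: lt_le_trans cx.
- by rewrite -[X in _ --> X]oppr0; apply: cvgN; exact: trawl_cvg0.
- by move=> x cx; apply: dN; exact: lt_trans cx.
- have cg : {for c, continuous (fun x => - g x)}.
    by apply: differentiable_continuous; apply/derivable1_diffP; exact: dN.
  exact: cvg_at_right_filter.
- move=> x; rewrite in_itv/= andbT => cx.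
  rewrite /f derive1N//; apply: (trawl_derivable hg); exact: lt_trans cx.
Qed.

Lemma measurable_trawl_derive : measurable_fun (`]0, +oo[ : set R) (derive1 g).
Proof.
apply: open_continuous_measurable_fun; first exact: interval_open.
by move=> x; rewrite inE/= in_itv/= andbT; exact: (trawl_derive_continuous hg).
Qed.

Lemma trawl_cvg_at0 : g (k.+1%:R^-1) @[k --> \oo] --> g 0.
Proof.
have /continuous_within_itvcyP[_ g0] := trawl_continuous hg.
apply: (cvg_at_rightP _ _ _).1 g0 _ _; split => [k|]; first by rewrite invr_gt0.
exact: cvg_harmonic.
Qed.

(** The derivative may blow up at 0, so the formula for [c, +oo[ is passed to the limit c = 1 / (k +
    1), by monotone convergence on one side and continuity of [g] at 0 on the other. *)
Lemma integral_trawl_derive :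
  (\int[mu]_(r in `]0%R, +oo[) (`|derive1 g r|)%:E = (g 0)%:E)%E.
Proof.
pose F k := `[k.+1%:R^-1, +oo[%classic : set R.
have UF : `]0, +oo[%classic = \bigcup_k F k.
  apply/seteqP; split => x /=; rewrite /F.
    rewrite in_itv/= andbT => x0; exists (Num.truncn x^-1) => //=.
    rewrite in_itv/= andbT -[leRHS]invrK lef_pV2 ?posrE ?invr_gt0//.
    exact/ltW/truncnS_gt.
  by move=> [k _]; rewrite /= !in_itv/= !andbT; exact: lt_le_trans.
have mF k : measurable (F k) by exact: measurable_itv.
have ndF : nondecreasing_seq F.
  apply/nondecreasing_seqP => k; apply/subsetPset => x; rewrite /F/= !in_itv/= !andbT.
  by apply: le_trans; rewrite lef_pV2 ?posrE// ler_nat.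
have mfF k : measurable_fun (F k) (fun r => (`|derive1 g r|)%:E).
  apply/measurable_EFinP; apply: (measurableT_comp (@normr_measurable R setT)).
  apply: (measurable_funS _ _ measurable_trawl_derive) => //.
  by rewrite UF; exact: bigcup_sup.
have h : (\int[mu]_(r in F k) (`|derive1 g r|)%:E @[k --> \oo] --> \int[mu]_(r in \bigcup_k F k) (`|derive1 g r|)%:E)%E.
  by apply: ge0_nondecreasing_set_cvg_integral => // k r _; rewrite lee_fin.
rewrite UF -(cvg_lim _ h)//; apply: cvg_lim => //.
under eq_cvg do rewrite integral_trawl_derive_tail ?invr_gt0//.
by apply: cvg_EFin; [exact: nearW|exact: trawl_cvg_at0].
Qed.

Let gp (z : R) : R := g (Num.max z 0).
Let k (r : R) : R := `|derive1 g r| * \1_(`]0, +oo[%classic : set R) r.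

Let mk : measurable_fun setT k.
Proof.
have -> : k = (fun r => `|derive1 g r|) \_ `]0, +oo[%classic.
  apply/funext => r; rewrite patchE /k indicE.
  by case: (r \in _); rewrite ?mulr1 ?mulr0.
apply: (measurable_restrictT _ _).1 => //.
by apply: (measurableT_comp (@normr_measurable R setT)); exact: measurable_trawl_derive.
Qed.

Let k_ge0 r : 0 <= k r.
Proof. by rewrite mulr_ge0. Qed.

(** The subgraph of |g'|. Planar Lebesgue measure on it projects to the measure with density |g'| in
    r, whose image under [g] is to be compared with Lebesgue measure on ]0, g 0[. *)
Let S : set (R * R) := [set z | 0 <= z.2] `&` [set z | z.2 < k z.1].

Let S_gt0 z : S z -> 0 < z.1.
Proof.
move=> [z0 /= zk]; have := le_lt_trans z0 zk; rewrite /k indicE.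
case: (boolP (z.1 \in _)) => [|_]; last by rewrite mulr0 ltxx.
by rewrite inE/= in_itv/= andbT.
Qed.

Let mS : measurable S.
Proof.
have m2 : measurable_fun setT (fun p : R * R => p.2) by exact: measurable_snd.
have mk1 : measurable_fun setT (fun p : R * R => k p.1).
  by apply: (measurableT_comp mk); exact: measurable_fst.
apply: measurableI; rewrite -[X in measurable X]setTI.
  by apply: (measurable_fun_ler (f := cst 0)).
exact: measurable_fun_ltr.
Qed.

(* Outside the subgraph of [k] the point is sent to [-1], so that the subgraph
   is exactly the preimage of the interval ]0, g 0[. *)
Let phi (z : R * R) : R := gp z.1 * \1_S z + (\1_S z - 1).

Let mphi : measurable_fun setT phi.
Proof.
have mI : measurable_fun setT (\1_S : R * R -> R) by exact: measurable_indic.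
apply: measurable_funD; last exact: measurable_funB.
apply: measurable_funM => //; apply: (measurableT_comp (measurable_trawl_ext hg)).
exact: measurable_fst.
Qed.

Let phiS z : S z -> phi z = g z.1.
Proof.
move=> Sz; rewrite /phi indicE mem_set//= subrr addr0 mulr1 /gp max_l//.
by apply: ltW; exact: S_gt0.
Qed.

Let phi_preimage : phi @^-1` `]0, g 0[ = S.
Proof.
apply/seteqP; split => z /=.
  rewrite in_itv/= => /andP[phi0 _]; have [//|nS] := pselect (S z).
  by move: phi0; rewrite /phi indicE memNset// mulr0 add0r sub0r ltr0N1.
move=> Sz; have z0 := S_gt0 Sz; rewrite phiS// in_itv/=.
by rewrite trawl_gt0 ?ltW//; apply: (trawl_decreasing hg).
Qed.

Let mphiR : measurable_fun setT (phi : R * R -> measurableTypeR R).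
Proof. exact: mphi. Qed.

Let m1 := measure_function_pushforward__canonical__measure_function_Measure
  (mu \x mu)%E mphiR.

Local Open Scope ereal_scope.

Let integral_m1 (Phi : R -> \bar R) : measurable_fun setT Phi -> (forall y, 0 <= Phi y) ->
  \int[m1]_(y in `]0%R, g 0[) Phi y = \int[mu]_(r in `]0%R, +oo[) (Phi (g r) * (`|derive1 g r|)%:E).
Proof.
move=> mPhi Phi0.
rewrite ge0_integral_pushforward//; last by apply: measurable_funTS.
rewrite phi_preimage.
pose h (z : R * R) := Phi (gp z.1) * (\1_S z)%:E.
have mI : measurable_fun setT (\1_S : R * R -> R) by exact: measurable_indic.
have mPg : measurable_fun setT (fun r => Phi (gp r)).
  by apply: (measurableT_comp mPhi); exact: (measurable_trawl_ext hg).
have mh : measurable_fun setT h.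
  apply: emeasurable_funM; last exact/measurable_EFinP.
  by apply: (measurableT_comp mPg); exact: measurable_fst.
transitivity (\int[(mu \x mu)%E]_z h z).
  rewrite integral_mkcond; apply: eq_integral => z _; rewrite patchE /h indicE.
  case: (boolP (z \in S)) => [|_]; last by rewrite mule0.
  by rewrite inE => Sz; rewrite /= mule1 phiS// /gp max_l// ltW// S_gt0.
rewrite (@fubini_tonelli1 _ _ _ _ _ mu mu h mh); last by move=> z; rewrite mule_ge0 ?lee_fin.
rewrite [RHS]integral_mkcond; apply: eq_integral => r _.
rewrite /fubini_F /h /= ge0_integralZl//; last first.
  apply/measurable_EFinP; exact: (measurableT_comp mI).
have -> : \int[mu]_y (\1_S (r, y))%:E = (k r)%:E.
  transitivity (\int[mu]_y (\1_(`[0%R, k r[%classic : set R) y)%:E).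
    apply: eq_integral => y _; rewrite !indicE; congr ((nat_of_bool _)%:R%:E).
    by apply/idP/idP; rewrite !inE/= in_itv/=; [move=> [/= -> ->]|move=> /andP[]].
  rewrite integral_indic// setIT.
  transitivity (mu `[0%R, k r[) => //; rewrite lebesgue_measure_itv/= lte_fin oppr0 adde0.
  case: ltP => // k0; congr EFin; apply/eqP; by rewrite eq_le k_ge0 k0.
rewrite patchE /k indicE; case: (boolP (r \in _)) => [|_]; last by rewrite mulr0 mule0.
by rewrite inE/= in_itv/= andbT mulr1 => r0; rewrite /gp max_l// ltW.
Qed.

(** For 0 < a < g 0 the intermediate value theorem gives c with g c = a; then g r < a means r > c,
    and the integral of |g'| over ]c, +oo[ is g c = a. Other values of a give an empty or full
    trace. *)
Let m1_lt a : m1 (`]-oo, a[ `&` `]0%R, g 0[) = mu (`]-oo, a[ `&` `]0%R, g 0[).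
Proof.
transitivity (\int[mu]_(r in `]0%R, +oo[) ((\1_(`]-oo, a[%classic : set R) (g r))%:E * (`|derive1 g r|)%:E)).
  rewrite -(integral_m1 (Phi := fun y => (\1_(`]-oo, a[%classic : set R) y)%:E)); last 2 first.
  - by apply/measurable_EFinP; exact: measurable_indic.
  - by move=> y; rewrite lee_fin.
  by rewrite integral_indic.
have [a0|a0] := leP a 0%R.
  have -> : (`]-oo, a[ `&` `]0%R, g 0[ = set0 :> set R).
    apply/seteqP; split => y //= []; rewrite !in_itv/= => ya /andP[y0 _].
    by have := lt_le_trans (lt_trans y0 ya) a0; rewrite ltxx.
  rewrite measure0 integral0_eq// => r; rewrite /= in_itv/= andbT => r0.
  rewrite indicE memNset ?mul0e//= in_itv/= => ga.
  by have := lt_le_trans (lt_trans (trawl_gt0 (ltW r0)) ga) a0; rewrite ltxx.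
have [ga|ga] := leP (g 0) a.
  have -> : (`]-oo, a[ `&` `]0%R, g 0[ = (`]0%R, g 0[%classic : set R)).
    apply/seteqP; split => y /=; rewrite !in_itv/=; first by case.
    by move=> h; split => //; case/andP: h => _ /lt_le_trans; apply.
  rewrite lebesgue_measure_itv/= lte_fin (trawl_gt0 (lexx 0%R)) oppr0 adde0.
  rewrite -integral_trawl_derive; apply: eq_integral => r; rewrite inE/= in_itv/= andbT => r0.
  rewrite indicE mem_set ?mul1e//= in_itv/= (lt_le_trans _ ga)//.
  exact: (trawl_decreasing hg).
have [c c0 gc] : exists2 c, (0 < c)%R & g c = a.
  have /cvgrPdist_lt/(_ a a0) [M [Mr hM]] := trawl_cvg0.
  pose b : R := Num.max (M + 1)%R 1%R.
  have b0 : (0 <= b)%R by rewrite le_max ler01 orbT.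
  have gb : (g b < a)%R.
    have := hM b; rewrite sub0r normrN ger0_norm ?(trawl_ge0 hg)//; apply.
    by rewrite lt_max ltrDl ltr01.
  have cb : {within `[0%R, b], continuous g}.
    apply: (continuous_subspaceW _ (trawl_continuous hg)) => x /=.
    by rewrite !in_itv/= andbT => /andP[].
  have [|c] := @IVT R g 0%R b a b0 cb.
    by rewrite ge_min (ltW gb) orbT le_max (ltW ga).
  rewrite in_itv/= => /andP[c0 _] gc; exists c => //.
  by rewrite lt_neqAle c0 andbT; apply/eqP => c00; move: ga; rewrite -gc -c00 ltxx.
have -> : (`]-oo, a[ `&` `]0%R, g 0[ = (`]0%R, a[%classic : set R)).
  apply/seteqP; split => y /=; rewrite !in_itv/=; first by move=> [-> /andP[->]].
  by move=> /andP[y0 ya]; split => //; rewrite y0 (lt_trans ya).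
rewrite lebesgue_measure_itv/= lte_fin a0 oppr0 adde0.
transitivity (\int[mu]_(r in `]c, +oo[) (`|derive1 g r|)%:E).
  have -> : `]c, +oo[%classic = (`]0%R, +oo[ `&` `]c, +oo[ : set R).
    apply/seteqP; split => r /=; rewrite !in_itv/= !andbT; last by case.
    by move=> cr; split => //; exact: lt_trans cr.
  rewrite integral_mkcondr; apply: eq_integral => r; rewrite inE/= in_itv/= andbT => r0.
  rewrite epatch_indic muleC; congr (_ * (nat_of_bool _)%:R%:E).
  apply/idP/idP; rewrite !inE/= !in_itv/= andbT -gc; last exact: (trawl_decreasing hg (ltW c0)).
  by apply: contraTT; rewrite -!leNgt => rc; apply: (trawl_le hg) => //; exact: ltW.
rewrite integral_itv_obnd_cbnd; first by rewrite integral_trawl_derive_tail// gc.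
apply/measurable_EFinP; apply: (measurableT_comp (@normr_measurable R setT)).
apply: (measurable_funS _ _ measurable_trawl_derive) => // r /=.
by rewrite !in_itv/= !andbT; exact: lt_trans.
Qed.

(** The traces of the two measures on ]0, g 0[ are finite and agree on the half-lines ]-oo, a[, a
    generating class stable under intersection, hence on all Borel sets. *)
Lemma integral_trawl_substitution (Phi : R -> \bar R) :
  measurable_fun setT Phi -> (forall y, 0 <= Phi y) ->
  \int[mu]_(y in `]0%R, g 0[) Phi y = \int[mu]_(r in `]0%R, +oo[) (Phi (g r) * (`|derive1 g r|)%:E).
Proof.
move=> mPhi Phi0; rewrite -integral_m1//.
have mD : measurable (`]0%R, g 0[%classic : set R) by [].
apply/esym; apply: (@eq_measure_integral _ (measurableTypeR R) R _ mu m1) => A mA AD.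
have <- : A `&` `]0%R, g 0[ = A by apply/setIidl.
apply: (@measure_unique _ R (measurableTypeR R) (@RGenInftyO.G R) (fun n => `]-oo, n%:R[%classic) _ _ _ _ (mrestr m1 mD) (mrestr mu mD)) => //.
- exact: RGenInftyO.measurableE.
- move=> _ _ [x ->] [y ->]; exists (Num.min x y).
  by apply/seteqP; split => z /=; rewrite !in_itv/= lt_min; [move=> [-> ->]|move=> /andP[]].
- by move=> n; exists n%:R.
- apply/seteqP; split => // x _; exists (Num.truncn x).+1 => //=.
  by rewrite in_itv/=; exact: truncnS_gt.
- by move=> _ [x ->]; exact: m1_lt.
- move=> n; rewrite /= /mrestr m1_lt (@le_lt_trans _ _ (mu `]0%R, g 0[))//.
    by apply: le_measure; rewrite ?inE//; exact: measurableI.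
  by rewrite lebesgue_measure_itv/=; case: ifP => _; rewrite -?EFinD ltry.
Qed.

End trawl_substitution.

(** * Occupation times as overlaps of intervals *)

Section overlap.
Context {R : realType}.
Notation mu := (@lebesgue_measure R).

(* Length of the intersection of [0, V] and [x, x + r], the set of times [s]
   at which the trawl set [A_s] contains the point [(x, g r)]. *)
Definition overlap (V r x : R) : R := Num.max 0 (Num.min V (x + r) - Num.max 0 x).

Lemma overlap_ge0 V r x : 0 <= overlap V r x.
Proof. by rewrite /overlap le_max lexx. Qed.

Lemma overlap_le V r x : 0 <= r -> overlap V r x <= r.
Proof.
move=> r0; rewrite /overlap ge_max r0/= lerBlDr ge_min; apply/orP; right.
by rewrite addrC lerD2l le_max lexx orbT.
Qed.

Lemma overlap_le_end V r x : 0 <= V -> overlap V r x <= V.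
Proof.
move=> V0; rewrite /overlap ge_max V0/= lerBlDr ge_min; apply/orP; left.
by rewrite lerDl le_max lexx.
Qed.

Lemma overlap_left V r x : x + r <= 0 -> overlap V r x = 0.
Proof.
move=> h; rewrite /overlap max_l// subr_le0 ge_min; apply/orP; right.
by rewrite (le_trans h)// le_max lexx.
Qed.

Lemma overlap_right V r x : V <= x -> overlap V r x = 0.
Proof.
move=> h; rewrite /overlap max_l// subr_le0 ge_min; apply/orP; left.
by rewrite (le_trans h)// le_max lexx orbT.
Qed.

Lemma overlapM c V r x : 0 <= c -> overlap (c * V) (c * r) (c * x) = c * overlap V r x.
Proof.
move=> c0; by rewrite /overlap -mulrDr maxr_pMr// mulrBr minr_pMr// maxr_pMr// !mulr0.
Qed.

(** An exact equality for small r, so pointwise convergence in the scaling limit is eventually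
    constant. The threshold d is the distance from x to 0 when x < 0, and to V when 0 <= x < V. *)
Lemma overlap_near0 V x : exists2 d, 0 < d & forall r, 0 <= r <= d ->
  overlap V r x = r * \1_([set y | 0 <= y < V]) x.
Proof.
rewrite indicE; have [x0|x0] := ltP x 0.
  exists (- x) => [|r /andP[_ rx]]; first by rewrite oppr_gt0.
  rewrite memNset/= ?mulr0 ?overlap_left//; first by rewrite addrC -lerBrDr sub0r.
  by rewrite leNgt x0.
have [xV|Vx] := ltP x V; last first.
  exists 1 => // r _; rewrite memNset/= ?mulr0 ?overlap_right//.
  by rewrite x0/= ltNge Vx.
exists (V - x) => [|r /andP[r0 rx]]; first by rewrite subr_gt0.
rewrite mem_set/= ?x0// mulr1 /overlap (max_r x0) min_r; last by rewrite addrC -lerBrDr.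
by rewrite addrAC subrr add0r max_r.
Qed.

Lemma measurable_overlap d (T : measurableType d) V (f h : T -> R) : measurable_fun setT f -> measurable_fun setT h ->
  measurable_fun setT (fun z => overlap V (f z) (h z)).
Proof.
move=> mf mh; apply: measurable_maxr => //; apply: measurable_funB.
  by apply: measurable_minr => //; exact: measurable_funD.
exact: measurable_maxr.
Qed.

End overlap.

Section trawl_occupation.
Context {R : realType} (gamma : R) (g : R -> R) (hg : trawl_function gamma g).
Notation mu := (@lebesgue_measure R).
Notation leb2 := (mu \x mu)%E.

(** Strict monotonicity of [g] turns g r <= g (s - x) into s - x <= r, so the point is caught
    exactly for s in [x, x + r]. *)
Lemma occupation_trawl V r x : 0 < r -> occupation g V (x, g r) = overlap V r x.
Proof.
move=> r0.
have E s : trawl_set g s (x, g r) <-> x <= s <= x + r.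
  rewrite /trawl_set/= (ltW (trawl_gt0 hg (ltW r0)))/=; split => [[xs]|/andP[xs sxr]].
    rewrite xs/= => h; rewrite leNgt; apply/negP => sxr.
    have := trawl_decreasing hg (ltW r0) (_ : r < s - x); rewrite ltrBrDr addrC => /(_ sxr).
    by rewrite ltNge h.
  by split=> //; apply: (trawl_le hg); rewrite ?subr_ge0// lerBlDr addrC.
rewrite /occupation.
have -> : (fun s : R => \1_(trawl_set g s) (x, g r) : R) = \1_(`[x, x + r]%classic).
  apply/funext => s; rewrite !indicE; congr (nat_of_bool _)%:R.
  by apply/idP/idP; rewrite !inE/= in_itv/= => /E.
rewrite /Rintegral integral_indic// setIC.
have -> : `[0, V] `&` `[x, x + r] = `[Num.max 0 x, Num.min V (x + r)]%classic :> set R.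
  apply/seteqP; split => s /=; rewrite !in_itv/= ge_max le_min.
    by move=> [/andP[-> ->] /andP[-> ->]].
  by move=> /andP[/andP[-> ->] /andP[-> ->]].
rewrite [X in fine X](_ : _ = mu `[Num.max 0 x, Num.min V (x + r)]%classic)//.
rewrite lebesgue_measure_itv/= lte_fin /overlap; case: ltP => [h|h].
  by rewrite -EFinB/= [RHS]max_r// subr_ge0 ltW.
by rewrite /= [RHS]max_l// subr_le0.
Qed.

Lemma occupation0 V x y : y < 0 \/ g 0 < y -> occupation g V (x, y) = 0.
Proof.
move=> hy; rewrite /occupation.
rewrite (@eq_Rintegral _ _ _ mu _ (cst 0)); first by rewrite Rintegral_cst//= mul0r.
move=> s _; rewrite indicE memNset// => -[/= xs /andP[y0 yg]].
case: hy => [|hy]; first by rewrite ltNge y0.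
have : y <= g 0 by rewrite (le_trans yg)// (trawl_le hg)// subr_ge0.
by rewrite leNgt hy.
Qed.

Local Open Scope ereal_scope.

(** Tonelli's theorem with the height y outermost: heights outside [0, g 0] are never reached and
    contribute psi 0 = 0, and on ]0, g 0[ the substitution y = g r applies. *)
Lemma integral_occupation (psi : R -> R) n (V th : 'I_n -> R) :
  measurable_fun setT psi -> (forall x, (0 <= psi x)%R) -> psi 0%R = 0%R ->
  (forall j, (0 <= V j)%R) ->
  \int[leb2]_p (psi (\sum_j th j * occupation g (V j) p))%:E =
  \int[mu]_(r in `]0%R, +oo[) (\int[mu]_x (psi (\sum_j th j * overlap (V j) r x)%R)%:E *
    (`|derive1 g r|)%:E).
Proof.
move=> mpsi psi_ge0 psi0 V0.
pose f p := (psi (\sum_j th j * occupation g (V j) p)%R)%:E.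
have mf : measurable_fun setT f.
  apply/measurable_EFinP; apply: (measurableT_comp mpsi); apply: measurable_sum => j.
  by apply: measurable_funM => //; exact: (measurable_occupation hg).
have f0 p : 0 <= f p by rewrite lee_fin.
rewrite (@fubini_tonelli1 _ _ _ _ _ mu mu f mf)// (@fubini_tonelli _ _ _ _ _ mu mu f mf)//.
have mG := @measurable_fun_fubini_tonelli_G _ _ _ _ _ mu _ mf f0.
have G0 y : 0 <= fubini_G mu f y by apply: integral_ge0.
transitivity (\int[mu]_(y in `[0%R, g 0]) fubini_G mu f y).
  rewrite [RHS]integral_mkcond; apply: eq_integral => y _; rewrite patchE.
  case: ifPn => // /negP; rewrite inE/= in_itv/= => hy.
  rewrite /fubini_G integral0_eq// => x _; rewrite /f big1 ?psi0// => j _.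
  rewrite occupation0 ?mulr0//; apply/orP; move/negP: hy.
  by rewrite negb_and -!ltNge.
rewrite integral_itv_bndoo; last exact: measurable_funTS.
rewrite (integral_trawl_substitution hg mG G0); apply: eq_integral => r; rewrite inE/= in_itv/= andbT => r0.
congr (_ * _); rewrite /fubini_G /f; apply: eq_integral => x _.
by congr (psi _)%:E; apply: eq_bigr => j _; rewrite occupation_trawl.
Qed.

End trawl_occupation.

(** * The scaling limit *)

Section halfline.
Context {R : realType}.
Notation mu := (@lebesgue_measure R).
Local Open Scope ereal_scope.

Lemma ge0_integral_itv0y_scale (a : R) (f : R -> \bar R) : (0 < a)%R ->
  measurable_fun (`]0%R, +oo[ : set R) f -> (forall x, (0 < x)%R -> 0 <= f x) ->
  \int[mu]_(x in `]0%R, +oo[) f x = a%:E * \int[mu]_(x in `]0%R, +oo[) f (a * x)%R.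
Proof.
move=> a0 mf f0; rewrite integral_mkcond (ge0_integral_affine 0%R a0).
- congr (_ * _); rewrite [RHS]integral_mkcond; apply: eq_integral => x _.
  rewrite !patchE addr0; congr (if _ then _ else _); apply/idP/idP; rewrite !inE/= !in_itv/= !andbT.
    by rewrite pmulr_rgt0.
  by rewrite pmulr_rgt0.
- exact: (measurable_restrictT _ _).1.
- by move=> x; rewrite patchE; case: ifPn => // ; rewrite inE/= in_itv/= andbT => /f0.
Qed.

Lemma integral_indic_itvcc (a b : R) :
  \int[mu]_x (\1_(`[a, b]%classic : set R) x)%:E = (Num.max 0 (b - a))%:E.
Proof.
rewrite integral_indic// setIT; transitivity (mu `[a, b]) => //.
rewrite lebesgue_measure_itv/= lte_fin; case: ltP => ab.
  by rewrite -EFinB max_r// subr_ge0 ltW.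
by rewrite max_l// subr_le0.
Qed.

End halfline.

Lemma powR_cvgy {R : realType} (F : nat -> R) q : 0 < q ->
  F k @[k --> \oo] --> +oo -> F k `^ q @[k --> \oo] --> +oo.
Proof.
move=> q0 F_oo; apply/cvgryPge => A; pose A' := Num.max A 1.
have A'0 : 0 <= A' by rewrite le_max ler01 orbT.
have : \forall k \near \oo, A' `^ q^-1 <= F k by move/cvgryPge: F_oo; apply.
apply: filterS => k hk.
rewrite (@le_trans _ _ A')//; first by rewrite le_max lexx.
rewrite -(powRr1 A'0) -(mulVf (lt0r_neq0 q0)) powRrM.
apply: ge0_ler_powR; rewrite ?nnegrE ?powR_ge0//; first exact: ltW.
exact: le_trans (powR_ge0 _ _) hk.
Qed.

Section scaling_limit.
Context {R : realType} (psi p dg : R -> R) (gamma D Cg r0 : R).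
Notation mu := (@lebesgue_measure R).
Hypotheses (gamma0 : 0 < gamma) (D0 : 0 <= D) (r00 : 0 <= r0).
Hypotheses (mpsi : measurable_fun setT psi) (psi_ge0 : forall u, 0 <= psi u) (psi0 : psi 0 = 0).
Hypotheses (mp : measurable_fun setT p) (p_nd : forall u v, 0 <= u -> u <= v -> p u <= p v)
  (psi_p : forall u, psi u <= p `|u|)
  (p_fin : (\int[mu]_(u in `]0%R, +oo[) (p u * u `^ (- 2 - gamma))%:E < +oo)%E).
Hypotheses (mdg : measurable_fun (`]0, +oo[ : set R) dg) (dg_ge0 : forall r, 0 <= dg r)
  (dg_tail : x `^ (2 + gamma) * dg x @[x --> +oo] --> Cg)
  (dg_le : forall r, r0 < r -> dg r <= D * r `^ (- 2 - gamma)).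
Variable F : nat -> R.
Hypotheses (F1 : forall k, 1 <= F k) (F_oo : F k @[k --> \oo] --> +oo).
(** The density in u: for T = F ^ (1 + gamma) the factor T * F is F ^ (2 + gamma). *)
Let w k u := F k `^ (2 + gamma) * dg (F k * u).
(** [dg_le] gives no control below r0, so the range u <= r0 / F is left to this assumption; its
    interval is empty when r0 = 0. *)
Hypothesis small_jumps : forall c : R, 0 < c ->
  (\int[mu]_(u in `]0%R, (r0 / F k)%R]) (p (c * u) * w k u)%:E @[k --> \oo] --> 0)%E.
Variables (n : nat) (t th : 'I_n -> R).
Hypothesis t0 : forall j, 0 <= t j.

Let F0 k : 0 < F k. Proof. exact: lt_le_trans (F1 k). Qed.
Let p_ge0 u : 0 <= u -> 0 <= p u.
Proof. by move=> u0; rewrite (le_trans (psi_ge0 u))// (le_trans (psi_p u))// ger0_norm. Qed.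
Let M : R := \sum_j `|th j| + 1.
Let M0 : 0 < M. Proof. by rewrite ltr_wpDl// sumr_ge0. Qed.
Let tm : R := \sum_j t j + 1.
Let tm0 : 0 < tm. Proof. by rewrite ltr_wpDl// sumr_ge0. Qed.
Let t_le j : t j <= tm.
Proof. by rewrite /tm (bigD1 j)//= -addrA lerDl addr_ge0// sumr_ge0. Qed.

(* [E k = T / F] for the time horizon [T = F ^ (1 + gamma)]; it is the cutoff
   between trawl widths that are short and long with respect to [T]. *)
Let E k := F k `^ gamma.
Let E1 k : 1 <= E k.
Proof. by rewrite /E -(powRr0 (F k)) ler_powR// ltW. Qed.
Let E0 k : 0 < E k. Proof. exact: lt_le_trans (E1 k). Qed.
Let E_oo : E k @[k --> \oo] --> +oo.
Proof. exact: powR_cvgy. Qed.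

(** The rescaled occupation function: with T = F * E, homogeneity turns the overlap of (T * t, F *
    u, T * x), divided by F, into E * overlap t (u / E) x. *)
Let jump k u x := \sum_j th j * E k * overlap (t j) (u / E k) x.
Let G k u : \bar R := (\int[mu]_x (psi (jump k u x))%:E)%E.

Let jump_le k u x : 0 <= u -> `|jump k u x| <= M * u.
Proof.
move=> u0; rewrite (le_trans (ler_norm_sum _ _ _))// (@le_trans _ _ (\sum_j `|th j| * u))//.
  apply: ler_sum => j _; rewrite normrM normrM (ger0_norm (ltW (E0 k))) -mulrA ler_wpM2l//.
  rewrite (ger0_norm (overlap_ge0 _ _ _)) mulrC -ler_pdivlMr//.
  by rewrite overlap_le// divr_ge0// ltW.
by rewrite -mulr_suml ler_wpM2r// lerDl.
Qed.

(** For trawls wider than the horizon the overlap saturates at t j, which gives a bound independent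
    of u. *)
Let jump_le_end k u x : `|jump k u x| <= M * tm * E k.
Proof.
rewrite (le_trans (ler_norm_sum _ _ _))// (@le_trans _ _ (\sum_j `|th j| * (tm * E k)))//.
  apply: ler_sum => j _; rewrite normrM normrM (ger0_norm (ltW (E0 k))) -mulrA ler_wpM2l//.
  rewrite (ger0_norm (overlap_ge0 _ _ _)) mulrC ler_wpM2r//; first exact: ltW.
  exact: le_trans (overlap_le_end _ _ (t0 j)) (t_le j).
by rewrite -mulr_suml -mulrA ler_wpM2r ?lerDl// mulr_ge0// ltW.
Qed.

Let jump_supp k u x : x \notin (`[- (u / E k), tm]%classic : set R) -> jump k u x = 0.
Proof.
rewrite notin_setE/= in_itv/= => /negP; rewrite negb_and -!ltNge => h.
rewrite /jump big1// => j _; case/orP: h => h.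
  by rewrite overlap_left ?mulr0// ltW// -ltrBrDr sub0r.
by rewrite overlap_right ?mulr0// (le_trans (t_le j))// ltW.
Qed.

Let mjump k : measurable_fun setT (fun z : R * R => psi (jump k z.1 z.2)).
Proof.
apply: (measurableT_comp mpsi); apply: measurable_sum => j.
apply: measurable_funM => //; apply: measurable_overlap; last exact: measurable_snd.
by apply: measurable_funM => //; exact: measurable_fst.
Qed.

Local Open Scope ereal_scope.

Let G_ge0 k u : 0 <= G k u.
Proof. by apply: integral_ge0 => x _; rewrite lee_fin. Qed.

Let mG k : measurable_fun setT (G k).
Proof.
have mf : measurable_fun setT (fun z : R * R => (psi (jump k z.1 z.2))%:E).
  exact/measurable_EFinP.
have f0 z : 0 <= (fun z : R * R => (psi (jump k z.1 z.2))%:E) z by rewrite lee_fin.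
exact: (@measurable_fun_fubini_tonelli_F _ _ _ _ _ mu _ mf f0).
Qed.

Let mjumpx k u : measurable_fun setT (fun x => (psi (jump k u x))%:E).
Proof.
apply/measurable_EFinP; exact: (measurableT_comp (mjump k) (pair1_measurable u)).
Qed.

Let jump_indic k u v x : (0 <= v)%R -> (psi (jump k u x) <= p v)%R ->
  (psi (jump k u x) <= p v * \1_(`[(- (u / E k))%R, tm]%classic : set R) x)%R.
Proof.
move=> v0 h; rewrite indicE; case: (boolP (x \in _)) => [_|/jump_supp ->].
  by rewrite mulr1.
by rewrite psi0 mulr0.
Qed.

Let G_le k u v : (0 <= u)%R -> (0 <= v)%R -> (forall x, (psi (jump k u x) <= p v)%R) ->
  G k u <= (p v * (tm + u / E k))%:E.
Proof.
move=> u0 v0 h.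
have uE : (0 <= u / E k)%R by rewrite divr_ge0// ltW.
apply: (@le_trans _ _ (\int[mu]_x (p v * \1_(`[(- (u / E k))%R, tm]%classic : set R) x)%:E)).
  apply: ge0_le_integral => //.
  - by move=> x _; rewrite lee_fin.
  - exact: mjumpx.
  - by apply/measurable_EFinP; apply: measurable_funM => //; exact: measurable_indic.
  - by move=> x _; rewrite lee_fin; exact: jump_indic.
under eq_integral do rewrite EFinM.
rewrite ge0_integralZl//; last 2 first.
- by apply/measurable_EFinP; exact: measurable_indic.
- by rewrite lee_fin p_ge0.
by rewrite integral_indic_itvcc opprK max_r// addr_ge0// ltW.
Qed.

Let h x : R := (\sum_j th j * \1_([set y | (0 <= y < t j)%R]) x)%R.

Let cvg_jump u x : (0 < u)%R -> \forall k \near \oo, jump k u x = (u * h x)%R.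
Proof.
move=> u0.
have near_j j : \forall k \near \oo,
    (E k * overlap (t j) (u / E k) x)%R = (u * \1_([set y | (0 <= y < t j)%R]) x)%R.
  have [d d0 hd] := overlap_near0 (t j) x.
  have : \forall k \near \oo, (u / d <= E k)%R by move/cvgryPge: E_oo; apply.
  apply: filterS => k hk; rewrite hd; first by rewrite mulrA mulrCA mulfV ?mulr1// gt_eqF.
  by rewrite divr_ge0 ?(ltW (E0 k)) ?(ltW u0)//= ler_pdivrMr// mulrC -ler_pdivrMr.
have : \forall k \near \oo, forall j,
    (E k * overlap (t j) (u / E k) x)%R = (u * \1_([set y | (0 <= y < t j)%R]) x)%R.
  exact: filter_forall.
apply: filterS => k hk; rewrite /jump /h mulr_sumr; apply: eq_bigr => j _.
by rewrite -mulrA hk mulrCA.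
Qed.

Let mh : measurable_fun setT h.
Proof.
apply: measurable_sum => j; apply: measurable_funM => //; apply: measurable_indic.
by have := @measurable_itv R `[0%R, t j[; rewrite set_itvE.
Qed.

(** Since E k >= 1, all the supports lie in the fixed interval [- u, tm], on which p (M * u)
    dominates. Finiteness of the limit is recorded because it is later multiplied by the limit of
    the density. *)
Let cvg_G u : (0 < u)%R -> 
  \int[mu]_x (psi (u * h x))%:E \is a fin_num /\
  G k u @[k --> \oo] --> \int[mu]_x (psi (u * h x))%:E.
Proof.
move=> u0.
have pM0 : (0 <= p (M * u))%R by rewrite p_ge0// mulr_ge0// ltW.
have mI : measurable_fun setT (\1_(`[(- u)%R, tm]%classic : set R) : R -> R) by exact: measurable_indic.
have [|||||iG _ cG] := @dominated_convergence _ _ R mu setT measurableT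
  (fun k x => (psi (jump k u x))%:E) (fun x => (psi (u * h x))%:E)
  (fun x => (p (M * u) * \1_(`[(- u)%R, tm]%classic : set R) x)%:E).
- by move=> k; exact: mjumpx.
- apply/measurable_EFinP; apply: (measurableT_comp mpsi); exact: measurable_funM.
- apply: aeW => x _; apply: cvg_near_cst.
  by apply: filterS (cvg_jump x u0) => k ->.
- apply/integrableP; split; first by apply/measurable_EFinP; exact: measurable_funM.
  under eq_integral do rewrite gee0_abs ?lee_fin ?mulr_ge0// EFinM.
  rewrite ge0_integralZl//; last exact/measurable_EFinP.
  by rewrite integral_indic_itvcc -EFinM ltry.
- apply: aeW => x k _; rewrite lee_fin ger0_norm//.
  have := @jump_indic k u (M * u)%R x (mulr_ge0 (ltW M0) (ltW u0)).
  have hj : (psi (jump k u x) <= p (M * u))%R.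
    by rewrite (le_trans (psi_p _))// p_nd// jump_le// ltW.
  move=> /(_ hj) /le_trans; apply; rewrite ler_wpM2l// !indicE.
  case: (boolP (x \in _)) => //; rewrite inE/= in_itv/= => /andP[x1 x2].
  rewrite mem_set//= in_itv/= x2 andbT (le_trans _ x1)// lerN2 ler_pdivrMr// ler_peMr//.
  exact: ltW.
by split => //; exact: integrable_fin_num.
Qed.

Let beta := (- 2 - gamma)%R.

Let mpc c : measurable_fun (`]0%R, +oo[ : set R) (fun u => (p (c * u) * u `^ beta)%:E).
Proof.
apply/measurable_EFinP; apply: measurable_funTS; apply: measurable_funM.
  by apply: (measurableT_comp mp); exact: measurable_funM.
exact: measurable_powR.
Qed.

Let pc_ge0 c u : (0 < c)%R -> (0 < u)%R -> 0 <= (p (c * u) * u `^ beta)%:E.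
Proof.
by move=> c0 u0; rewrite lee_fin mulr_ge0 ?powR_ge0// p_ge0// mulr_ge0// ltW.
Qed.

Let integrable_p c : (0 < c)%R ->
  \int[mu]_(u in `]0%R, +oo[) (p (c * u) * u `^ beta)%:E < +oo.
Proof.
move=> c0; have a0 : (0 < c * c `^ beta)%R by rewrite mulr_gt0// powR_gt0.
rewrite -(@lte_pmul2l _ (c * c `^ beta)%:E)// gt0_muley//.
apply: le_lt_trans p_fin; rewrite [leRHS](ge0_integral_itv0y_scale c0).
- rewrite EFinM -muleA -ge0_integralZl//; last 3 first.
  + exact: mpc.
  + by move=> u; rewrite /= in_itv/= andbT; exact: pc_ge0.
  + by rewrite lee_fin powR_ge0.
  rewrite le_eqVlt; apply/orP; left; apply/eqP; congr (_ * _).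
  apply: eq_integral => u; rewrite inE/= in_itv/= andbT => u0.
  by rewrite -EFinM powRM ?ltW// mulrCA.
- by apply: eq_measurable_fun (mpc 1) => u _; rewrite mul1r.
- by move=> u u0; have := pc_ge0 ltr01 u0; rewrite mul1r.
Qed.

(** By monotonicity of [p], the integral of p (c * u) * u ^ beta over [E, 2 * E] is at least p (c *
    E) * (2 * E) ^ beta * E, which is 2 ^ beta times the quantity considered; and it is bounded by
    the tail of a convergent integral. *)
Let p_small c : (0 < c)%R ->
  (p (c * E k) * E k `^ (- 1 - gamma))%:E @[k --> \oo] --> 0.
Proof.
move=> c0.
pose f (k : nat) (u : R) : \bar R := ((fun u => (p (c * u) * u `^ beta)%:E) \_ `[E k, +oo[%classic) u.
have f_ge0 k u : (0 < u)%R -> 0 <= f k u.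
  by move=> u0; rewrite /f patchE; case: ifPn => // _; exact: pc_ge0.
have hf : \int[mu]_(u in `]0%R, +oo[) f k u @[k --> \oo] --> 0.
  have mI : measurable (`]0%R, +oo[%classic : set R) by [].
  have [|||||_ _] := @dominated_convergence _ _ R mu _ mI f (cst 0)
    (fun u => (p (c * u) * u `^ beta)%:E).
  - move=> k; apply: (measurable_restrict _ _ _).1 => //.
    exact: measurable_funS (mpc c).
  - exact: measurable_cst.
  - apply: aeW => u /=; rewrite in_itv/= andbT => u0; apply: cvg_near_cst.
    have : \forall k \near \oo, (u + 1 <= E k)%R by move/cvgryPge: E_oo; apply.
    apply: filterS => k uk; rewrite /f patchE ifF//.
    apply/negbTE; rewrite notin_setE/= in_itv/= andbT => /(le_trans uk).
    by rewrite leNgt ltrDl ltr01.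
  - apply/integrableP; split; first exact: mpc.
    apply: le_lt_trans (integrable_p c0); rewrite le_eqVlt; apply/orP; left; apply/eqP.
    apply: eq_integral => u; rewrite inE/= in_itv/= andbT => u0; have := pc_ge0 c0 u0.
    by rewrite lee_fin => h0; rewrite ger0_norm.
  - apply: aeW => u k /=; rewrite in_itv/= andbT => u0.
    rewrite gee0_abs ?f_ge0// /f patchE; case: ifPn => // _; exact: pc_ge0.
  by rewrite integral0.
have low k : (2%:R `^ beta)%:E * (p (c * E k) * E k `^ (- 1 - gamma))%:E <=
    \int[mu]_(u in `]0%R, +oo[) f k u.
  have sub : `[E k, (2 * E k)%R]%classic `<=` (`]0%R, +oo[%classic : set R).
    by move=> u /=; rewrite !in_itv/= andbT => /andP[/(lt_le_trans (E0 k))].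
  have mf : measurable_fun (`]0%R, +oo[ : set R) (f k).
    apply: (measurable_restrict _ _ _).1 => //; exact: measurable_funS (mpc c).
  apply: (@le_trans _ _ (\int[mu]_(u in `[E k, (2 * E k)%R]) f k u)); last first.
    by apply: ge0_subset_integral => // u /=; rewrite in_itv/= andbT; exact: f_ge0.
  apply: (@le_trans _ _ (\int[mu]_(u in `[E k, (2 * E k)%R]) (p (c * E k) * (2 * E k) `^ beta)%:E)).
    rewrite integral_cst//= lebesgue_measure_itv/= lte_fin ltr_pMl// ltr1n -EFinB -!EFinM lee_fin.
    rewrite powRM ?(ltW (E0 k))// (_ : 2 * E k - E k = E k)%R; last by ring.
    have -> : (E k `^ (- 1 - gamma) = E k `^ beta * E k)%R.
      have hE : (beta + 1 == 0)%R ==> (E k != 0)%R by rewrite (gt_eqF (E0 k)) implybT.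
      by rewrite -{3}(powRr1 (ltW (E0 k))) -powRD//; congr (_ `^ _)%R; rewrite /beta; ring.
    rewrite le_eqVlt; apply/orP; left; apply/eqP; ring.
  apply: ge0_le_integral => //.
  - move=> u _; rewrite lee_fin mulr_ge0 ?powR_ge0// p_ge0// mulr_ge0// ltW//.
  - exact: measurable_funS mf.
  - move=> u /=; rewrite in_itv/= => /andP[Eu u2]; have u0 := lt_le_trans (E0 k) Eu.
    rewrite /f patchE ifT; last by rewrite inE/= in_itv/= Eu.
    rewrite lee_fin ler_pM ?powR_ge0//.
    + by rewrite p_ge0// mulr_ge0// ltW.
    + rewrite p_nd//; first by rewrite mulr_ge0// ltW.
      by rewrite ler_wpM2l// ltW.
    + have -> : beta = (- (2 + gamma))%R by rewrite /beta; ring.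
      rewrite !powRN lef_pV2 ?posrE ?powR_gt0// ?mulr_gt0//.
      apply: ge0_ler_powR; rewrite ?nnegrE//; first by rewrite addr_ge0// ltW.
      exact: ltW.
      by rewrite mulr_ge0// ltW.
have a0 : (0 < 2%:R `^ beta :> R)%R by rewrite powR_gt0.
have h2 : (2%:R `^ beta)%:E * (p (c * E k) * E k `^ (- 1 - gamma))%:E @[k --> \oo] --> 0.
  apply: (@squeeze_cvge _ _ _ _ (cst 0) _ (fun k => \int[mu]_(u in `]0%R, +oo[) f k u)) => //.
  - apply: nearW => k; rewrite low andbT mule_ge0 ?lee_fin ?powR_ge0//.
    rewrite mulr_ge0 ?powR_ge0// p_ge0// mulr_ge0// ltW//.
  - exact: cvg_cst.
have fin : ((2%:R `^ beta)^-1)%:E \is a @fin_num R by [].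
have := cvgeZl fin h2.
rewrite mule0; apply: cvg_trans; apply: near_eq_cvg; apply: nearW => k.
by rewrite -!EFinM mulrA mulVf ?gt_eqF// mul1r.
Qed.

Let DD : set R := `]0%R, +oo[%classic.
Let mDD : measurable DD. Proof. exact: measurable_itv. Qed.

Let w_ge0 k u : (0 <= w k u)%R. Proof. by rewrite mulr_ge0 ?powR_ge0. Qed.

Let powR_F k : (F k `^ (2 + gamma) * F k `^ beta = 1)%R.
Proof.
have hE : (2 + gamma + beta == 0)%R ==> (F k != 0)%R by rewrite (gt_eqF (F0 k)) implybT.
by rewrite -powRD// (_ : 2 + gamma + beta = 0)%R ?powRr0// /beta; ring.
Qed.

Let w_le k u : (0 < u)%R -> (r0 / F k < u)%R -> (w k u <= D * u `^ beta)%R.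
Proof.
move=> u0; rewrite ltr_pdivrMr// mulrC => hu.
rewrite /w (le_trans (ler_wpM2l (powR_ge0 _ _) (dg_le hu)))//.
by rewrite powRM ?(ltW (F0 k)) ?(ltW u0)// mulrCA (mulrA (F k `^ (2 + gamma))%R) powR_F mul1r.
Qed.

Let mdgF k : measurable_fun DD (fun u => dg (F k * u)).
Proof.
apply: (@measurable_comp _ _ _ _ _ _ DD dg) => //.
by move=> _ [u /= +] <-; rewrite /DD/= !in_itv/= !andbT; exact: mulr_gt0.
Qed.

Let mw k : measurable_fun DD (fun u => (w k u)%:E).
Proof. by apply/measurable_EFinP; exact: measurable_funM. Qed.

Let a k u := G k u * (w k u)%:E.
Let ma k : measurable_fun DD (a k).
Proof. by apply: emeasurable_funM => //; exact: measurable_funTS. Qed.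
Let a_ge0 k u : 0 <= a k u.
Proof. by rewrite mule_ge0// lee_fin. Qed.

(* On [S1] the jumps are controlled by [small_jumps], on [S2] by dominated
   convergence, and on [S3] by the decay of [p v * v `^ (- 1 - gamma)]. *)
Let S1 k : set R := `]-oo, (r0 / F k)%R]%classic.
Let S2 k : set R := `](r0 / F k)%R, E k]%classic.
Let S3 k : set R := `](Num.max (r0 / F k) (E k))%R, +oo[%classic.
Let mrestr_a k (S : set R) : measurable S -> measurable_fun DD (a k \_ S).
Proof.
move=> mS; apply: (measurable_restrict _ _ _).1 => //.
by apply: measurable_funS (ma k) => //; exact: subIsetl.
Qed.
Let restr_a_ge0 k (S : set R) u : 0 <= (a k \_ S) u.
Proof. by rewrite patchE; case: ifPn. Qed.

Let cvg_S1 : \int[mu]_(u in DD) (a k \_ (S1 k)) u @[k --> \oo] --> 0.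
Proof.
(* On this range u / E <= r0, because F and E are at least 1, so the support of the jump has length
   at most tm + r0. *)
have fin : (tm + r0)%:E \is a @fin_num R by [].
have := cvgeZl fin (small_jumps M0); rewrite mule0 => h2.
apply: (@squeeze_cvge _ _ _ _ (cst 0) _ _ _ _ _ h2); last exact: cvg_cst.
apply: nearW => k; apply/andP; split; first exact: integral_ge0.
rewrite -integral_mkcondr.
have -> : DD `&` S1 k = `]0%R, (r0 / F k)%R]%classic.
  by apply/seteqP; split => u; rewrite /DD/S1/= !in_itv/= ?andbT; [move=> [-> ->]|move=> /andP[-> ->]].
have sub : `]0%R, (r0 / F k)%R]%classic `<=` DD.
  by move=> u; rewrite /DD/= !in_itv/= andbT => /andP[].
have mpM : measurable_fun setT (fun u => p (M * u)).
  by apply: (measurableT_comp mp); exact: measurable_funM.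
have mpw : measurable_fun (`]0%R, (r0 / F k)%R] : set R) (fun u => (p (M * u) * w k u)%:E).
  apply/measurable_EFinP; apply: measurable_funM; first exact: measurable_funTS.
  by apply/measurable_EFinP; exact: measurable_funS (mw k).
rewrite -ge0_integralZl//; last 2 first.
- by move=> u /=; rewrite in_itv/= => /andP[u0 _]; rewrite lee_fin mulr_ge0// p_ge0// mulr_ge0// ltW.
- by rewrite lee_fin addr_ge0// ltW.
apply: ge0_le_integral => //.
- exact: measurable_funS (ma k).
- exact: measurable_funeM.
- move=> u /=; rewrite in_itv/= => /andP[u0 ur].
  have Mu0 : (0 <= M * u)%R by rewrite mulr_ge0// ltW.
  have hG : G k u <= (p (M * u) * (tm + u / E k))%:E.
    apply: G_le => //; first exact: ltW.
    by move=> x; rewrite (le_trans (psi_p _))// p_nd// jump_le// ltW.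
  rewrite /a (le_trans (lee_wpmul2r _ hG)) ?lee_fin// mulrAC [leRHS]mulrC ler_wpM2l//.
    by rewrite mulr_ge0// p_ge0.
  rewrite lerD2l ler_pdivrMr// (le_trans ur)// ler_pdivrMr// -mulrA ler_peMr//.
  by rewrite -[1%R]mulr1 ler_pM.
Qed.

Let cvg_S3 : \int[mu]_(u in DD) (a k \_ (S3 k)) u @[k --> \oo] --> 0.
Proof.
(* For u >= E the support length tm + u / E is at most (tm + 1) * u / E, the density is at most D *
   u ^ beta, and the integral of u ^ (beta + 1) over [E, +oo[ is at most E ^ (- gamma) / gamma. *)
have fin : ((tm + 1) * D / gamma)%:E \is a @fin_num R by [].
have c0 : (0 < M * tm)%R by rewrite mulr_gt0.
have := cvgeZl fin (p_small c0); rewrite mule0 => h2.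
apply: (@squeeze_cvge _ _ _ _ (cst 0) _ _ _ _ _ h2); last exact: cvg_cst.
apply: nearW => k; apply/andP; split; first exact: integral_ge0.
rewrite -integral_mkcondr.
have -> : DD `&` S3 k = S3 k.
  apply/seteqP; split => u; first by case.
  move=> Su; split => //; move: Su; rewrite /S3/DD/= !in_itv/= !andbT.
  by rewrite gt_max => /andP[_]; exact: lt_trans.
pose b := (p (M * tm * E k) * (tm + 1) * D / E k)%R.
have pE0 : (0 <= p (M * tm * E k))%R by rewrite p_ge0// mulr_ge0// ltW.
have b0 : (0 <= b)%R by rewrite /b divr_ge0 ?(ltW (E0 k))// !mulr_ge0// addr_ge0// ltW.
have sub : S3 k `<=` `[E k, +oo[%classic.
  by move=> u /=; rewrite /S3/= !in_itv/= !andbT gt_max => /andP[_ /ltW].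
have msub : measurable_fun (`[E k, +oo[ : set R) (fun u => (b * u `^ (beta + 1))%:E).
  apply/measurable_EFinP; apply: measurable_funM => //; apply: measurable_funTS; exact: measurable_powR.
apply: (@le_trans _ _ (\int[mu]_(u in `[E k, +oo[) (b * u `^ (beta + 1))%:E)).
  apply: (@le_trans _ _ (\int[mu]_(u in S3 k) (b * u `^ (beta + 1))%:E)); last first.
    apply: ge0_subset_integral => //; first exact: measurable_itv.
    by move=> u _; rewrite lee_fin mulr_ge0 ?powR_ge0.
  apply: ge0_le_integral => //; first exact: measurable_itv.
  - apply: measurable_funS (ma k) => // u /sub; rewrite /DD/= !in_itv/= !andbT.
    exact: lt_le_trans.
  - exact: measurable_funS msub.
  - move=> u; rewrite /S3/= in_itv/= andbT gt_max => /andP[ru Eu].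
    have u0 : (0 < u)%R by exact: lt_trans Eu.
    have hG : G k u <= (p (M * tm * E k) * (tm + u / E k))%:E.
      apply: G_le => //; [exact: ltW|by rewrite mulr_ge0// ltW|].
      by move=> x; rewrite (le_trans (psi_p _))// p_nd.
    rewrite /a (le_trans (lee_wpmul2r _ hG)) ?lee_fin//.
    have -> : (b * u `^ (beta + 1) = p (M * tm * E k) * ((tm + 1) * (u / E k)) * (D * u `^ beta))%R.
      have hE : (beta + 1 == 0)%R ==> (u != 0)%R by rewrite (gt_eqF u0) implybT.
      by rewrite powRD// powRr1 ?ltW// /b; ring.
    rewrite ler_pM//.
    + by rewrite mulr_ge0// addr_ge0// ?divr_ge0// ltW.
    + rewrite ler_wpM2l// mulrDl mul1r lerD2r ler_peMr ?(ltW tm0)//.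
      by rewrite ler_pdivlMr// mul1r ltW.
    + exact: w_le.
under eq_integral do rewrite EFinM.
rewrite ge0_integralZl//; last 2 first.
- by apply/measurable_EFinP; apply: measurable_funTS; exact: measurable_powR.
- by move=> u _; rewrite lee_fin powR_ge0.
have hb : (beta + 1 < - 1)%R by rewrite /beta; have := gamma0; lra.
apply: (le_trans (lee_wpmul2l _ (integral_powR_ay (E0 k) hb))) => //.
rewrite lee_fin le_eqVlt; apply/orP; left; apply/eqP.
have -> : (E k `^ (beta + 1 + 1) = E k `^ (- 1 - gamma) * E k)%R.
  have hE : (- 1 - gamma + 1 == 0)%R ==> (E k != 0)%R by rewrite (gt_eqF (E0 k)) implybT.
  by rewrite -{3}(powRr1 (ltW (E0 k))) -powRD//; congr (_ `^ _)%R; rewrite /beta; ring.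
have -> : (- (beta + 1 + 1) = gamma)%R by rewrite /beta; ring.
by rewrite /b; field; rewrite (gt_eqF (E0 k)) (gt_eqF gamma0).
Qed.

Let cvg_w u : (0 < u)%R -> w k u @[k --> \oo] --> (Cg * u `^ beta)%R.
Proof.
move=> u0.
have h1 : (F k * u)%R @[k --> \oo] --> +oo%R.
  apply/cvgryPge => A; have : \forall k \near \oo, (A / u <= F k)%R by move/cvgryPge: F_oo; apply.
  by apply: filterS => k; rewrite ler_pdivrMr.
have := cvg_comp _ _ h1 dg_tail => h2.
have h3 : ((F k * u) `^ (2 + gamma) * dg (F k * u) * u `^ beta)%R @[k --> \oo] --> (Cg * u `^ beta)%R.
  by apply: cvgMr_tmp; exact: h2.
apply: cvg_trans h3; apply: near_eq_cvg; apply: nearW => k.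
rewrite powRM ?(ltW (F0 k)) ?(ltW u0)// /w -!mulrA; congr (_ * _)%R.
have hE : (2 + gamma + beta == 0)%R ==> (u != 0)%R by rewrite (gt_eqF u0) implybT.
by rewrite mulrCA -powRD// (_ : 2 + gamma + beta = 0)%R ?powRr0 ?mulr1// /beta; ring.
Qed.

Let Glim u := \int[mu]_x (psi (u * h x))%:E.

Let mGlim : measurable_fun setT Glim.
Proof.
have mf : measurable_fun setT (fun z : R * R => (psi (z.1 * h z.2))%:E).
  apply/measurable_EFinP; apply: (measurableT_comp mpsi); apply: measurable_funM.
    exact: measurable_fst.
  by apply: (measurableT_comp mh); exact: measurable_snd.
have f0 z : 0 <= (fun z : R * R => (psi (z.1 * h z.2))%:E) z by rewrite lee_fin.
exact: (@measurable_fun_fubini_tonelli_F _ _ _ _ _ mu _ mf f0).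
Qed.

Let cvg_S2 : \int[mu]_(u in DD) (a k \_ (S2 k)) u @[k --> \oo] -->
  \int[mu]_(u in DD) (Glim u * (Cg * u `^ beta)%:E).
Proof.
(* For u <= E the support length tm + u / E is at most tm + 1; the factor D comes from the power
   bound on the density. *)
pose C := (D * (tm + 1))%R.
have C0 : (0 <= C)%R by rewrite mulr_ge0// addr_ge0// ltW.
have [|||||_ _ //] := @dominated_convergence _ _ R mu DD mDD (fun k => a k \_ (S2 k))
  (fun u => Glim u * (Cg * u `^ beta)%:E) (fun u => C%:E * (p (M * u) * u `^ beta)%:E).
- by move=> k; apply: mrestr_a; exact: measurable_itv.
- apply: emeasurable_funM; first exact: measurable_funTS.
  apply/measurable_EFinP; apply: measurable_funM => //; apply: measurable_funTS.
  exact: measurable_powR.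
- apply: aeW => u; rewrite /DD/= in_itv/= andbT => u0.
  have [fG cG] := cvg_G u0.
  have h1 : a k u @[k --> \oo] --> Glim u * (Cg * u `^ beta)%:E.
    apply: cvgeM => //; first by rewrite mule_def_fin.
    by apply: cvg_EFin; [exact: nearW|exact: cvg_w].
  apply: cvg_trans h1; apply: near_eq_cvg.
  have near1 : \forall k \near \oo, (u <= E k)%R by move/cvgryPge: E_oo; apply.
  have near2 : \forall k \near \oo, (r0 / u < F k)%R by move/cvgryPgt: F_oo; apply.
  apply: filterS2 near1 near2 => k uE; rewrite ltr_pdivrMr// mulrC -ltr_pdivrMr// => ru.
  by rewrite patchE ifT// inE /S2/= in_itv/= ru.
- apply/integrableP; split; first by apply: measurable_funeM; exact: mpc.
  apply: (@le_lt_trans _ _ (C%:E * \int[mu]_(u in DD) (p (M * u) * u `^ beta)%:E)); last first.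
    by rewrite lte_mul_pinfty// ?lee_fin//; exact: integrable_p.
  rewrite -ge0_integralZl//; last 2 first.
  + exact: mpc.
  + by move=> u; rewrite /DD/= in_itv/= andbT; exact: pc_ge0.
  rewrite le_eqVlt; apply/orP; left; apply/eqP; apply: eq_integral => u uD.
  have u0 : (0 < u)%R by move: uD; rewrite inE /DD/= in_itv/= andbT.
  by rewrite gee0_abs// mule_ge0 ?pc_ge0// lee_fin.
- apply: aeW => u k; rewrite /DD/= in_itv/= andbT => u0.
  rewrite gee0_abs// patchE; case: ifPn => [|_]; last first.
    by rewrite mule_ge0// pc_ge0.
  rewrite inE /S2/= in_itv/= => /andP[ru uE].
  have Mu0 : (0 <= M * u)%R by rewrite mulr_ge0// ltW.
  have hG : G k u <= (p (M * u) * (tm + u / E k))%:E.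
    apply: G_le => //; first exact: ltW.
    by move=> x; rewrite (le_trans (psi_p _))// p_nd// jump_le// ltW.
  rewrite /a (le_trans (lee_wpmul2r _ hG)) ?lee_fin//.
  have -> : (C * (p (M * u) * u `^ beta) = (p (M * u) * (tm + 1)) * (D * u `^ beta))%R.
    by rewrite /C; ring.
  rewrite ler_pM//.
  + by rewrite mulr_ge0 ?p_ge0// addr_ge0 ?(ltW tm0)// divr_ge0// ltW.
  + by rewrite ler_wpM2l ?p_ge0// lerD2l ler_pdivrMr// mul1r.
  + exact: w_le.
Qed.

(** The substitutions x = T * x' and r = F * u with T = F * E; their Jacobian T * F is absorbed into
    [w]. *)
Let rescale k :
  \int[mu]_(r in `]0%R, +oo[) ((\int[mu]_x
      (psi (\sum_j (th j / F k) * overlap (F k `^ (1 + gamma) * t j) r x)%R)%:E) * (dg r)%:E) =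
  \int[mu]_(u in DD) a k u.
Proof.
pose T := (F k * E k)%R.
have T0 : (0 < T)%R by rewrite mulr_gt0.
have TE : (F k `^ (1 + gamma) = T)%R.
  have hE : (1 + gamma == 0)%R ==> (F k != 0)%R by rewrite (gt_eqF (F0 k)) implybT.
  by rewrite powRD// powRr1// ltW.
have I r : \int[mu]_x (psi (\sum_j (th j / F k) * overlap (F k `^ (1 + gamma) * t j) r x)%R)%:E
    = T%:E * G k (r / F k).
  rewrite (ge0_integral_affine 0%R T0); last by move=> x; rewrite lee_fin.
    congr (_ * _); apply: eq_integral => x _; congr (psi _)%:E; apply: eq_bigr => j _.
    have -> : r = (T * (r / F k / E k))%R.
      by rewrite /T; field; rewrite (gt_eqF (E0 k)) (gt_eqF (F0 k)).
    rewrite addr0 TE overlapM ?ltW//.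
    have -> : (T * (r / F k / E k) / F k / E k = r / F k / E k)%R.
      by rewrite /T; field; rewrite (gt_eqF (E0 k)) (gt_eqF (F0 k)).
    by rewrite /T; field; rewrite (gt_eqF (F0 k)).
  apply/measurable_EFinP; apply: (measurableT_comp mpsi); apply: measurable_sum => j.
  by apply: measurable_funM => //; exact: measurable_overlap.
transitivity (\int[mu]_(r in `]0%R, +oo[) ((T%:E * G k (r / F k)) * (dg r)%:E)).
  by apply: eq_integral => r _; rewrite I.
rewrite (ge0_integral_itv0y_scale (F0 k)).
- rewrite -ge0_integralZl//; last 3 first.
  + apply: emeasurable_funM.
      apply: measurable_funTS; apply: measurable_funeM; apply: (measurableT_comp (mG k)).
      by apply: measurable_funM => //; exact: measurable_funM.
    by apply/measurable_EFinP; exact: mdgF.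
  + by move=> u _; rewrite mule_ge0 ?lee_fin// mule_ge0// lee_fin ltW.
  + by rewrite lee_fin ltW.
  apply: eq_integral => u _; rewrite (mulrC (F k)) mulfK ?gt_eqF//.
  rewrite !muleA muleAC muleC -!EFinM; congr (_ * _%:E).
  have hE : (1 + (1 + gamma) == 0)%R ==> (F k != 0)%R by rewrite (gt_eqF (F0 k)) implybT.
  rewrite /w (_ : 2 + gamma = 1 + (1 + gamma))%R; last by ring.
  by rewrite powRD// TE powRr1 ?ltW// (mulrC u) mulrA.
- apply: emeasurable_funM; last exact/measurable_EFinP.
  apply: measurable_funTS; apply: measurable_funeM; apply: (measurableT_comp (mG k)).
  exact: measurable_funM.
- by move=> u _; rewrite mule_ge0 ?lee_fin// mule_ge0// lee_fin ltW.
Qed.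

(** Squeeze: the middle range alone is a lower bound, and the sum over the three ranges an upper
    bound whose outer terms vanish. When r0 / F exceeds E the middle range is empty, and starting
    the last one at the maximum of both keeps the density bound valid on it. *)
Lemma cvg_scaling_limit :
  \int[mu]_(r in `]0%R, +oo[) ((\int[mu]_x
      (psi (\sum_j (th j / F k) * overlap (F k `^ (1 + gamma) * t j) r x)%R)%:E) * (dg r)%:E)
    @[k --> \oo] -->
  \int[mu]_(u in `]0%R, +oo[) ((\int[mu]_x
      (psi (u * \sum_j th j * \1_([set y | (0 <= y < t j)%R]) x)%R)%:E) * (Cg * u `^ (- 2 - gamma))%:E).
Proof.
under eq_cvg do rewrite rescale.
have upper : \int[mu]_(u in DD) (a k \_ (S2 k)) u +
    (\int[mu]_(u in DD) (a k \_ (S1 k)) u + \int[mu]_(u in DD) (a k \_ (S3 k)) u) @[k --> \oo] -->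
    \int[mu]_(u in DD) (Glim u * (Cg * u `^ beta)%:E).
  rewrite -[X in _ --> X]adde0; apply: cvgeD; first by rewrite fin_num_adde_defl.
    exact: cvg_S2.
  by rewrite -[X in _ --> X]adde0; apply: cvgeD.
apply: (squeeze_cvge _ cvg_S2 upper); apply: nearW => k; apply/andP; split.
  apply: ge0_le_integral => //.
  - by apply: mrestr_a; exact: measurable_itv.
  - exact: ma.
  - by move=> u _; rewrite patchE; case: ifPn.
have m1 : measurable_fun DD (a k \_ (S1 k)) by apply: mrestr_a; exact: measurable_itv.
have m2 : measurable_fun DD (a k \_ (S2 k)) by apply: mrestr_a; exact: measurable_itv.
have m3 : measurable_fun DD (a k \_ (S3 k)) by apply: mrestr_a; exact: measurable_itv.
have p0 (S S' : set R) u : 0 <= (a k \_ S) u + (a k \_ S') u by rewrite adde_ge0.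
rewrite -ge0_integralD// -ge0_integralD//; last exact: emeasurable_funD.
apply: ge0_le_integral => //; first exact: ma.
  by apply: emeasurable_funD => //; exact: emeasurable_funD.
move=> u _; have [u1|u1] := leP u (r0 / F k)%R.
  have -> : (a k \_ (S1 k)) u = a k u by rewrite patchE ifT// inE /S1/= in_itv/= u1.
  by rewrite addeCA leeDl// adde_ge0.
have [u2|u2] := leP u (E k).
  have -> : (a k \_ (S2 k)) u = a k u by rewrite patchE ifT// inE /S2/= in_itv/= u1.
  by rewrite leeDl// adde_ge0.
have -> : (a k \_ (S3 k)) u = a k u by rewrite patchE ifT// inE /S3/= in_itv/= andbT gt_max u1.
by rewrite addeA leeDr// adde_ge0.
Qed.

End scaling_limit.

(** * Factorization of the limit exponent *)

Section scaling_constant.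
Context {R : realType} (psi : R -> R) (gamma : R).
Notation mu := (@lebesgue_measure R).
Hypotheses (gamma0 : 0 < gamma) (mpsi : measurable_fun setT psi)
  (psi_ge0 : forall u, 0 <= psi u) (psi0 : psi 0 = 0) (psi_norm : forall u, psi `|u| = psi u).
Local Open Scope ereal_scope.
Let I := \int[mu]_(u in `]0%R, +oo[) (psi u * u `^ (- 2 - gamma))%:E.

(** The substitution u -> |a| * u, with psi even: the measure u ^ (- 2 - gamma) du is homogeneous of
    degree - 1 - gamma, which is where the stable index comes from. *)
Let integral_dilation (a : R) :
  \int[mu]_(u in `]0%R, +oo[) (psi (u * a) * u `^ (- 2 - gamma))%:E = (`|a| `^ (1 + gamma))%:E * I.
Proof.
have [->|a0] := eqVneq a 0%R.
  rewrite normr0 powR0 ?mul0e; last by rewrite gt_eqF// addr_gt0.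
  by apply: integral0_eq => u _; rewrite mulr0 psi0 mul0r.
have a_gt0 : (0 < `|a|)%R by rewrite normr_gt0.
have mf (c : R) : measurable_fun (`]0%R, +oo[ : set R) (fun u => (psi (c * u) * u `^ (- 2 - gamma))%:E).
  apply/measurable_EFinP; apply: measurable_funTS; apply: measurable_funM; last exact: measurable_powR.
  by apply: (measurableT_comp mpsi); exact: measurable_funM.
rewrite /I [X in _ = _ * X](ge0_integral_itv0y_scale a_gt0); last 2 first.
- by apply: eq_measurable_fun (mf 1%R) => u _; rewrite mul1r.
- by move=> u _; rewrite lee_fin mulr_ge0 ?powR_ge0.
rewrite muleA -EFinM -ge0_integralZl//; last 2 first.
- apply/measurable_EFinP; apply: measurable_funTS; apply: measurable_funM.
    by apply: (measurableT_comp mpsi); exact: measurable_funM.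
  by apply: (measurableT_comp (@measurable_powR R _)); exact: measurable_funM.
- by move=> u _; rewrite lee_fin mulr_ge0 ?powR_ge0.
apply: eq_integral => u; rewrite inE/= in_itv/= andbT => u0; rewrite -EFinM; congr EFin.
rewrite powRM ?(ltW u0)// -psi_norm normrM (gtr0_norm u0) (mulrC u).
have hE : (1 + (1 + gamma) == 0)%R ==> (`|a| != 0)%R by rewrite (gt_eqF a_gt0) implybT.
have E1 : (`|a| `^ (1 + gamma) * `|a| = `|a| `^ (1 + (1 + gamma)))%R.
  by rewrite (powRD hE) powRr1// mulrC.
have E2 : (`|a| `^ (1 + (1 + gamma)) * `|a| `^ (- 2 - gamma) = 1)%R.
  have hE' : (1 + (1 + gamma) + (- 2 - gamma) == 0)%R ==> (`|a| != 0)%R.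
    by rewrite (gt_eqF a_gt0) implybT.
  by rewrite -powRD// (_ : 1 + (1 + gamma) + (- 2 - gamma) = 0)%R ?powRr0//; ring.
by rewrite -[LHS]mul1r -[X in (X * _ = _)%R]E2 -E1; ring.
Qed.

(** Tonelli's theorem moves the u-integral inside, where the dilation with a = h x separates the two
    variables. *)
Lemma integral_scaling_limit (h : R -> R) (c : R) : measurable_fun setT h -> (0 <= c)%R ->
  \int[mu]_(u in `]0%R, +oo[) ((\int[mu]_x (psi (u * h x))%:E) * (c * u `^ (- 2 - gamma))%:E) =
  c%:E * I * \int[mu]_x (`|h x| `^ (1 + gamma))%:E.
Proof.
move=> mh c0.
pose k (u : R) : R := (c * u `^ (- 2 - gamma) * \1_(`]0%R, +oo[%classic : set R) u)%R.
have mi : measurable_fun setT (\1_(`]0%R, +oo[%classic : set R) : R -> R) by exact: measurable_indic.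
have mk : measurable_fun setT k.
  by apply: measurable_funM => //; apply: measurable_funM => //; exact: measurable_powR.
have k0 u : (0 <= k u)%R by rewrite !mulr_ge0// powR_ge0.
pose f (z : R * R) : \bar R := (psi (z.1 * h z.2) * k z.1)%:E.
have m1 : measurable_fun setT (fun z : R * R => z.1) by exact: measurable_fst.
have m2 : measurable_fun setT (fun z : R * R => h z.2) by apply: (measurableT_comp mh); exact: measurable_snd.
have mf : measurable_fun setT f.
  apply/measurable_EFinP; apply: measurable_funM; last exact: (measurableT_comp mk).
  by apply: (measurableT_comp mpsi); exact: measurable_funM.
have f0 z : 0 <= f z by rewrite lee_fin mulr_ge0.
transitivity (\int[mu]_u fubini_F mu f u).
  rewrite integral_mkcond; apply: eq_integral => u _; rewrite patchE /fubini_F /f/=.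
  have mpu : measurable_fun setT (fun x => (psi (u * h x))%:E).
    by apply/measurable_EFinP; apply: (measurableT_comp mpsi); exact: measurable_funM.
  under [RHS]eq_integral do rewrite EFinM muleC.
  rewrite ge0_integralZl ?lee_fin//; last by move=> x _; rewrite lee_fin.
  rewrite /k indicE; case: (u \in _); rewrite ?mulr1 ?mulr0 ?mul0e//.
  by rewrite muleC.
rewrite (@fubini_tonelli _ _ _ _ _ mu mu f mf)//.
have I0 : 0 <= I by apply: integral_ge0 => u _; rewrite lee_fin mulr_ge0 ?powR_ge0.
have mp : measurable_fun setT (fun x => (`|h x| `^ (1 + gamma))%:E).
  apply/measurable_EFinP; apply: (measurableT_comp (@measurable_powR R _)).
  exact: (measurableT_comp (@normr_measurable R setT)).
rewrite -ge0_integralZl//; last by rewrite mule_ge0 ?lee_fin.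
apply: eq_integral => x _; rewrite /fubini_G /f/=.
rewrite -muleA (muleC I) -integral_dilation -ge0_integralZl//.
- rewrite [RHS]integral_mkcond; apply: eq_integral => u _; rewrite patchE /k indicE.
  case: (u \in _); rewrite ?mulr1 ?mulr0// -EFinM; congr EFin; ring.
- apply/measurable_EFinP; apply: measurable_funTS; apply: measurable_funM; last exact: measurable_powR.
  by apply: (measurableT_comp mpsi); exact: measurable_funM.
- by move=> u _; rewrite lee_fin mulr_ge0 ?powR_ge0.
Qed.

(** By continuity psi exceeds psi u / 2 on a nondegenerate segment [a, u]; a >= u / 2 keeps it away
    from 0, so the power weight is bounded below there. *)
Lemma scaling_constant_gt0 : continuous psi -> (exists2 u, (0 < u)%R & (0 < psi u)%R) -> 0 < I.
Proof.
move=> cpsi [u u0 pu].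
have /cvgrPdist_lt /(_ (psi u / 2)%R) := cpsi u.
rewrite divr_gt0// => /(_ isT) /nbhs_ballP[e /= e0 he].
pose a := Num.max (u - e / 2)%R (u / 2)%R.
have au : (a < u)%R by rewrite gt_max ltrBlDr ltrDl divr_gt0//= ltr_pdivrMr// ltr_pMr// ltr1n.
have a0 : (0 < a)%R by rewrite lt_max [X in _ || X]divr_gt0// orbT.
pose m := (psi u / 2 * Num.min (a `^ (- 2 - gamma)) (u `^ (- 2 - gamma)))%R.
have m0 : (0 < m)%R by rewrite mulr_gt0 ?divr_gt0// lt_min !powR_gt0.
have sub : `[a, u]%classic `<=` (`]0%R, +oo[%classic : set R).
  by move=> v /=; rewrite !in_itv/= andbT => /andP[/(lt_le_trans a0)].
have mpw : measurable_fun setT (fun v => (psi v * v `^ (- 2 - gamma))%:E).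
  by apply/measurable_EFinP; apply: measurable_funM => //; exact: measurable_powR.
apply: (@lt_le_trans _ _ (\int[mu]_(v in `[a, u]) m%:E)).
  rewrite integral_cst//= lebesgue_measure_itv/= lte_fin au -EFinB -EFinM lte_fin.
  by rewrite mulr_gt0// subr_gt0.
apply: (@le_trans _ _ (\int[mu]_(v in `[a, u]) (psi v * v `^ (- 2 - gamma))%:E)); last first.
  apply: ge0_subset_integral => //; first exact: measurable_funTS.
  by move=> v _; rewrite lee_fin mulr_ge0 ?powR_ge0.
apply: ge0_le_integral => //.
- by move=> v _; rewrite lee_fin ltW.
- exact: measurable_funTS.
- move=> v /=; rewrite in_itv/= => /andP[av vu]; have v0 := lt_le_trans a0 av.
  rewrite lee_fin /m ler_pM ?divr_ge0 ?(ltW pu)//.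
  + by rewrite le_min !powR_ge0.
  + have : ball u e v.
      rewrite /ball/= ger0_norm ?subr_ge0// ltrBlDr.
      have : (u - e / 2 <= v)%R by rewrite (le_trans _ av)// le_max lexx.
      by move: e0; lra.
    by move=> /he; rewrite /= ltr_norml => /andP[_]; lra.
  + rewrite ge_min; apply/orP; right.
    have E w : (w `^ (- 2 - gamma) = (w `^ (2 + gamma))^-1)%R by rewrite -powRN; congr (_ `^ _)%R; ring.
    rewrite !E lef_pV2 ?posrE ?powR_gt0//.
    by apply: ge0_ler_powR; rewrite ?nnegrE ?addr_ge0// ltW.
Qed.

End scaling_constant.

(** * From the scaling limit to finite-dimensional laws *)

Section trawl_limit.
Context {R : realType} d (Omega : measurableType d) (P : probability Omega R)
  (nu : {measure set R -> \bar R}) (Lambda : set (R * R) -> {RV P >-> R})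
  (gamma : R) (g : R -> R) (X : R -> Omega -> R).
Hypotheses (hnu : symmetric_levy_measure nu) (hnu0 : nu setT <> 0%E)
  (hLambda : homogeneous_levy_basis nu Lambda)
  (gamma0 : 0 < gamma) (hg : trawl_function gamma g) (hX : trawl_process Lambda g X).
Notation psi := (levy_exponent nu).
Notation mu := (@lebesgue_measure R).
Variables (p : R -> R) (D r0 : R).
Hypotheses (D0 : 0 <= D) (r00 : 0 <= r0).
Hypotheses (mp : measurable_fun setT p) (p_nd : forall u v, 0 <= u -> u <= v -> p u <= p v)
  (psi_p : forall u, psi u <= p `|u|)
  (p_fin : (\int[mu]_(u in `]0%R, +oo[) (p u * u `^ (- 2 - gamma))%:E < +oo)%E)
  (dg_le : forall r, r0 < r -> `|derive1 g r| <= D * r `^ (- 2 - gamma))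
  (small_jumps : forall F : nat -> R, (forall k, 1 <= F k) -> F k @[k --> \oo] --> +oo ->
    forall c : R, 0 < c ->
    (\int[mu]_(u in `]0%R, (r0 / F k)%R])
      (p (c * u) * (F k `^ (2 + gamma) * `|derive1 g (F k * u)|))%:E @[k --> \oo] --> 0)%E).

(* [p] is a nondecreasing majorant of the exponent: in case (ii) the exponent
   itself, with [r0 = 0], in case (i) the given minimum of powers. *)
Let mpsi : measurable_fun setT psi. Proof. exact: measurable_levy_exponent. Qed.
Let I := (\int[mu]_(u in `]0%R, +oo[) (psi u * u `^ (- 2 - gamma))%:E)%E.

Let I_fin : (I < +oo)%E.
Proof.
have mf (q : R -> R) : measurable_fun setT q ->
    measurable_fun (`]0%R, +oo[ : set R) (fun u => (q u * u `^ (- 2 - gamma))%:E).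
  move=> mq; apply/measurable_EFinP; apply: measurable_funTS; exact: measurable_funM.
apply: le_lt_trans p_fin; apply: ge0_le_integral => //.
- by move=> u _; rewrite lee_fin mulr_ge0 ?levy_exponent_ge0 ?powR_ge0.
- exact: mf.
- exact: mf.
- move=> u; rewrite /= in_itv/= andbT => u0; rewrite lee_fin ler_wpM2r ?powR_ge0//.
  by rewrite (le_trans (psi_p u))// gtr0_norm.
Qed.

Let I_gt0 : (0 < I)%E.
Proof.
apply: scaling_constant_gt0 => //; first exact: levy_exponent_ge0.
- exact: continuous_levy_exponent.
- exact: levy_exponent_gt0.
Qed.

Lemma fdd_cvg_trawl : exists2 K : R, 0 < K &
  forall d' (Omega' : measurableType d') (P' : probability Omega' R) (xi : R -> {RV P' >-> R}),
    symmetric_stable_levy_process (1 + gamma) xi ->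
    fdd_cvg P P' (normalized_integral gamma X) (fun t w => K * xi t w).
Proof.
have [Cg Cg0 hCg] := trawl_derive_tail hg.
have b0 : 0 < 1 + gamma by rewrite addr_gt0.
have fI0 : 0 < fine I by rewrite fine_gt0// I_gt0.
have IE : I = (fine I)%:E by rewrite fineK// ge0_fin_numE// ltW.
(* Chosen so that K ^ (1 + gamma) = Cg * I, the factor in front of the stable exponent in the
   limit. *)
pose K := (Cg * fine I) `^ (1 + gamma)^-1.
have K0 : 0 < K by rewrite powR_gt0// mulr_gt0.
have Kb : K `^ (1 + gamma) = Cg * fine I.
  by rewrite /K -powRrM mulVf ?gt_eqF// powRr1// mulr_ge0// ltW.
exists K => // d' Omega' P' xi hxi n t t0 f cf [M fM].
(* The limit at infinity is tested along arbitrary sequences, the setting of dominated convergence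
   and of the continuity theorem. *)
apply/cvge_pinftyP => T T_oo.
(* The truncation gives F k >= 1 for every k; as soon as T k >= 1 this is the true normalization and
   F k ^ (1 + gamma) = T k. *)
pose F k := Num.max 1 (T k `^ (1 / (1 + gamma))).
have F1 k : 1 <= F k by rewrite le_max lexx.
have F0 k : 0 < F k by exact: lt_le_trans (F1 k).
have F_oo : F k @[k --> \oo] --> +oo.
  have q0 : 0 < 1 / (1 + gamma) by rewrite divr_gt0.
  apply/cvgryPge => A; have /cvgryPge /(_ A) := powR_cvgy q0 T_oo.
  by apply: filterS => k; rewrite le_max => ->; rewrite orbT.
pose V k j := F k `^ (1 + gamma) * t j.
have V0 k j : 0 <= V k j by rewrite mulr_ge0 ?powR_ge0.
pose Y k i w := (F k)^-1 * \int[mu]_(s in `[0, V k i]) X s w.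
have FT : \forall k \near \oo, F k = T k `^ (1 / (1 + gamma)) /\ F k `^ (1 + gamma) = T k.
  have : \forall k \near \oo, 1 <= T k by move/cvgryPge : T_oo; apply.
  apply: filterS => k T1; have T0 : 0 <= T k by exact: le_trans T1.
  have -> : F k = T k `^ (1 / (1 + gamma)).
    by rewrite /F max_r// -[leLHS](powRr0 (T k)) ler_powR// divr_ge0// ltW.
  by split=> //; rewrite -powRrM mul1r mulVf ?gt_eqF// powRr1.
have mY k i : measurable_fun setT (Y k i).
  by apply: measurable_funM => //; exact: (measurable_trawl_integral hX).
have mZ i : measurable_fun setT (fun w => K * xi (t i) w) by exact: measurable_funM.
have [tau [tau0 tau_nd tau_t]] := exists_partition t0.
pose S th := \sum_(0 <= i < n) `|weight t tau th i| `^ (1 + gamma) * (tau i.+1 - tau i).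
have cf_Y th k := charfun_trawl_integrals hnu hLambda gamma0 hg hX I_fin (fun j => th j / F k) (V0 k).
have YE th k w : \sum_i th i * Y k i w = \sum_j th j / F k * \int[mu]_(s in `[0, V k j]) X s w.
  by apply: eq_bigr => j _; rewrite /Y mulrA.
have lim_psi th : (fine (\int[(mu \x mu)%E]_q (psi (\sum_j th j / F k * occupation g (V k j) q))%:E))
    @[k --> \oo] --> K `^ (1 + gamma) * S th.
  have mh : measurable_fun setT (fun x => \sum_j th j * \1_([set y | (0 <= y < t j)%R]) x : R).
    apply: measurable_sum => j; apply: measurable_funM => //; apply: measurable_indic.
    by have := @measurable_itv R `[0%R, t j[; rewrite set_itvE.
  have mdg : measurable_fun (`]0, +oo[ : set R) (fun r => `|derive1 g r|).
    by apply: (measurableT_comp (@normr_measurable R setT)); exact: (measurable_trawl_derive hg).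
  have h := cvg_scaling_limit gamma0 D0 r00 mpsi (levy_exponent_ge0 nu) (levy_exponent0 nu) mp p_nd psi_p
    p_fin mdg (fun r => normr_ge0 _) hCg dg_le F1 F_oo (small_jumps F1 F_oo) t0 (th := th).
  apply: fine_cvg.
  move: h; rewrite (integral_scaling_limit gamma0 mpsi (levy_exponent_ge0 nu) (levy_exponent0 nu) (levy_exponent_norm nu) mh (ltW Cg0)).
  rewrite (integral_powR_step tau0 tau_nd tau_t); last by rewrite gt_eqF.
  rewrite -/I IE -!EFinM -Kb; apply: cvg_trans; apply: near_eq_cvg; apply: nearW => k.
  by rewrite (integral_occupation hg _ mpsi (levy_exponent_ge0 nu) (levy_exponent0 nu) (V0 k)).
have hcos th : \int[P]_w cos (\sum_i th i * Y k i w) @[k --> \oo] -->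
    \int[P']_w cos (\sum_i th i * (K * xi (t i) w)).
  have [-> _] := charfun_stable_fdd hxi tau0 tau_nd tau_t th K0.
  apply: (@cvg_trans _ (expR (- fine (\int[(mu \x mu)%E]_q (psi (\sum_j th j / F k * occupation g (V k j) q))%:E)) @[k --> \oo])).
    apply: near_eq_cvg; apply: nearW => k.
    by under eq_Rintegral do rewrite YE; rewrite (cf_Y th k).1.
  have ca : - fine (\int[(mu \x mu)%E]_q (psi (\sum_j th j / F k * occupation g (V k j) q))%:E)
      @[k --> \oo] --> - (K `^ (1 + gamma) * S th) by exact: (cvgN (lim_psi th)).
  apply: (cvg_comp _ _ ca); exact: continuous_expR.
have hsin th : \int[P]_w sin (\sum_i th i * Y k i w) @[k --> \oo] -->
    \int[P']_w sin (\sum_i th i * (K * xi (t i) w)).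
  have [_ ->] := charfun_stable_fdd hxi tau0 tau_nd tau_t th K0.
  apply: cvg_near_cst; apply: nearW => k.
  by under eq_Rintegral do rewrite YE; rewrite (cf_Y th k).2.
have := levy_continuity mY mZ hcos hsin cf fM.
apply: cvg_trans; apply: near_eq_cvg; apply: filterS FT => k [FTk FbT].
congr ('E_P[_])%E; apply/funext => w; congr f; apply/rowP => i; rewrite !mxE.
by rewrite /normalized_integral /Y /V FbT FTk.
Qed.

End trawl_limit.

(** * Power majorants *)

Section power_majorant.
Context {R : realType} (gamma : R) (g : R -> R).
Hypotheses (gamma0 : 0 < gamma) (hg : trawl_function gamma g).
Notation mu := (@lebesgue_measure R).

(** Beyond some r0 the quantity r ^ (2 + gamma) * |g' r| is within 1 of its limit, hence D = Cg +
    1. *)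
Lemma trawl_derive_tail_bound : exists D r0, [/\ 0 <= D, 0 <= r0 &
  forall r, r0 < r -> `|derive1 g r| <= D * r `^ (- 2 - gamma)].
Proof.
have [Cg Cg0 /cvgrPdist_lt /(_ 1 ltr01) [M [Mr hM]]] := trawl_derive_tail hg.
exists (Cg + 1), (Num.max M 0); split; [by rewrite addr_ge0// ltW|by rewrite le_max lexx orbT|].
move=> r; rewrite gt_max => /andP[/hM/= h r0].
have E : r `^ (- 2 - gamma) = (r `^ (2 + gamma))^-1 by rewrite -powRN; congr (_ `^ _); ring.
rewrite E ler_pdivlMr ?powR_gt0// mulrC.
by move: h; rewrite ltr_norml => /andP[h _]; move: h; lra.
Qed.

Variables (kappa alpha C : R).
Hypotheses (kappa_gt : 1 + gamma < kappa) (alpha0 : 0 <= alpha) (alpha_lt : alpha < 1 + gamma)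
  (C0 : 0 < C).

Definition power_majorant (u : R) : R := C * Num.min (`|u| `^ kappa) (`|u| `^ alpha).
Let p := power_majorant.

Let kappa0 : 0 <= kappa. Proof. by move: kappa_gt gamma0; lra. Qed.

Let p_ge0 u : 0 <= p u.
Proof. by rewrite /p /power_majorant mulr_ge0 ?(ltW C0)// le_min !powR_ge0. Qed.

Let p_le_kappa u : 0 <= u -> p u <= C * u `^ kappa.
Proof.
by move=> u0; rewrite /p /power_majorant ler_wpM2l ?(ltW C0)// ger0_norm// ge_min lexx.
Qed.

Let p_le_alpha u : 0 <= u -> p u <= C * u `^ alpha.
Proof.
by move=> u0; rewrite /p /power_majorant ler_wpM2l ?(ltW C0)// ger0_norm// ge_min lexx orbT.
Qed.

Lemma power_majorant_nd u v : 0 <= u -> u <= v -> p u <= p v.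
Proof.
move=> u0 uv; have v0 := le_trans u0 uv; rewrite /p /power_majorant ler_wpM2l ?(ltW C0)// !ger0_norm//.
by rewrite le_min !ge_min !ge0_ler_powR ?nnegrE// orbT.
Qed.

Lemma measurable_power_majorant : measurable_fun setT p.
Proof.
apply: measurable_funM => //; apply: measurable_minr;
  exact: (measurableT_comp (@measurable_powR R _) (@normr_measurable R setT)).
Qed.

Let powRD_pos (u r s : R) : 0 < u -> u `^ r * u `^ s = u `^ (r + s).
Proof.
move=> u0; have hE : (r + s == 0) ==> (u != 0) by rewrite (gt_eqF u0) implybT.
by rewrite powRD.
Qed.

(** Split at 1: near 0 the power [kappa] gives an exponent kappa - 2 - gamma > - 1, and at infinity
    the power [alpha] gives alpha - 2 - gamma < - 1. *)
Lemma power_majorant_fin :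
  (\int[mu]_(u in `]0%R, +oo[) (p u * u `^ (- 2 - gamma))%:E < +oo)%E.
Proof.
have mq (A : set R) q : measurable_fun A (fun u : R => (C * u `^ q)%:E).
  by apply/measurable_EFinP; apply: measurable_funM => //; apply: measurable_funTS; exact: measurable_powR.
have mf (A : set R) : measurable_fun A (fun u => (p u * u `^ (- 2 - gamma))%:E).
  apply/measurable_EFinP; apply: measurable_funTS; apply: measurable_funM; last exact: measurable_powR.
  exact: measurable_power_majorant.
have -> : `]0%R, +oo[%classic = `]0%R, 1%R]%classic `|` `]1%R, +oo[%classic :> set R.
  apply/seteqP; split => u /=; rewrite !in_itv/= !andbT.
    by move=> u0; have [u1|u1] := leP u 1; [left; rewrite u0|right].
  by move=> [/andP[]//|]; exact: lt_trans.
rewrite ge0_integral_setU//; last 3 first.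
- exact: mf.
- by move=> u _; rewrite lee_fin mulr_ge0 ?powR_ge0.
- rewrite disj_set2E; apply/eqP/seteqP; split => u //= []; rewrite !in_itv/= andbT => /andP[_ u1].
  by rewrite ltNge u1.
apply: lte_add_pinfty.
  apply: (@le_lt_trans _ _ (\int[mu]_(u in `]0%R, 1%R]) (C * u `^ (kappa + (- 2 - gamma)))%:E)%E).
    apply: ge0_le_integral => //; [|exact: mf|exact: mq|].
    - by move=> u _; rewrite lee_fin mulr_ge0 ?powR_ge0.
    - move=> u /=; rewrite in_itv/= => /andP[u0 _]; rewrite lee_fin -powRD_pos// mulrA.
      by rewrite ler_wpM2r ?powR_ge0// p_le_kappa// ltW.
  under eq_integral do rewrite EFinM.
  rewrite ge0_integralZl ?lee_fin ?(ltW C0)//; last 2 first.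
  - by apply/measurable_EFinP; apply: measurable_funTS; exact: measurable_powR.
  - by move=> u _; rewrite lee_fin powR_ge0.
  apply: lte_mul_pinfty; rewrite ?lee_fin ?(ltW C0)//.
  have hq : - 1 < kappa + (- 2 - gamma) by move: kappa_gt; lra.
  exact: le_lt_trans (integral_powR_0a ltr01 hq) (ltry _).
apply: (@le_lt_trans _ _ (\int[mu]_(u in `[1%R, +oo[) (C * u `^ (alpha + (- 2 - gamma)))%:E)%E).
  apply: (@le_trans _ _ (\int[mu]_(u in `]1%R, +oo[) (C * u `^ (alpha + (- 2 - gamma)))%:E)%E).
    apply: ge0_le_integral => //; [|exact: mf|exact: mq|].
    - by move=> u _; rewrite lee_fin mulr_ge0 ?powR_ge0.
    - move=> u /=; rewrite in_itv/= andbT => u1; have u0 : 0 < u by exact: lt_trans u1.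
      rewrite lee_fin -powRD_pos// mulrA.
      by rewrite ler_wpM2r ?powR_ge0// p_le_alpha// ltW.
  apply: ge0_subset_integral => //; first exact: mq.
  - by move=> u _; rewrite lee_fin mulr_ge0 ?powR_ge0// ltW.
  - by move=> u /=; rewrite !in_itv/= !andbT; exact: ltW.
under eq_integral do rewrite EFinM.
rewrite ge0_integralZl ?lee_fin ?(ltW C0)//; last 2 first.
- by apply/measurable_EFinP; apply: measurable_funTS; exact: measurable_powR.
- by move=> u _; rewrite lee_fin powR_ge0.
apply: lte_mul_pinfty; rewrite ?lee_fin ?(ltW C0)//.
have hq : alpha + (- 2 - gamma) < - 1 by move: alpha_lt; lra.
exact: le_lt_trans (integral_powR_ay ltr01 hq) (ltry _).
Qed.

(** On u <= r0 / F the majorant is at most C * (c * r0 / F) ^ kappa, while F ^ (2 + gamma) * |g' (F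
    * u)| integrates over the half-line to F ^ (1 + gamma) * g 0. The product is of order F ^ (1 +
    gamma - kappa), which tends to 0 because kappa > 1 + gamma. *)
Lemma power_majorant_small_jumps (r0 : R) (F : nat -> R) : 0 <= r0 -> (forall k, 1 <= F k) ->
  F k @[k --> \oo] --> +oo -> forall c : R, 0 < c ->
  (\int[mu]_(u in `]0%R, (r0 / F k)%R])
    (p (c * u) * (F k `^ (2 + gamma) * `|derive1 g (F k * u)|))%:E @[k --> \oo] --> 0)%E.
Proof.
move=> r00 F1 F_oo c c0.
have F0 k : 0 < F k by exact: lt_le_trans (F1 k).
pose B := C * (c * r0) `^ kappa.
have B0 : 0 <= B by rewrite mulr_ge0 ?powR_ge0// ltW.
have mdg : measurable_fun (`]0, +oo[ : set R) (fun r => (`|derive1 g r|)%:E).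
  apply/measurable_EFinP; apply: (measurableT_comp (@normr_measurable R setT)).
  exact: (measurable_trawl_derive hg).
have mscale k (q : R -> R) : measurable_fun (`]0, +oo[ : set R) q ->
    measurable_fun (`]0, +oo[ : set R) (fun u => q (F k * u)).
  move=> mq; apply: (@measurable_comp _ _ _ _ _ _ (`]0, +oo[%classic : set R) q) => //.
  by move=> _ [u /= +] <-; rewrite !in_itv/= !andbT; exact: mulr_gt0.
have mdgF k : measurable_fun (`]0, +oo[ : set R) (fun u => `|derive1 g (F k * u)|).
  by apply: (mscale k (fun r => `|derive1 g r|)); exact/measurable_EFinP.
have bound k : (\int[mu]_(u in `]0%R, (r0 / F k)%R])
    (p (c * u) * (F k `^ (2 + gamma) * `|derive1 g (F k * u)|))%:E <=
    (B * g 0 * (F k `^ (kappa - (1 + gamma)))^-1)%:E)%E.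
  (* A bounds p (c * u) * F ^ (2 + gamma) on the interval, so only |g' (F * u)| is left to
     integrate. *)
  pose A := (B * F k `^ (2 + gamma - kappa))%R.
  have A0 : 0 <= A by rewrite mulr_ge0 ?powR_ge0.
  have sub : `]0%R, (r0 / F k)%R]%classic `<=` (`]0%R, +oo[%classic : set R).
    by move=> u /=; rewrite !in_itv/= andbT => /andP[].
  apply: (@le_trans _ _ (\int[mu]_(u in `]0%R, +oo[) (A%:E * (`|derive1 g (F k * u)|)%:E))%E).
    apply: (@le_trans _ _ (\int[mu]_(u in `]0%R, (r0 / F k)%R]) (A%:E * (`|derive1 g (F k * u)|)%:E))%E); last first.
      apply: ge0_subset_integral => //; first by apply: measurable_funeM; apply/measurable_EFinP; exact: mdgF.
      by move=> u _; rewrite mule_ge0 ?lee_fin.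
    apply: ge0_le_integral => //.
    - by move=> u _; rewrite lee_fin mulr_ge0 ?p_ge0// mulr_ge0 ?powR_ge0.
    - apply/measurable_EFinP; apply: measurable_funM.
        apply: measurable_funTS; apply: (measurableT_comp measurable_power_majorant).
        exact: measurable_funM.
      by apply: measurable_funM => //; exact: measurable_funS (mdgF k).
    - by apply: measurable_funeM; apply/measurable_EFinP; exact: measurable_funS (mdgF k).
    - move=> u /=; rewrite in_itv/= => /andP[u0 ur].
      rewrite -EFinM lee_fin mulrA ler_wpM2r//.
      have -> : A = (C * (c * r0 / F k) `^ kappa * F k `^ (2 + gamma))%R.
        rewrite /A /B -(powRD_pos (2 + gamma) (- kappa) (F0 k)) powRN.
        rewrite (powRM kappa (mulr_ge0 (ltW c0) r00)) ?invr_ge0 ?(ltW (F0 k))//.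
        by rewrite -[(F k)^-1]powR_inv1 ?(ltW (F0 k))// -powRrM mulN1r powRN; ring.
      have cu0 : 0 <= c * u by rewrite mulr_ge0 ?(ltW c0) ?(ltW u0).
      rewrite ler_wpM2r ?powR_ge0// (le_trans (p_le_kappa cu0))//.
      rewrite ler_wpM2l ?(ltW C0)// ge0_ler_powR ?nnegrE//.
      + by rewrite divr_ge0 ?mulr_ge0 ?(ltW c0)// ltW.
      + by rewrite -mulrA ler_wpM2l// ltW.
  rewrite ge0_integralZl ?lee_fin//; last by apply/measurable_EFinP; exact: mdgF.
  have := integral_trawl_derive hg.
  rewrite (ge0_integral_itv0y_scale (F0 k) mdg); last by move=> x _; rewrite lee_fin.
  set J := (\int[mu]_(_ in _) _)%E => hJ.
  have -> : (B * g 0 * (F k `^ (kappa - (1 + gamma)))^-1)%:E =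
      ((B * (F k `^ (kappa - (1 + gamma)))^-1)%:E * ((F k)%:E * J))%E.
    by rewrite hJ -EFinM mulrAC.
  rewrite muleA -EFinM le_eqVlt; apply/orP; left; apply/eqP; congr (_%:E * _)%E.
  rewrite /A -[RHS]mulrA; congr (B * _).
  transitivity (F k `^ (- (kappa - (1 + gamma))) * F k `^ 1).
    by rewrite powRD_pos//; congr (_ `^ _); ring.
  by rewrite powRN powRr1// ltW.
apply: (@squeeze_cvge _ _ _ _ (cst 0%E) _ (fun k => (B * g 0 * (F k `^ (kappa - (1 + gamma)))^-1)%:E)).
- apply: nearW => k; rewrite bound andbT; apply: integral_ge0 => u _.
  by rewrite lee_fin mulr_ge0 ?p_ge0// mulr_ge0 ?powR_ge0.
- exact: cvg_cst.
- apply: cvg_EFin; first exact: nearW.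
  rewrite -[X in _ --> X](mulr0 (B * g 0)); apply: cvgMl_tmp.
  apply/gtr0_cvgV0; first by apply: nearW => k; rewrite powR_gt0.
  by apply: powR_cvgy => //; rewrite subr_gt0.
Qed.

End power_majorant.

(** * The two alternative conditions on the exponent *)

Theorem theorem2p6 (R : realType) (d : measure_display)
    (Omega : measurableType d) (P : probability Omega R)
    (nu : {measure set R -> \bar R})
    (Lambda : set (R * R) -> {RV P >-> R})
    (gamma : R) (g : R -> R) (X : R -> Omega -> R)
    (hnu : symmetric_levy_measure nu) (hnu0 : nu [set: R] <> 0%E)
    (hLambda : homogeneous_levy_basis nu Lambda)
    (hgamma0 : 0 < gamma) (hgamma1 : gamma < 1)
    (hg : trawl_function gamma g)
    (hX : trawl_process Lambda g X)
    (hpsi :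
      (exists kappa alpha C : R,
        [/\ 1 + gamma < kappa <= 2, 0 <= alpha < 1 + gamma, 0 < C &
          forall u : R, levy_exponent nu u <=
            C * Num.min (`|u| `^ kappa) (`|u| `^ alpha)])
      \/
      [/\ (forall u v : R, 0 <= u -> u <= v ->
            levy_exponent nu u <= levy_exponent nu v),
          (\int[@lebesgue_measure R]_u
            (levy_exponent nu u * `|u| `^ (- 2 - gamma))%:E < +oo)%E &
          exists2 C : R, 0 < C &
            forall u : R, 0 < u -> u `^ (2 + gamma) * `|(derive1 g) u| <= C]) :
  exists2 K : R, 0 < K &
    forall (d' : measure_display) (Omega' : measurableType d')
      (P' : probability Omega' R) (xi : R -> {RV P' >-> R}),
      symmetric_stable_levy_process (1 + gamma) xi ->
      fdd_cvg P P' (normalized_integral gamma X)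
        (fun t w => K * xi t w).
Proof.
have hpsi_meas := measurable_levy_exponent hnu.
case: hpsi => [[kappa [alpha [C [/andP[kappa_gt _] /andP[alpha0 alpha_lt] C0 hC]]]]|[psi_nd psi_int [C C0 hC]]].
  (* Case (i): only the tail of g' is controlled, so a threshold r0 appears and the decay of the
     power majorant at 0 handles the small jumps. *)
  have [D [r0 [D0 r00 dg_le]]] := trawl_derive_tail_bound hg.
  apply: (fdd_cvg_trawl hnu hnu0 hLambda hgamma0 hg hX (p := power_majorant kappa alpha C) D0 r00
    (measurable_power_majorant _ _ _) _ _ _ dg_le).
  - exact: (power_majorant_nd hgamma0).
  - by move=> u; rewrite /power_majorant normr_id.
  - exact: power_majorant_fin.
  - by move=> F F1 F_oo c c0; exact: (power_majorant_small_jumps hgamma0 hg).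
(* Case (ii): the bound on g' holds on the whole half-line, so the threshold is 0 and psi is its own
   majorant. *)
have dg_le r : 0 < r -> `|derive1 g r| <= C * r `^ (- 2 - gamma).
  move=> r0_gt; have -> : - 2 - gamma = - (2 + gamma) by ring.
  by rewrite powRN ler_pdivlMr ?powR_gt0// mulrC hC.
apply: (fdd_cvg_trawl hnu hnu0 hLambda hgamma0 hg hX (p := levy_exponent nu) (ltW C0) (lexx 0)
  hpsi_meas psi_nd _ _ dg_le).
- by move=> u; rewrite levy_exponent_norm.
- apply: le_lt_trans psi_int.
  apply: (@le_trans _ _ (\int[@lebesgue_measure R]_(u in `]0%R, +oo[)
      (levy_exponent nu u * `|u| `^ (- 2 - gamma))%:E)%E).
    rewrite le_eqVlt; apply/orP; left; apply/eqP; apply: eq_integral => u.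
    by rewrite inE/= in_itv/= andbT => u0; rewrite gtr0_norm.
  apply: ge0_subset_integral => //.
  + apply/measurable_EFinP; apply: measurable_funM => //.
    exact: (measurableT_comp (@measurable_powR R _) (@normr_measurable R setT)).
  + by move=> u _; rewrite lee_fin mulr_ge0 ?levy_exponent_ge0 ?powR_ge0.
(* With threshold 0 the interval ]0, 0] of small jumps is empty. *)
- move=> F _ _ c _; apply: cvg_near_cst; apply: nearW => k.
  by rewrite mul0r set_itvoc0 integral_set0.
Qed.
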